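(* Suppose that there is a constant $C_{up}>0$ such that the weight function $\alpha$ satisfies, for every interior facet $F\in\mathcal F_h^\circ$ and every $x\in F$, $$-\bm\beta(x)\cdot\bm n^+(x)\,\bigl(\alpha^+(x)-\alpha^-(x)\bigr)\ \ge\ C_{up}\,|\bm\beta(x)\cdot\bm n(x)|,$$ and that the parameters $\delta_T\ge 0$ satisfy, for each $T\in\mathcal T_h$, $$\delta_T\le\min\Bigl\{\frac{h_T^2}{2C_{inv}^2\varepsilon},\ \frac{\rho_0}{2\|\gamma\|_{L^\infty(T)}^2}\Bigr\}$$ (the second entry being read as $+\infty$ if $\gamma=0$ on $T$). Then the bilinear form $$a_h(\bm u_h,\bm v_h)=(\varepsilon\nabla\times\bm u_h,\nabla\times\bm v_h)+(\tilde L_{\bm\beta,h}\bm u_h+\gamma\bm u_h,\bm v_h)+\sum_{T\in\mathcal T_h}(\tilde{\mathcal A}_h\bm u_h,\delta_T\tilde L_{\bm\beta,h}\bm v_h)_T$$ is coercive on $\bm V_h$ with respect to the energy norm: $$a_h(\bm v_h,\bm v_h)\ \ge\ \frac12\,|\!|\!|\bm v_h|\!|\!|_h^2\qquad\forall\,\bm v_h\in\bm V_h .$$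
   Context: Data: $\Omega\subset\mathbb R^3$ is a bounded Lipschitz polyhedral domain with boundary $\Gamma$ and unit outward normal $\bm n$; $\varepsilon>0$ is a constant; $\bm\beta\in(W^{1,\infty}(\Omega))^3$; $\gamma\in L^\infty(\Omega)$. $\Gamma^+=\{x\in\Gamma:\bm\beta\cdot\bm n\ge0\}$, $\Gamma^-=\{x\in\Gamma:\bm\beta\cdot\bm n<0\}$. Standing assumption: there is a constant $\rho_0>0$ with $$\lambda_{\min}\Bigl[\bigl(\gamma-\tfrac{\nabla\cdot\bm\beta}{2}\bigr)I+\tfrac{\nabla\bm\beta+(\nabla\bm\beta)^T}{2}\Bigr](x)\ge\rho_0\quad\text{for (almost) all }x\in\Omega,$$ where $\lambda_{\min}$ denotes the smallest eigenvalue. Mesh: $\mathcal T_h$ belongs to a shape-regular family of (conforming, simplicial) triangulations of $\Omega$ such that each open boundary facet lies entirely in $\Gamma^+$ or in $\Gamma^-$; $\mathcal F_h^\circ$ and $\mathcal F_h^\partial$ are the sets of interior and boundary facets, and $\mathcal F_h^\pm$ are the boundary facets contained in $\Gamma^\pm$. $h_T$ is the diameter of $T$. $(\cdot,\cdot)_D$ and $\langle\cdot,\cdot\rangle_F$ denote $L^2$-inner products on $D$ and on a facet $F$ (subscript omitted for $\Omega$), $\|\cdot\|_{0,T}$ is the $L^2(T)$ norm, $\|\cdot\|_0$ the $L^2(\Omega)$ norm. Jumps and weights: each interior facet is shared by two elements arbitrarily labelled $T^+,T^-$, with unit normals $\bm n^\pm$ outward to $T^\pm$; in expressions like $|\bm\beta\cdot\bm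 n|$ either normal may be used. $[\![\bm v]\!]=\bm v^+-\bm v^-$ on interior facets; on boundary facets $\bm n^+:=\bm n$ and $[\![\bm v]\!]=\bm v$. The weight $\alpha$ is a bounded function which on interior facets takes two values $\alpha^\pm(x)$ (from $T^\pm$) with $\alpha^++\alpha^-=1$, and on the boundary $\alpha|_{\Gamma^+}=0$, $\alpha|_{\Gamma^-}=1$; $[\alpha]=\alpha^+-\alpha^-$. $\alpha|_{\partial T}$ denotes the value of $\alpha$ seen from $T$. Discrete space: $\bm V_h$ is an $\bm H(\mathrm{curl})$-conforming finite element space on $\mathcal T_h$, consisting of piecewise polynomials of a fixed maximal degree. $C_{inv}$ is a constant independent of $h_T$ such that $\|\nabla\times(\nabla\times\bm v_h)\|_{0,T}\le C_{inv}h_T^{-1}\|\nabla\times\bm v_h\|_{0,T}$ for all $\bm v_h\in\bm V_h$, $T\in\mathcal T_h$. Operators: $L_{\bm\beta}\bm u:=-\bm\beta\times(\nabla\times\bm u)+\nabla(\bm\beta\cdot\bm u)$, and $L_{\bm\beta,h}$ is $L_{\bm\beta}$ applied elementwise. The lifting $\bm r_\alpha$ is defined elementwise: $\bm r_\alpha|_T(\bm v)\in\bm V_h|_T$ satisfies $\int_T\bm r_\alpha(\bm v)\cdot\bm w_h\,dx=\int_{\partial T}\alpha|_{\partial T}\,\bm v\cdot\bm w_h\,ds$ for all $\bm w_h\in\bm V_h|_T$. On each $T$, $\tilde L_{\bm\beta,h}\bm u:=L_{\bm\beta,h}\bm u-\bm r_\alpha(\bm\beta\cdot\bm n^+[\![\bm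 u]\!])$, where on each facet $\bm n^+$ and $[\![\cdot]\!]$ are as fixed above. Elementwise, $\tilde{\mathcal A}_h\bm u:=\nabla\times(\varepsilon\nabla\times\bm u)+\tilde L_{\bm\beta,h}\bm u+\gamma\bm u$. Energy norm: $$|\!|\!|\bm u|\!|\!|_h^2:=\varepsilon\|\nabla\times\bm u\|_0^2+\rho_0\|\bm u\|_0^2+\sum_{T\in\mathcal T_h}\delta_T\|\tilde L_{\bm\beta,h}\bm u\|_{0,T}^2+\frac12\sum_{F\in\mathcal F_h^\circ}\langle|[\alpha]\bm\beta\cdot\bm n|,|[\![\bm u]\!]|^2\rangle_F+\frac12\sum_{F\in\mathcal F_h^\partial}\langle|\bm\beta\cdot\bm n|,|\bm u|^2\rangle_F .$$ *)

(* Defs.v *)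
From HB Require Import structures.
From mathcomp Require Import all_boot all_order all_algebra.
From mathcomp Require Import all_classical all_reals all_analysis.
From mathcomp Require Import measurable_realfun.

Set Implicit Arguments.
Unset Strict Implicit.
Unset Printing Implicit Defensive.

Import Order.TTheory GRing.Theory Num.Theory.
Import numFieldNormedType.Exports.

Local Open Scope classical_set_scope.
Local Open Scope ring_scope.

Notation vec R := 'rV[R]_3.

Section EuclideanSpace.
Context {R : realType}.
Implicit Types (u v x y : vec R) (D : set (vec R)).

Definition dot u v : R := \sum_(i < 3) u 0 i * v 0 i.

(* The library norm on matrices is the maximum norm. *)
Definition enorm u : R := Num.sqrt (dot u u).

(* Indices are added in 'I_3, that is, modulo 3. *)
Definition cross u v : vec R :=
  \row_(i < 3) (u 0 (i + 1) * v 0 (i + 2) - u 0 (i + 2) * v 0 (i + 1)).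

Definition partial (j : 'I_3) (f : vec R -> R) (x : vec R) : R :=
  'D_(delta_mx 0 j) f x.

Definition curl (f : vec R -> vec R) (x : vec R) : vec R :=
  \row_(i < 3) (partial (i + 1) (fun y => f y 0 (i + 2)) x
                - partial (i + 2) (fun y => f y 0 (i + 1)) x).

Definition bnd D : set (vec R) := closure D `\` D°.

Definition diam D : R := sup [set enorm (x - y) | x in D & y in D].

(* Diameter of the largest ball contained in D. *)
Definition indiam D : R :=
  sup [set d | exists c r, [/\ 0 <= r, d = 2 * r
                           & [set y | enorm (y - c) <= r] `<=` D]].

Definition hull n (p : 'I_n -> vec R) : set (vec R) :=
  [set x | exists l : 'I_n -> R, [/\ forall i, 0 <= l i,
     \sum_i l i = 1 & x = \sum_i l i *: p i]].

Definition open_hull n (p : 'I_n -> vec R) : set (vec R) :=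
  [set x | exists l : 'I_n -> R, [/\ forall i, 0 < l i,
     \sum_i l i = 1 & x = \sum_i l i *: p i]].

(* For real symmetric matrices, whose spectrum is finite and nonempty, the
   infimum is the smallest eigenvalue. *)
Definition lambda_min (A : 'M[R]_3) : R := inf [set a | eigenvalue A a].

End EuclideanSpace.

Section Domain.
Context {R : realType}.

(* Near every boundary point, in some orthonormal coordinates, the set is the
   part lying strictly above the graph of a Lipschitz function. *)
Definition lipschitz_boundary (D : set (vec R)) : Prop :=
  forall x, bnd D x ->
  exists (Q : 'M[R]_3) (r L : R) (phi : R -> R -> R),
  [/\ Q *m Q^T = 1%:M, 0 < r,
      forall a b c d, `|phi a b - phi c d| <= L * (`|a - c| + `|b - d|)
    & forall y, enorm (y - x) < r ->
        (D y <-> phi ((y *m Q) 0 0) ((y *m Q) 0 1) < (y *m Q) 0 2)].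

Definition polyhedral_boundary (D : set (vec R)) : Prop :=
  exists n (nu : 'I_n -> vec R) (c : 'I_n -> R),
    (forall i, nu i != 0)
    /\ bnd D `<=` \bigcup_i [set x | dot (nu i) x = c i].

Definition lipschitz_polyhedral_domain (D : set (vec R)) : Prop :=
  [/\ open D, D !=set0, connected D & bounded_set D]
  /\ lipschitz_boundary D /\ polyhedral_boundary D.

End Domain.

(* The sigma-finite instance that the library declares for product measures is
   shadowed by the one for products of subprobabilities; it is redeclared below
   for the Lebesgue measures on R^2 and R^3. *)
Lemma sigma_finite_product_measure d1 d2 (T1 : measurableType d1)
    (T2 : measurableType d2) (R : realType)
    (m1 : {sigma_finite_measure set T1 -> \bar R})
    (m2 : {sigma_finite_measure set T2 -> \bar R}) :
  sigma_finite [set: T1 * T2] (m1 \x m2)%E.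
Proof.
have /sigma_finiteP[F [TF ndF Foo]] := sigma_finiteT m1.
have /sigma_finiteP[G [TG ndG Goo]] := sigma_finiteT m2.
exists (fun n => F n `*` G n).
  rewrite -setXTT TF TG predeqE => -[x y]; split.
    move=> [/= [n _ Fnx] [k _ Gky]]; exists (maxn n k) => //; split.
    - by move: x Fnx; exact/subsetPset/ndF/leq_maxl.
    - by move: y Gky; exact/subsetPset/ndG/leq_maxr.
  by move=> [n _ []/= ? ?]; split; exists n.
move=> k; have [? ?] := Foo k; have [? ?] := Goo k.
split; first exact: measurableX.
by rewrite product_measure1E// lte_mul_pinfty// ge0_fin_numE.
Qed.

Section LebesgueMeasures.
Context (R : realType).

Definition leb2 : set (measurableTypeR R * measurableTypeR R) -> \bar R :=
  (@lebesgue_measure R \x @lebesgue_measure R)%E.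

HB.instance Definition _ := Measure.on leb2.
HB.instance Definition _ := Measure_isSigmaFinite.Build _ _ _ leb2
  (sigma_finite_product_measure lebesgue_measure lebesgue_measure).

Definition leb3 :
    set (measurableTypeR R * measurableTypeR R * measurableTypeR R) -> \bar R :=
  (leb2 \x @lebesgue_measure R)%E.

HB.instance Definition _ := Measure.on leb3.
HB.instance Definition _ := Measure_isSigmaFinite.Build _ _ _ leb3
  (sigma_finite_product_measure leb2 lebesgue_measure).

End LebesgueMeasures.
Arguments leb2 R : clear implicits.
Arguments leb3 R : clear implicits.

Section Integration.
Context {R : realType}.

(* The library has no measurable structure on row vectors: measure-theoretic
   notions on R^3 are transported along this bijection. *)
Definition point3 (p : R * R * R) : vec R :=
  \row_(i < 3) [:: p.1.1; p.1.2; p.2]`_i.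

Definition int3 (D : set (vec R)) (f : vec R -> R) : R :=
  \int[leb3 R]_(p in point3 @^-1` D) f (point3 p).

Definition measurable3 (D : set (vec R)) (f : vec R -> R) : Prop :=
  measurable_fun (point3 @^-1` D) (f \o point3).

Definition integrable3 (D : set (vec R)) (f : vec R -> R) : Prop :=
  (leb3 R).-integrable (point3 @^-1` D) (EFin \o (f \o point3)).

Definition locally_integrable3 (D : set (vec R)) (f : vec R -> R) : Prop :=
  forall K, compact K -> K `<=` D -> integrable3 K f.

Definition ae3 (D P : set (vec R)) : Prop :=
  {ae leb3 R, forall p, D (point3 p) -> P (point3 p)}.

Definition L2ip (D : set (vec R)) (f g : vec R -> vec R) : R :=
  int3 D (fun x => dot (f x) (g x)).

Definition L2norm (D : set (vec R)) (f : vec R -> vec R) : R :=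
  Num.sqrt (L2ip D f f).

Definition Linfty_norm (D : set (vec R)) (f : vec R -> R) : \bar R :=
  'N[leb3 R]_(+oo%E)[EFin \o ((f \o point3) \_ (point3 @^-1` D))]%E.

Definition Linfty (D : set (vec R)) (f : vec R -> R) : Prop :=
  measurable3 D f /\ (Linfty_norm D f < +oo)%E.

Definition square_integrable (D : set (vec R)) (f : vec R -> R) : Prop :=
  measurable3 D f /\ integrable3 D (fun x => f x ^+ 2).

End Integration.

Section WeakDerivatives.
Context {R : realType}.

(* Functions of class C^1 with compact support in D: testing first-order weak
   derivatives against C^1_c or against C^oo_c is equivalent. *)
Definition test_function (D : set (vec R)) (phi : vec R -> R) : Prop :=
  [/\ forall x j, derivable phi x (delta_mx 0 j),
      forall j, continuous (partial j phi)
    & exists K, [/\ compact K, K `<=` D & forall x, ~ K x -> phi x = 0]].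

Definition is_weak_partial (D : set (vec R)) (j : 'I_3) (f g : vec R -> R)
    : Prop :=
  locally_integrable3 D g /\
  forall phi, test_function D phi ->
    int3 D (fun x => f x * partial j phi x)
    = - int3 D (fun x => g x * phi x).

(* Weak partial derivatives are unique almost everywhere; a representative is
   chosen. *)
Definition weak_partial (D : set (vec R)) (j : 'I_3) (f : vec R -> R)
    : vec R -> R :=
  xget (cst 0) [set g | is_weak_partial D j f g].

Definition weak_grad (D : set (vec R)) (f : vec R -> R) (x : vec R) : vec R :=
  \row_(j < 3) weak_partial D j f x.

Definition weak_jacobian (D : set (vec R)) (f : vec R -> vec R) (x : vec R)
    : 'M[R]_3 :=
  \matrix_(i < 3, j < 3) weak_partial D j (fun y => f y 0 i) x.

Definition weak_div (D : set (vec R)) (f : vec R -> vec R) (x : vec R) : R :=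
  \sum_(i < 3) weak_partial D i (fun y => f y 0 i) x.

(* Pointwise values are those of the given function f, which is not taken up
   to null sets: continuity of the representative is stated separately. *)
Definition W1infty (D : set (vec R)) (f : vec R -> R) : Prop :=
  Linfty D f /\ forall j, exists g, is_weak_partial D j f g /\ Linfty D g.

End WeakDerivatives.

Record mesh (R : realType) := Mesh {
  nelem : nat;
  vtx : 'I_nelem -> 'I_4 -> vec R
}.

(* The side (t, i) is the facet of the element t opposite to its i-th vertex,
   seen from t: an interior facet is represented by two sides. *)
Notation side M := ('I_(nelem M) * 'I_4)%type.

(* Elementwise defined vector fields: v t is the field on the element t, and
   v t x for x on the boundary of t is its trace from t. *)
Definition bfield (R : realType) (M : mesh R) : Type :=
  'I_(nelem M) -> vec R -> vec R.

Section Mesh.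
Context {R : realType} (Omega : set (vec R)) (M : mesh R).

Definition elem (t : 'I_(nelem M)) : set (vec R) := hull (vtx t).

(* Volume integrals are taken over open elements, which is immaterial since
   the boundary of a simplex is a null set. *)
Definition oelem (t : 'I_(nelem M)) : set (vec R) := (elem t)°.

Definition fvtx (s : side M) (j : 'I_3) : vec R := vtx s.1 (lift s.2 j).

Definition facet (s : side M) : set (vec R) := hull (fvtx s).
Definition ofacet (s : side M) : set (vec R) := open_hull (fvtx s).

Definition facet_cross (s : side M) : vec R :=
  cross (fvtx s 1 - fvtx s 0) (fvtx s 2 - fvtx s 0).

(* Unit normal to the side s, outward to the element s.1. *)
Definition normal (s : side M) : vec R :=
  - (Num.sg (dot (facet_cross s) (vtx s.1 s.2 - fvtx s 0))
     / enorm (facet_cross s)) *: facet_cross s.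

Definition ref_triangle : set (R * R) :=
  [set p | [/\ 0 <= p.1, 0 <= p.2 & p.1 + p.2 <= 1]].

Definition facet_param (s : side M) (p : R * R) : vec R :=
  fvtx s 0 + p.1 *: (fvtx s 1 - fvtx s 0) + p.2 *: (fvtx s 2 - fvtx s 0).

(* Surface integral, through the affine parametrization of the facet. *)
Definition facet_int (s : side M) (f : vec R -> R) : R :=
  enorm (facet_cross s)
  * \int[leb2 R]_(p in ref_triangle) f (facet_param s p).

Definition boundary_facet (s : side M) : bool := `[< facet s `<=` bnd Omega >].

(* The same facet seen from the other element, for an interior facet. *)
Definition neighbour (s : side M) : option (side M) :=
  if boundary_facet s then None
  else [pick s' : side M | (s'.1 != s.1) && `[< facet s' = facet s >]].

(* Conformity: every facet lies on the boundary or is also a facet of another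
   element (elements do not overlap). *)
Definition conforming_triangulation : Prop :=
  [/\ forall t : 'I_(nelem M),
        \det (\matrix_(i < 3) (vtx t (lift 0 i) - vtx t 0)) != 0,
      closure Omega = \bigcup_t elem t,
      forall t t' : 'I_(nelem M), t != t' ->
        (elem t)° `&` (elem t')° = set0
    & forall s : side M, facet s `<=` bnd Omega \/
        exists s' : side M, s'.1 != s.1 /\ facet s' = facet s].

Definition shape_regular (sigma : R) : Prop :=
  forall t : 'I_(nelem M), diam (elem t) <= sigma * indiam (elem t).

(* lab s holds when the element s.1 is the one labelled T^+ for that facet;
   the values of lab on boundary facets are never used. *)
Definition labelling (lab : side M -> bool) : Prop :=
  forall s s', neighbour s = Some s' -> lab s' = ~~ lab s.

(* Inner product of L^2(Omega) for elementwise defined fields. *)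
Definition bip (f g : bfield M) : R := \sum_t L2ip (oelem t) (f t) (g t).

Definition bcurl (v : bfield M) : bfield M := fun t => curl (v t).

(* A (total) polynomial function of degree at most k. *)
Definition poly_deg_le (k : nat) (f : vec R -> R) : Prop :=
  exists c : nat -> nat -> nat -> R, forall x,
    f x = \sum_(a < k.+1) \sum_(b < k.+1) \sum_(d < k.+1 | (a + b + d <= k)%N)
            c a b d * x 0 0 ^+ a * x 0 1 ^+ b * x 0 2 ^+ d.

(* The piecewise polynomial v has a square integrable weak curl on Omega; this
   weak curl then coincides a.e. with the elementwise curl bcurl v. *)
Definition in_Hcurl (v : bfield M) : Prop :=
  exists w : vec R -> vec R,
    (forall i, square_integrable Omega (fun x => w x 0 i)) /\
    forall phi : vec R -> vec R,
      (forall i, test_function Omega (fun x => phi x 0 i)) ->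
      bip v (fun _ => curl phi) = L2ip Omega w phi.

Definition Hcurl_conforming_space (k : nat) (Vh : set (bfield M)) : Prop :=
  [/\ Vh (fun _ _ => 0),
      forall (a : R) u v, Vh u -> Vh v -> Vh (fun t x => a *: u t x + v t x),
      forall v, Vh v -> forall t i, poly_deg_le k (fun x => v t x 0 i)
    & forall v, Vh v -> in_Hcurl v].

Definition inverse_inequality (Cinv : R) (Vh : set (bfield M)) : Prop :=
  forall v t, Vh v ->
    L2norm (oelem t) (curl (curl (v t)))
    <= Cinv * (diam (elem t))^-1 * L2norm (oelem t) (curl (v t)).

End Mesh.

Section Method.
Context {R : realType} (Omega : set (vec R)) (M : mesh R).
Context (eps rho0 : R) (beta : vec R -> vec R) (gamma : vec R -> R).
Context (lab : side M -> bool) (alpha : side M -> vec R -> R).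
Context (delta : 'I_(nelem M) -> R) (Vh : set (bfield M)).

Definition coercivity_assumption : Prop :=
  ae3 Omega [set x | rho0 <= lambda_min
    ((gamma x - weak_div Omega beta x / 2)%:M
     + 2^-1 *: (weak_jacobian Omega beta x + (weak_jacobian Omega beta x)^T))].

(* n^+ on the facet carrying the side s. *)
Definition nplus (s : side M) : vec R :=
  if neighbour Omega s is Some s' then
    (if lab s then normal s else normal s')
  else normal s.

Definition jump (v : bfield M) (s : side M) (x : vec R) : vec R :=
  if neighbour Omega s is Some s' then
    (if lab s then v s.1 x - v s'.1 x else v s'.1 x - v s.1 x)
  else v s.1 x.

(* alpha^+ - alpha^-, only used on interior facets. *)
Definition alpha_jump (s : side M) (x : vec R) : R :=
  if neighbour Omega s is Some s' then
    (if lab s then alpha s x - alpha s' x else alpha s' x - alpha s x)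
  else 0.

(* Interior facets, each represented once, by its side seen from T^+. *)
Definition interior_facet (s : side M) : bool :=
  (neighbour Omega s != None) && lab s.

(* Every open boundary facet lies entirely in Gamma^+ or in Gamma^-. On an open
   boundary facet the outward normal to Omega is that of the element. *)
Definition boundary_facets_split : Prop :=
  forall s : side M, boundary_facet Omega s ->
    (forall x, ofacet s x -> 0 <= dot (beta x) (normal s)) \/
    (forall x, ofacet s x -> dot (beta x) (normal s) < 0).

Definition weight_function : Prop :=
  [/\ exists C, forall s x, facet s x -> `|alpha s x| <= C,
      forall s, measurable_fun (@ref_triangle R) (alpha s \o facet_param s),
      forall s s', neighbour Omega s = Some s' ->
        forall x, facet s x -> alpha s x + alpha s' x = 1
    & forall s, boundary_facet Omega s -> forall x, ofacet s x ->
        alpha s x = if 0 <= dot (beta x) (normal s) then 0 else 1].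

(* g s is the datum to be lifted on the side s; in L2ip the polynomial r stands
   for its restriction to the element t. *)
Definition is_lifting (t : 'I_(nelem M)) (g : side M -> vec R -> vec R)
    (r : vec R -> vec R) : Prop :=
  (exists2 v, Vh v & r = v t) /\
  forall w, Vh w ->
    L2ip (oelem t) r (w t)
    = \sum_(i < 4) facet_int (t, i)
        (fun x => alpha (t, i) x * dot (g (t, i) x) (w t x)).

Definition lifting (g : side M -> vec R -> vec R) : bfield M :=
  fun t => xget (cst 0) [set r | is_lifting t g r].

Definition Lbeta (u : bfield M) : bfield M := fun t x =>
  - cross (beta x) (curl (u t) x)
  + weak_grad (oelem t) (fun y => dot (beta y) (u t y)) x.

Definition Ltilde (u : bfield M) : bfield M := fun t x =>
  Lbeta u t x
  - lifting (fun s y => dot (beta y) (nplus s) *: jump u s y) t x.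

Definition Atilde (u : bfield M) : bfield M := fun t x =>
  curl (fun y => eps *: curl (u t) y) x + Ltilde u t x + gamma x *: u t x.

Definition a_h (u v : bfield M) : R :=
  bip (fun t x => eps *: bcurl u t x) (bcurl v)
  + bip (fun t x => Ltilde u t x + gamma x *: u t x) v
  + \sum_t L2ip (oelem t) (Atilde u t) (fun x => delta t *: Ltilde v t x).

(* The square of the energy norm. *)
Definition energy_sq (u : bfield M) : R :=
  eps * bip (bcurl u) (bcurl u)
  + rho0 * bip u u
  + \sum_t delta t * L2norm (oelem t) (Ltilde u t) ^+ 2
  + 2^-1 * \sum_(s | interior_facet s) facet_int s
      (fun x => `|alpha_jump s x * dot (beta x) (normal s)|
                * enorm (jump u s x) ^+ 2)
  + 2^-1 * \sum_(s : side M | boundary_facet Omega s) facet_int s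
      (fun x => `|dot (beta x) (normal s)| * enorm (u s.1 x) ^+ 2).

(* The second entry is +oo when gamma vanishes a.e. on the element. *)
Definition delta_bound (Cinv : R) (t : 'I_(nelem M)) : \bar R :=
  Order.min
    (diam (elem t) ^+ 2 / (2 * Cinv ^+ 2 * eps))%:E
    (if Linfty_norm (oelem t) gamma == 0%E then +oo%E
     else (rho0 / (2 * fine (Linfty_norm (oelem t) gamma) ^+ 2))%:E).

End Method.

(* Main.v *)
(* On each element T the weak product rule gives, almost everywhere,
   (L_beta v + gamma v) . v = v^T S v + 1/2 div(|v|^2 beta) with
   S = (gamma - div(beta)/2) I + (grad(beta) + grad(beta)^T)/2, so that S >= rho_0
   and the divergence theorem bound the volume terms by rho_0 |v|^2 plus the flux
   1/2 <beta.n, |v|^2> through the faces of T.  By definition the lifting subtracts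
   <alpha beta.n^+, [v].v>.  Adding the contributions of the two sides of an interior
   facet leaves -1/2 <beta.n^+ [alpha], |[v]|^2>, which is nonnegative by the upwind
   condition; on the boundary the choice of alpha leaves 1/2 <|beta.n|, |v|^2>.  The
   cross terms (eps curl curl v, delta L v) and (gamma v, delta L v) of the
   stabilization are absorbed by Young's inequality, the inverse inequality and the
   two bounds on delta.

   The divergence theorem on T for a continuous F with weak derivative G is obtained
   by testing with products of C^1 ramps of the barycentric coordinates: the gradient
   of the cutoff concentrates in thin layers along the faces, and an affine change of
   variables flattens each layer onto its face. *)

(* The order matters: all_fingroup exports a constant [normal] which would otherwise
   hide the unit normal of Defs. *)
From mathcomp Require Import all_boot all_fingroup.
Require Import Defs.
From HB Require Import structures.
From mathcomp Require Import all_boot all_order all_algebra.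
From mathcomp Require Import all_classical all_reals all_analysis.
From mathcomp Require Import measurable_realfun ess_sup_inf ring lra zify.

Set Implicit Arguments.
Unset Strict Implicit.
Unset Printing Implicit Defensive.

Import Order.TTheory GRing.Theory Num.Theory.
Import numFieldNormedType.Exports.
Local Open Scope classical_set_scope.
Local Open Scope ring_scope.

(** * Lebesgue measure on R^3 and affine maps *)

(** Two objects of the method are chosen by [xget]: weak derivatives and the lifting. A chosen weak
    derivative says something only once weak derivatives are unique almost everywhere; this links
    the gradient of beta.v, taken on an element, with the derivatives of beta, taken on [Omega], and
    it is why boxes have to determine integrable functions. The lifting has its defining property
    only once some function has it, which is a Riesz representation in the finite-dimensional space
    of restrictions to the element.

    The factor 1/2 of the conclusion is the balance of the estimate. Each of the two cross terms
    takes a quarter of delta |L v|^2, so one half is left; the bounds on delta turn the remainders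
    into at most eps/2 |curl v|^2 and rho_0/2 |v|^2, half of what diffusion and advection supply.

    The two sides of an interior facet carry unrelated vertex orders. Their integrals are compared
    through an affine map of the reference triangle, and their normals are opposite because the
    elements do not overlap. *)

Lemma pushforward_is_measure d d' (T1 : measurableType d)
    (T2 : measurableType d') (R : realType) (m : {measure set T1 -> \bar R})
    (f : T1 -> T2) : measurable_fun setT f ->
  {pm : {measure set T2 -> \bar R} | pm = pushforward m f :> (set T2 -> \bar R)}.
Proof.
move=> mf.
by unshelve refine (exist _ (pushforward m f : {measure set T2 -> \bar R}) _).
Qed.

Section LinearChange.
Variable R : realType.
Notation mR := (measurableTypeR R).
Notation mu := (@lebesgue_measure R).

(** The left side is a measure in [S] that gives b - a on []a, b]], and Lebesgue measure is the only
    one. For negative [c] the preimage of such an interval is closed on the left and open on the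
    right. *)
Lemma lebesgue_measure_affine (c d : R) (S : set mR) : c != 0 ->
  measurable S -> (`|c|%:E * mu [set z | S (c * z + d)%R] = mu S)%E.
Proof.
move=> c0 mS.
have mf : measurable_fun [set: mR] (fun z : mR => c * z + d : mR).
  by apply: measurable_funD => //; apply: measurable_funM.
have [pm pmE] := pushforward_is_measure mu mf.
pose nu := mscale (NngNum (normr_ge0 c)) pm.
suff -> : mu S = nu S by rewrite /nu /mscale pmE /pushforward.
apply: lebesgue_measure_unique => //= _ [[a b] ab <-] /=.
rewrite /nu /mscale pmE /pushforward /= lebesgue_measure_itv /= lte_fin.
have [c_gt0|c_le0] := ltP 0 c.
  have -> : (fun z : R => c * z + d) @^-1` `]a, b]%classic
      = `](a - d) / c, (b - d) / c]%classic.
    apply/seteqP; split => z /=; rewrite !in_itv /=;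
    by rewrite ltr_pdivrMr // ler_pdivlMr // ltrBlDr lerBrDr mulrC.
  rewrite lebesgue_measure_itv /= lte_fin ltr_pM2r ?invr_gt0 // ltrD2r.
  case: ifP => _; rewrite ?mule0 // -EFinD -EFinM gtr0_norm //.
  congr (_%:E); by field.
have {}c_lt0 : c < 0 by rewrite lt_neqAle c0.
have -> : (fun z : R => c * z + d) @^-1` `]a, b]%classic
    = `[(b - d) / c, (a - d) / c[%classic.
  apply/seteqP; split => z /=; rewrite !in_itv /= ler_ndivrMr // ltr_ndivlMr //;
  by rewrite ltrBlDr lerBrDr mulrC andbC.
rewrite lebesgue_measure_itv /= lte_fin ltr_nM2r ?invr_lt0 // ltrD2r.
case: ifP => _; rewrite ?mule0 // -EFinD -EFinM ltr0_norm //.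
congr (_%:E); by field.
Qed.

Notation T3 := (mR * mR * mR)%type.

(** On each vertical section this is the one-dimensional map of slope [c] with an offset depending
    on the first two coordinates; [leb3] integrates the measures of the sections. *)
Lemma leb3_affine_last (a b c : R) (S : set T3) : c != 0 -> measurable S ->
  (`|c|%:E * leb3 R [set p | S (p.1, a * p.1.1 + b * p.1.2 + c * p.2)]%R
   = leb3 R S)%E.
Proof.
move=> c0 mS.
pose g := (fun p : T3 => (p.1, a * p.1.1 + b * p.1.2 + c * p.2) : T3).
have mg : measurable_fun [set: T3] g.
  apply/measurable_fun_pairP; split; first exact: measurable_fst.
  have m1 : measurable_fun [set: T3] (fun p : T3 => p.1.1 : mR).
    by apply: (measurableT_comp measurable_fst measurable_fst).
  have m2 : measurable_fun [set: T3] (fun p : T3 => p.1.2 : mR).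
    by apply: (measurableT_comp measurable_snd measurable_fst).
  apply: measurable_funD; last first.
    by apply: measurable_funM => //; exact: measurable_snd.
  by apply: measurable_funD; apply: measurable_funM.
have mT : measurable (g @^-1` S) by rewrite -[X in measurable X]setTI; apply: mg.
rewrite -[X in leb3 R X]/(g @^-1` S) /leb3 /product_measure1.
rewrite -ge0_integralZl //; last first.
  by have := measurable_fun_xsection (@lebesgue_measure R) mT; apply.
apply: eq_integral => p _ /=.
rewrite -[RHS](lebesgue_measure_affine (a * p.1 + b * p.2) c0); last first.
  exact: measurable_xsection.
congr (_ * mu _)%E; apply/seteqP; split => z /=; rewrite /xsection /= !inE /g /=;
by rewrite [c * z + _]addrC.
Qed.


Lemma leb2_swap (S : set (mR * mR)) : measurable S ->
  leb2 R [set q | S (q.2, q.1)] = leb2 R S.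
Proof.
move=> mS.
have [pm pmE] := pushforward_is_measure (leb2 R) (@measurable_swap _ _ mR mR).
have -> : leb2 R [set q | S (q.2, q.1)] = pm S by rewrite pmE.
apply/esym; apply: (@product_measure_unique _ _ _ _ _ mu mu) => // A B mA mB.
rewrite pmE /pushforward (_ : _ @^-1` _ = B `*` A); last first.
  by apply/seteqP; split => -[x y] /= [].
by apply: etrans (muleC _ _); exact: (product_measure1E mu mu).
Qed.

Lemma leb3_swap01 (S : set T3) : measurable S ->
  leb3 R [set p | S ((p.1.2, p.1.1), p.2)] = leb3 R S.
Proof.
move=> mS.
have mf : measurable_fun [set: T3] (fun p : T3 => ((p.1.2, p.1.1), p.2) : T3).
  apply/measurable_fun_pairP; split; last exact: measurable_snd.
  by apply: (measurableT_comp (@measurable_swap _ _ mR mR) measurable_fst).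
have [pm pmE] := pushforward_is_measure (leb3 R) mf.
have -> : leb3 R [set p | S ((p.1.2, p.1.1), p.2)] = pm S by rewrite pmE.
apply/esym; apply: (@product_measure_unique _ _ _ _ _ (leb2 R) mu) => // A B mA mB.
rewrite pmE /pushforward (_ : _ @^-1` _ = [set q | A (q.2, q.1)] `*` B); last first.
  by apply/seteqP; split => -[[x y] z] /= [].
apply: etrans (product_measure1E (leb2 R) mu _ mB) _; last first.
  by congr (_ * _)%E; exact: leb2_swap.

by have := @measurable_swap _ _ mR mR measurableT _ mA; rewrite setTI.
Qed.

(** Exchanging the last two coordinates mixes the two factors of [leb3], the plane and the line. Cut
    along the first coordinate it becomes an exchange within a plane. *)
Lemma leb3_slices (S : set T3) : measurable S ->
  leb3 R S = (\int[mu]_x leb2 R [set q | S ((x, q.1), q.2)])%E.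
Proof.
move=> mS; rewrite {1}/leb3 {1}/product_measure1.
rewrite [LHS](@fubini_tonelli1 _ _ _ _ _ mu mu); last 2 first.
  by have := measurable_fun_xsection mu mS; apply.
  by move=> q; exact: measure_ge0.
apply: eq_integral => x _; rewrite /fubini_F /leb2 /product_measure1.
by apply: eq_integral => y _ /=; congr mu.
Qed.

Lemma leb3_swap12 (S : set T3) : measurable S ->
  leb3 R [set p | S ((p.1.1, p.2), p.1.2)] = leb3 R S.
Proof.
move=> mS.
have mf : measurable_fun [set: T3] (fun p : T3 => ((p.1.1, p.2), p.1.2) : T3).
  apply/measurable_fun_pairP; split; last first.
    by apply: (measurableT_comp measurable_snd measurable_fst).
  apply/measurable_fun_pairP; split; last exact: measurable_snd.
  by apply: (measurableT_comp measurable_fst measurable_fst).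
have mS' := mf measurableT _ mS; rewrite setTI in mS'.
rewrite [LHS](leb3_slices mS') (leb3_slices mS).
apply: eq_integral => x _ /=.
rewrite -[RHS]leb2_swap //.
have mp : measurable_fun [set: mR * mR] (fun q : mR * mR => ((x, q.1), q.2) : T3).
  apply/measurable_fun_pairP; split; last exact: measurable_snd.
  by apply: (measurableT_comp (pair1_measurable x) measurable_fst).
by have := mp measurableT _ mS; rewrite setTI.
Qed.

Definition measurable_vset (S : set (vec R)) :=
  measurable (point3 @^-1` S : set T3).
Definition vol (S : set (vec R)) := leb3 R (point3 @^-1` S).

(** Stable under products, so that an LUP decomposition leaves only permutations and triangular
    matrices to check. Measurability of the preimage travels along because the product step needs
    it. *)
Definition scales_vol (A : 'M[R]_3) := forall S, measurable_vset S ->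
  measurable_vset [set x | S (x *m A)] /\
  (`|\det A|%:E * vol [set x | S (x *m A)%R] = vol S)%E.

Lemma scales_volM A B : scales_vol A -> scales_vol B -> scales_vol (A *m B).
Proof.
move=> hA hB S mS; have [mB eB] := hB S mS; have [mA eA] := hA _ mB.
have E : [set x | S (x *m (A *m B))] = [set x | [set y | S (y *m B)] (x *m A)].
  by apply/seteqP; split => x /=; rewrite mulmxA.
by rewrite E det_mulmx normrM mulrC EFinM -muleA eA eB; split.
Qed.

Lemma scales_vol_coord (A : 'M[R]_3) (g : T3 -> T3) :
  measurable_fun setT g -> (forall p, point3 p *m A = point3 (g p)) ->
  (forall S, measurable S -> (`|\det A|%:E * leb3 R (g @^-1` S) = leb3 R S)%E) ->
  scales_vol A.
Proof.
move=> mg gA h S mS.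
have E : point3 @^-1` [set x | S (x *m A)] = g @^-1` (point3 @^-1` S).
  by apply/seteqP; split => p /=; rewrite gA.
rewrite /measurable_vset /vol E; split; last exact: h.
by have := mg measurableT _ mS; rewrite setTI.
Qed.

Lemma forall_I3 (P : 'I_3 -> Prop) : P 0 -> P 1 -> P 2 -> forall i, P i.
Proof.
move=> P0 P1 P2 [[|[|[|//]]] h].
- by move: P0; congr P; apply: val_inj.
- by move: P1; congr P; apply: val_inj.
- by move: P2; congr P; apply: val_inj.
Qed.

Lemma sum_I3 (f : 'I_3 -> R) : \sum_(i < 3) f i = f 0 + f 1 + f 2.
Proof.
rewrite !big_ord_recr big_ord0 /= add0r.
by congr (f _ + f _ + f _); apply: val_inj.
Qed.

(* Identity with its j-th column replaced by that of A: it acts on a single coordinate,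
   so that Fubini reduces it to the one-dimensional change of variables. *)
Definition colrep (A : 'M[R]_3) j :=
  \matrix_(i, k) if k == j then A i j else (i == k)%:R.

Lemma det3 (A : 'M[R]_3) : \det A =
  A 0 0 * (A 1 1 * A 2 2 - A 1 2 * A 2 1)
  - A 0 1 * (A 1 0 * A 2 2 - A 1 2 * A 2 0)
  + A 0 2 * (A 1 0 * A 2 1 - A 1 1 * A 2 0).
Proof.
have E (j : 'I_3) : \sum_(i < 3) A j i * cofactor A j i = \det A
  by rewrite -expand_det_row.
rewrite -(E 0) sum_I3 /cofactor !(expand_det_row _ 0) !big_ord_recr !big_ord0 /=.
rewrite /cofactor !det_mx11 !mxE /=.
(* Indices are read as natural numbers, so that different presentations of one index become the same
   atom for [ring]. *)
pose a m n := A (inord m) (inord n).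
have e i j : A i j = a i j by rewrite /a !inord_val.
rewrite !e /= /bump /=; ring.
Qed.

Lemma scales_vol_colrep2 (A : 'M[R]_3) : A 2 2 != 0 -> scales_vol (colrep A 2).
Proof.
move=> c0.
pose g := (fun p : T3 => (p.1, A 0 2 * p.1.1 + A 1 2 * p.1.2 + A 2 2 * p.2) : T3).
have dE : \det (colrep A 2) = A 2 2 by rewrite det3 !mxE /=; ring.
apply: (@scales_vol_coord _ g).
- apply/measurable_fun_pairP; split; first exact: measurable_fst.
  have m1 : measurable_fun [set: T3] (fun p : T3 => p.1.1 : mR).
    by apply: (measurableT_comp measurable_fst measurable_fst).
  have m2 : measurable_fun [set: T3] (fun p : T3 => p.1.2 : mR).
    by apply: (measurableT_comp measurable_snd measurable_fst).
  apply: measurable_funD; last first.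
    by apply: measurable_funM => //; exact: measurable_snd.
  by apply: measurable_funD; apply: measurable_funM.
- move=> [[x y] z]; apply/rowP; apply: forall_I3; rewrite !mxE sum_I3 !mxE /=; ring.
- by move=> S mS; rewrite dE; exact: leb3_affine_last.
Qed.

Lemma tperm_I3 :
  [/\ tperm 0 1 0 = 1 :> 'I_3, tperm 0 1 1 = 0 :> 'I_3, tperm 0 1 2 = 2 :> 'I_3
    & [/\ tperm 1 2 0 = 0 :> 'I_3, tperm 1 2 1 = 2 :> 'I_3 & tperm 1 2 2 = 1 :> 'I_3]].
Proof. by rewrite !tpermL !tpermR !tpermD. Qed.

Lemma scales_vol_tperm01 : scales_vol (tperm_mx 0 1).
Proof.
have [t0 t1 t2 _] := tperm_I3.
apply: (@scales_vol_coord _ (fun p : T3 => ((p.1.2, p.1.1), p.2) : T3)).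
- apply/measurable_fun_pairP; split; last exact: measurable_snd.
  by apply: (measurableT_comp (@measurable_swap _ _ mR mR) measurable_fst).
- move=> [[x y] z]; apply/rowP; apply: forall_I3;
  rewrite !mxE sum_I3 !mxE /= ?t0 ?t1 ?t2 /=; ring.
- move=> S mS; rewrite det_perm; rewrite normrX normrN1 expr1n mul1e.
  exact: leb3_swap01.
Qed.

Lemma scales_vol_tperm12 : scales_vol (tperm_mx 1 2).
Proof.
have [_ _ _ [t0 t1 t2]] := tperm_I3.
apply: (@scales_vol_coord _ (fun p : T3 => ((p.1.1, p.2), p.1.2) : T3)).
- apply/measurable_fun_pairP; split; last first.
    by apply: (measurableT_comp measurable_snd measurable_fst).
  apply/measurable_fun_pairP; split; last exact: measurable_snd.
  by apply: (measurableT_comp measurable_fst measurable_fst).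
- move=> [[x y] z]; apply/rowP; apply: forall_I3;
  rewrite !mxE sum_I3 !mxE /= ?t0 ?t1 ?t2 /=; ring.
- move=> S mS; rewrite det_perm; rewrite normrX normrN1 expr1n mul1e.
  exact: leb3_swap12.
Qed.

Lemma scales_vol_tperm i j : scales_vol (tperm_mx i j).
Proof.
have h1 : scales_vol 1%:M.
  move=> S mS; have -> : [set x | S (x *m 1%:M)] = S.
    by apply/seteqP; split => x /=; rewrite mulmx1.
  by rewrite det1 normr1 mul1e.
have h02 : scales_vol (tperm_mx 0 2).
  have -> : tperm_mx 0 2 = tperm_mx 0 1 *m tperm_mx 1 2 *m tperm_mx 0 1 :> 'M[R]_3.
    rewrite -!perm_mxM; congr perm_mx.
    have := @tpermJ _ 1 2 (tperm 0 1 : {perm 'I_3}).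
    rewrite tpermR tpermD // => <-.
    by rewrite /conjg tpermV mulgA.
  apply: scales_volM; last exact: scales_vol_tperm01.
  by apply: scales_volM; [exact: scales_vol_tperm01|exact: scales_vol_tperm12].
have S k l : scales_vol (tperm_mx k l) -> scales_vol (tperm_mx l k).
  by rewrite /tperm_mx tpermC.
have D k : scales_vol (tperm_mx k k) by rewrite /tperm_mx tperm1 perm_mx1.
move: i j; apply: forall_I3; apply: forall_I3.
- exact: D.
- exact: scales_vol_tperm01.
- exact: h02.
- apply: S; exact: scales_vol_tperm01.
- exact: D.
- exact: scales_vol_tperm12.
- apply: S; exact: h02.
- apply: S; exact: scales_vol_tperm12.
- exact: D.
Qed.

Lemma scales_vol_perm (s : 'S_3) : scales_vol (perm_mx s).
Proof.
have [ts -> _] := prod_tpermP s.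
elim: ts => [|[i j] ts IH].
  rewrite big_nil perm_mx1 => S mS; have -> : [set x | S (x *m 1%:M)] = S.
    by apply/seteqP; split => x /=; rewrite mulmx1.
  by rewrite det1 normr1 mul1e.
by rewrite big_cons perm_mxM; apply: scales_volM; [exact: scales_vol_tperm|exact: IH].
Qed.

(** Conjugation by the transposition of [j] and 2 leads to the case of the last column. *)
Lemma scales_vol_colrep (A : 'M[R]_3) j : A j j != 0 -> scales_vol (colrep A j).
Proof.
move=> c0; pose s : 'S_3 := tperm j 2.
pose B := \matrix_(i, k) A (s i) (s k).
have -> : colrep A j = perm_mx s *m colrep B 2 *m perm_mx s.
  rewrite -row_permE.
  have -> : perm_mx s = perm_mx (s^-1)%g :> 'M[R]_3 by rewrite tpermV.
  rewrite -col_permE; apply/matrixP => i k; rewrite !mxE.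
  by rewrite /s !tpermK tpermR (inj_eq perm_inj) (can2_eq (tpermK _ _) (tpermK _ _)) tpermR.
apply: scales_volM; last exact: scales_vol_perm.
apply: scales_volM; first exact: scales_vol_perm.
by apply: scales_vol_colrep2; rewrite mxE /s tpermR.
Qed.

(** Coordinate j of [x *m A] involves only the coordinates of [x] from j on. Computing the
    coordinates in increasing order one at a time thus never reads an overwritten one; for upper
    triangular matrices the order is reversed. *)
Lemma scales_vol_lower (A : 'M[R]_3) : A 0 1 = 0 -> A 0 2 = 0 -> A 1 2 = 0 ->
  \det A != 0 -> scales_vol A.
Proof.
move=> a01 a02 a12; rewrite det3 a01 a02 a12.
have -> : A 0 0 * (A 1 1 * A 2 2 - 0 * A 2 1) - 0 * (A 1 0 * A 2 2 - 0 * A 2 0)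
  + 0 * (A 1 0 * A 2 1 - A 1 1 * A 2 0) = A 0 0 * A 1 1 * A 2 2 by ring.
rewrite !mulf_eq0 !negb_or => /andP[/andP[d0 d1] d2].
have -> : A = colrep A 0 *m colrep A 1 *m colrep A 2.
  apply/matrixP; apply: forall_I3; apply: forall_I3;
  rewrite !(mxE, sum_I3) /= ?a01 ?a02 ?a12; ring.
by apply: scales_volM; [apply: scales_volM|]; exact: scales_vol_colrep.
Qed.

Lemma scales_vol_upper (A : 'M[R]_3) : A 1 0 = 0 -> A 2 0 = 0 -> A 2 1 = 0 ->
  \det A != 0 -> scales_vol A.
Proof.
move=> a10 a20 a21; rewrite det3 a10 a20 a21.
have -> : A 0 0 * (A 1 1 * A 2 2 - A 1 2 * 0) - A 0 1 * (0 * A 2 2 - A 1 2 * 0)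
  + A 0 2 * (0 * 0 - A 1 1 * 0) = A 0 0 * A 1 1 * A 2 2 by ring.
rewrite !mulf_eq0 !negb_or => /andP[/andP[d0 d1] d2].
have -> : A = colrep A 2 *m colrep A 1 *m colrep A 0.
  apply/matrixP; apply: forall_I3; apply: forall_I3;
  rewrite !(mxE, sum_I3) /= ?a10 ?a20 ?a21; ring.
by apply: scales_volM; [apply: scales_volM|]; exact: scales_vol_colrep.
Qed.

Lemma scales_vol_unit (A : 'M[R]_3) : \det A != 0 -> scales_vol A.
Proof.
move=> dA.
have e : (cormen_lup A).1.1 *m A = (cormen_lup A).1.2 *m (cormen_lup A).2.
  have := cormen_lup_correct A; rewrite [cormen_lup A]surjective_pairing.
  by rewrite [(cormen_lup A).1]surjective_pairing.
have hP := cormen_lup_perm A.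
have dL := cormen_lup_detL A.
have hL := @cormen_lup_lower _ _ A; have hU := @cormen_lup_upper _ _ A.
move: (cormen_lup A) e hP dL hL hU => [[P L] U] e /is_perm_mxP[s Ps] dL hL hU.
rewrite /= in e Ps dL hL hU; rewrite Ps in e.
have e' : A = perm_mx s^-1 *m L *m U.
  rewrite -mulmxA -[L *m U]e mulmxA -perm_mxM.
  by rewrite mulVg perm_mx1 mul1mx.
have dU : \det U != 0.
  by apply: contra_neq dA => dU; rewrite e' det_mulmx dU mulr0.
rewrite e'; apply: scales_volM; [apply: scales_volM|].
- exact: scales_vol_perm.
- by apply: scales_vol_lower; rewrite ?dL ?oner_eq0 ?hL.
- by apply: scales_vol_upper; rewrite ?hU.
Qed.

End LinearChange.

(** * Change of variables for maps that scale a measure *)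

Section ScalingMap.
Context d (T : measurableType d) (R : realType).
Variables (mu : {measure set T -> \bar R}) (phi : T -> T) (k : R).
Hypotheses (mphi : measurable_fun setT phi) (k0 : 0 < k)
  (kphi : forall S, measurable S -> (k%:E * mu (phi @^-1` S) = mu S)%E).

(** By [kphi], [mu] is [k] times its own pushforward along [phi]. *)
Lemma ge0_integral_scaling (D : set T) (f : T -> \bar R) :
  measurable D -> measurable_fun D f -> (forall p, D p -> (0 <= f p)%E) ->
  (k%:E * \int[mu]_(p in phi @^-1` D) f (phi p) = \int[mu]_(p in D) f p)%E.
Proof.
move=> mD mf f0.
rewrite -[X in (_ * X)%E](@ge0_integral_pushforward _ _ _ _ _ _ mphi) //;
  last by move=> p /set_mem; exact: f0.
rewrite -[X in (X%:E * _)%E]/((NngNum (ltW k0))%:num).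
rewrite -ge0_integral_mscale //.
by apply: eq_measure_integral => S mS _; exact: kphi.
Qed.

Lemma measurable_preimage (D : set T) : measurable D -> measurable (phi @^-1` D).
Proof. by move=> mD; have := mphi measurableT mD; rewrite setTI. Qed.

Lemma integrable_scaling (D : set T) (f : T -> \bar R) : measurable D ->
  mu.-integrable D f -> mu.-integrable (phi @^-1` D) (f \o phi).
Proof.
move=> mD /integrableP[mf fi]; have mp := measurable_preimage mD.
apply/integrableP; split.
  apply: (measurable_comp mD _ mf); first by move=> _ [p Dp <-].
  exact: measurable_funTS mphi.
have e := @ge0_integral_scaling D (fun p => `|f p|%E) mD
  (measurableT_comp (@abse_measurable _ _) mf) (fun _ _ => abse_ge0 _).
rewrite -e in fi; rewrite ltNge; apply/negP; rewrite leye_eq => /eqP e'.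
by move: fi; rewrite e' gt0_muley // lte_fin.
Qed.

Lemma Rintegral_scaling (D : set T) (f : T -> R) : measurable D ->
  mu.-integrable D (EFin \o f) ->
  k * \int[mu]_(p in phi @^-1` D) f (phi p) = \int[mu]_(p in D) f p.
Proof.
move=> mD fi; have fi' := integrable_scaling mD fi.
have mf := measurable_int _ fi; have mp := measurable_preimage mD.
suff E : (k%:E * \int[mu]_(p in phi @^-1` D) (f (phi p))%:E
    = \int[mu]_(p in D) (f p)%:E)%E.
  by rewrite /Rintegral -E fineM //; exact: (integrable_fin_num mp fi').
rewrite [in RHS]integralE [X in (_ * X)%E]integralE muleBr //; last first.
  exact: (integrable_add_def mp fi').
congr (_ - _)%E.
- have := @ge0_integral_scaling D (EFin \o f)^\+%E mD (measurable_funepos mf)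
    (fun _ _ => funepos_ge0 _ _).
  move=> <-; congr (_ * _)%E; apply: eq_integral => p _.
  by rewrite -[RHS]/(((EFin \o f)^\+ \o phi) p)%E -funepos_comp.
- have := @ge0_integral_scaling D (EFin \o f)^\-%E mD (measurable_funeneg mf)
    (fun _ _ => funeneg_ge0 _ _).
  move=> <-; congr (_ * _)%E; apply: eq_integral => p _.
  by rewrite -[RHS]/(((EFin \o f)^\- \o phi) p)%E -funeneg_comp.
Qed.
End ScalingMap.

(** * Borel sets of R^3, translations and affine changes of variables *)

Section Borel.
Variable R : realType.
Notation mR := (measurableTypeR R).
Notation mu := (@lebesgue_measure R).
Notation T3 := (mR * mR * mR)%type.

Definition unpoint3 (x : vec R) : T3 := ((x 0 0, x 0 1), x 0 2).

Lemma point3K p : unpoint3 (point3 p) = p.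
Proof. by case: p => [[x y] z]; rewrite /unpoint3 !mxE. Qed.

Lemma unpoint3K x : point3 (unpoint3 x) = x.
Proof. by apply/rowP; apply: forall_I3; rewrite !mxE. Qed.

Lemma measurable_point3 i : measurable_fun [set: T3] (fun p => point3 p 0 i : mR).
Proof.
move: i; apply: forall_I3.
- rewrite (_ : (fun _ => _) = fst \o fst); last by apply/funext => p; rewrite mxE.
  by apply: (measurableT_comp measurable_fst measurable_fst).
- rewrite (_ : (fun _ => _) = snd \o fst); last by apply/funext => p; rewrite mxE.
  by apply: (measurableT_comp measurable_snd measurable_fst).
- rewrite (_ : (fun _ => _) = snd); last by apply/funext => p; rewrite mxE.
  exact: measurable_snd.
Qed.

Lemma measurable_vset_ball (x : vec R) e : measurable_vset (ball x e).
Proof.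
have [e0|e0] := ltP 0 e; last first.
  rewrite /measurable_vset (_ : _ @^-1` _ = set0) //.
  by apply/seteqP; split => p //= [] /lt_geF; rewrite e0.
have mi i : measurable ((fun p : T3 => point3 p 0 i) @^-1` ball (x 0 i) e).
  have := @measurable_point3 i measurableT (ball (x 0 i) e).
  by rewrite setTI; apply; apply: open_measurable; exact: ball_open.
rewrite /measurable_vset (_ : _ @^-1` _ =
   ((fun p => point3 p 0 0) @^-1` ball (x 0 0) e) `&`
   ((fun p => point3 p 0 1) @^-1` ball (x 0 1) e) `&`
   ((fun p => point3 p 0 2) @^-1` ball (x 0 2) e)).
  by do 2?apply: measurableI; exact: mi.
apply/seteqP; split => p /=; first by move=> [_ h]; split; [split|]; exact: h.
move=> [[h0 h1] h2]; split=> // i; rewrite (ord1 i).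
by apply: forall_I3.
Qed.

(** Balls of the maximum norm are boxes, hence measurable; an open set is the union of the countably
    many balls with rational centre and radius 1/(n+1) that it contains. *)
Lemma open_measurable_vset (U : set (vec R)) : open U -> measurable_vset U.
Proof.
move=> oU.
pose c (q : rat * rat * rat) : vec R :=
  point3 ((ratr q.1.1, ratr q.1.2), ratr q.2).
pose B (a : rat * rat * rat * nat) : set (vec R) := ball (c a.1) a.2.+1%:R^-1.
pose F a := point3 @^-1` (if `[< B a `<=` U >] then B a else set0) : set T3.
rewrite /measurable_vset (_ : _ @^-1` _ = \bigcup_a F a); last first.
  apply/seteqP; split => [p /= Up|p [a _]]; last first.
    by rewrite /F /=; case: asboolP => // h /h.
  have [e e0 he] : exists2 e : R, 0 < e & ball (point3 p) e `<=` U.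
    by move: oU; rewrite openE => /(_ _ Up) /nbhs_ballP[e /= e0 he]; exists e.
  have [n hn] : exists n : nat, n.+1%:R^-1 < e / 2.
    have := @near_infty_natSinv_lt R (PosNum (divr_gt0 e0 (ltr0Sn _ 1))).
    by move=> [n _ /(_ n) /= h]; exists n; apply: h => /=.
  pose d : R := n.+1%:R^-1.
  have d0 : 0 < d by rewrite invr_gt0.
  have hq i : exists q : rat, `|point3 p 0 i - ratr q| < d.
    have : point3 p 0 i - d < point3 p 0 i + d by rewrite ltrBlDr -addrA ltrDl addr_gt0.
    move=> /rat_in_itvoo[q]; rewrite in_itv /= => /andP[h1 h2]; exists q.
    by rewrite ltr_distlC; apply/andP; split; lra.
  have [q0 h0] := hq 0; have [q1 h1] := hq 1; have [q2 h2] := hq 2.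
  have hB i : `|point3 p 0 i - c ((q0, q1), q2) 0 i| < d.
    by move: i; apply: forall_I3; rewrite [c _ _ _]mxE.
  exists (((q0, q1), q2), n) => //; rewrite /F /=.
  have BU : B ((q0, q1), q2, n) `<=` U.
    move=> y [_ hy]; apply: he; split=> // i j; rewrite (ord1 i).
    have := hy 0 j; have := hB j; rewrite /ball /= /ball_ -/d => h h'.
    rewrite -(subrKA (c (q0, q1, q2) 0 j)).
    apply: (le_lt_trans (ler_normD _ _)).
    have : d < e / 2 by []. lra.
  case: asboolP => // _; split; first by [].
  move=> i j; rewrite (ord1 i) /ball /= /ball_ distrC; exact: hB.
apply: countable_bigcupT_measurable => // a; rewrite /F.
case: asboolP => _; first exact: measurable_vset_ball.
by rewrite preimage_set0; exact: measurable0.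
Qed.

Lemma measurable_vsetC (S : set (vec R)) : measurable_vset S -> measurable_vset (~` S).
Proof. by move=> /measurableC; rewrite /measurable_vset preimage_setC. Qed.

Lemma closed_measurable_vset (U : set (vec R)) : closed U -> measurable_vset U.
Proof.
move=> cU; rewrite -[U]setCK; apply: measurable_vsetC.
by apply: open_measurable_vset; exact: closed_openC.
Qed.

Lemma within_continuous_measurable3 (D : set (vec R)) (f : vec R -> R) :
  measurable_vset D -> {within D, continuous f} -> measurable3 D f.
Proof.
move=> mD cf; apply: (measurability _ (RGenOpens.measurableE R)).
move=> _ [_ [a [b ->]] <-].
have /continuousP/(_ _ (@interval_open _ (BRight a) (BLeft b) isT isT)) := cf.
move=> /open_subspaceP[V oV eV].
have -> : point3 @^-1` D `&` (f \o point3) @^-1` `]a, b[ = point3 @^-1` (V `&` D).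
  by rewrite eV; apply/seteqP; split => p /= [].
by rewrite preimage_setI; apply: measurableI => //; exact: open_measurable_vset.
Qed.

Lemma continuous_measurable3 (D : set (vec R)) (f : vec R -> R) :
  measurable_vset D -> continuous f -> measurable3 D f.
Proof.
by move=> mD cf; apply: within_continuous_measurable3 => //; exact: continuous_subspaceT.
Qed.

(** The property is additive in the vector, so translations along the axes suffice; along the last
    axis it is checked on sections, and permutation matrices carry the other axes there. *)
Lemma vol_translate v (S : set (vec R)) : measurable_vset S ->
  measurable_vset [set x | S (x + v)] /\ vol [set x | S (x + v)] = vol S.
Proof.
pose ok (v : vec R) := forall S, measurable_vset S ->
  measurable_vset [set x | S (x + v)] /\ vol [set x | S (x + v)] = vol S.
suff : ok v by apply.
have okD u w : ok u -> ok w -> ok (u + w).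
  move=> hu hw {}S mS; have [mw ew] := hw _ mS; have [m e] := hu _ mw.
  have -> : [set x | S (x + (u + w))] = [set x | [set y | S (y + w)] (x + u)].
    by apply/seteqP; split => x /=; rewrite addrA.
  by split; [exact: m|rewrite e; exact: ew].
have ok2 a : ok (a *: delta_mx 0 2).
  move=> {}S mS.
  pose g := (fun p : T3 => (p.1, p.2 + a) : T3).
  have E : point3 @^-1` [set x | S (x + a *: delta_mx 0 2)] = g @^-1` (point3 @^-1` S).
    apply/seteqP; split => p /=; (have -> : point3 p + a *: delta_mx 0 2 = point3 (g p)
      by apply/rowP; apply: forall_I3; rewrite !mxE /= ?mulr1 ?mulr0 ?addr0) => //.
  rewrite /measurable_vset /vol E.
  have mg : measurable_fun [set: T3] g.
    apply/measurable_fun_pairP; split; first exact: measurable_fst.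
    by apply: measurable_funD => //; exact: measurable_snd.
  have mT : measurable (g @^-1` (point3 @^-1` S)).
    by rewrite -[X in measurable X]setTI; apply: mg.
  split; first exact: mT.
  rewrite /leb3 /product_measure1; apply: eq_integral => p _ /=.
  have := @lebesgue_measure_affine R 1 a (xsection (point3 @^-1` S) p) (oner_neq0 _)
    (measurable_xsection _ mS).
  rewrite normr1 mul1e => <-; congr mu; apply/seteqP.
  by split => z /=; rewrite /xsection /= !inE mul1r.
have okj a j : ok (a *: delta_mx 0 j).
  move=> {}S mS; pose s : 'S_3 := tperm j 2.
  have sK : perm_mx s *m perm_mx s = 1%:M :> 'M[R]_3.
    by rewrite -perm_mxM /s tperm2 perm_mx1.
  have d1 : `|\det (perm_mx s : 'M[R]_3)| = 1 by rewrite det_perm normrX normrN1 expr1n.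
  have [m1 e1] := scales_vol_perm s mS.
  have [m2 e2] := ok2 a _ m1.
  have [m3 e3] := scales_vol_perm s m2.
  rewrite d1 mul1e in e1; rewrite d1 mul1e in e3.
  have -> : [set x | S (x + a *: delta_mx 0 j)] = [set x |
      [set y | [set z | S (z *m perm_mx s)] (y + a *: delta_mx 0 2)] (x *m perm_mx s)].
    have e : (a *: delta_mx 0 2 : vec R) *m perm_mx s = a *: delta_mx 0 j.
      rewrite -scalemxAl; congr (_ *: _).
      have -> : perm_mx s = perm_mx (s^-1)%g :> 'M[R]_3 by rewrite tpermV.
      rewrite -col_permE; apply/rowP => k; rewrite !mxE /=.
      by rewrite (can2_eq (tpermK _ _) (tpermK _ _)) tpermR.
    by apply/seteqP; split => x /=; rewrite mulmxDl -mulmxA sK mulmx1 e.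
  by split; [exact: m3|rewrite e3 e2; exact: e1].
have -> : v = v 0 0 *: delta_mx 0 0 + v 0 1 *: delta_mx 0 1 + v 0 2 *: delta_mx 0 2.
  by apply/rowP; apply: forall_I3; rewrite !mxE /= ?mulr1 ?mulr0 ?addr0 ?add0r.
exact: (okD _ _ (okD _ _ (okj _ _) (okj _ _)) (okj _ _)).
Qed.

Lemma vol_affine b (A : 'M[R]_3) (S : set (vec R)) : \det A != 0 -> measurable_vset S ->
  measurable_vset [set x | S (b + x *m A)] /\
  (`|\det A|%:E * vol [set x | S (b + x *m A)%R] = vol S)%E.
Proof.
move=> dA mS; have [m1 e1] := vol_translate b mS.
have [m2 e2] := scales_vol_unit dA m1.
rewrite -e1 -e2.
have -> : [set x | S (b + x *m A)] = [set x | [set y | S (y + b)] (x *m A)].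
  by apply/seteqP; split => x /=; rewrite addrC.
by [].
Qed.

Section affine_integral.
Variables (b : vec R) (A : 'M[R]_3).
Hypothesis dA : \det A != 0.

Definition affine3 (p : T3) : T3 := unpoint3 (b + point3 p *m A).

Lemma measurable_affine3 : measurable_fun [set: T3] affine3.
Proof.
move=> _ S mS; rewrite setTI.
have [] := @vol_affine b A [set x | S (unpoint3 x)] dA; last by [].
rewrite /measurable_vset (_ : _ @^-1` _ = S) //.
by apply/seteqP; split => p /=; rewrite point3K.
Qed.

Lemma leb3_affine3 S : measurable S ->
  (`|\det A|%:E * leb3 R (affine3 @^-1` S) = leb3 R S)%E.
Proof.
move=> mS; have [] := @vol_affine b A [set x | S (unpoint3 x)] dA.
  rewrite /measurable_vset (_ : _ @^-1` _ = S) //.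
  by apply/seteqP; split => p /=; rewrite point3K.
have -> : vol [set x | S (unpoint3 x)] = leb3 R S; last by [].
by congr (leb3 R); apply/seteqP; split => p /=; rewrite point3K.
Qed.

Let kpos : 0 < `|\det A|. Proof. by rewrite normr_gt0. Qed.

Lemma integrable_affine3 (D : set T3) (f : T3 -> \bar R) : measurable D ->
  (leb3 R).-integrable D f -> (leb3 R).-integrable (affine3 @^-1` D) (f \o affine3).
Proof. exact: (@integrable_scaling _ _ _ (leb3 R) _ _ measurable_affine3 kpos leb3_affine3). Qed.

Lemma Rintegral_affine3 (D : set T3) (f : T3 -> R) : measurable D ->
  (leb3 R).-integrable D (EFin \o f) ->
  `|\det A| * \int[leb3 R]_(p in affine3 @^-1` D) f (affine3 p)
  = \int[leb3 R]_(p in D) f p.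
Proof. exact: (@Rintegral_scaling _ _ _ (leb3 R) _ _ measurable_affine3 kpos leb3_affine3). Qed.

End affine_integral.
End Borel.

(** * Boxes determine integrable functions *)

Section Boxes.
Variable R : realType.
Notation mR := (measurableTypeR R).
Notation T3 := (mR * mR * mR)%type.

Definition box (a b : vec R) : set (vec R) :=
  [set x | forall i, a 0 i < x 0 i < b 0 i].
Definition cbox (a b : vec R) : set (vec R) :=
  [set x | forall i, a 0 i <= x 0 i <= b 0 i].

Lemma boxI a b c d : box a b `&` box c d =
  box (\row_i Num.max (a 0 i) (c 0 i)) (\row_i Num.min (b 0 i) (d 0 i)).
Proof.
apply/seteqP; split => x /=.
  move=> [h1 h2] i; rewrite !mxE gt_max lt_min.
  by have /andP[-> ->] := h1 i; have /andP[-> ->] := h2 i.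
move=> h; split=> i; have := h i; rewrite !mxE gt_max lt_min;
by case/andP => /andP[? ?] /andP[? ?]; apply/andP.
Qed.

Lemma box_ball (x : vec R) e : 0 < e -> ball x e = box (x - const_mx e) (x + const_mx e).
Proof.
move=> e0; apply/seteqP; split => y /=.
  move=> [_ h] i; have := h 0 i; rewrite /ball /= !mxE ltr_distlC.
  by [].
move=> h; split=> // i j; rewrite (ord1 i) /ball /= ltr_distlC.
by have := h j; rewrite !mxE.
Qed.

Lemma measurable_vset_box a b : measurable_vset (box a b).
Proof.
have mi i : measurable ((fun p : T3 => point3 p 0 i) @^-1` `]a 0 i, b 0 i[%classic).
  have := @measurable_point3 R i measurableT `]a 0 i, b 0 i[%classic.
  by rewrite setTI; apply; exact: measurable_itv.
rewrite /measurable_vset (_ : _ @^-1` _ =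
   ((fun p => point3 p 0 0) @^-1` `]a 0 0, b 0 0[%classic) `&`
   ((fun p => point3 p 0 1) @^-1` `]a 0 1, b 0 1[%classic) `&`
   ((fun p => point3 p 0 2) @^-1` `]a 0 2, b 0 2[%classic)).
  by do 2?apply: measurableI; exact: mi.
apply/seteqP; split => p /=.
  by move=> h; split; [split|]; rewrite /= in_itv /=; exact: h.
rewrite !in_itv /= => -[[h0 h1] h2]; exact: forall_I3.
Qed.

Lemma cbox_closed a b : closed (cbox a b).
Proof.
have -> : cbox a b = \bigcap_(i in [set: 'I_3]) ((fun x : vec R => x 0 i) @^-1` `[a 0 i, b 0 i]%classic).
  apply/seteqP; split => x /= h.
    by move=> i _ /=; rewrite in_itv /=; exact: h.
  by move=> i; have := h i I; rewrite /= in_itv.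
apply: closed_bigI => i _; apply: closed_comp; last exact: interval_closed.
by move=> x _; exact: coord_continuous.
Qed.

Lemma cbox_compact a b : compact (cbox a b).
Proof.
apply: bounded_closed_compact; last exact: cbox_closed.
exists (\sum_i (`|a 0 i| + `|b 0 i|)); split; first exact: num_real.
move=> M hM x hx; rewrite /= [X in X <= _]mx_normrE; apply/bigmax_leP.
have h i : `|x 0 i| <= `|a 0 i| + `|b 0 i|.
  have /andP[h1 h2] := hx i; rewrite ler_norml.
  have := ler_norm (b 0 i); have := ler_norm (- a 0 i); rewrite normrN.
  have := normr_ge0 (b 0 i); have := normr_ge0 (a 0 i).
  by move=> *; apply/andP; split; lra.
have hs i : `|a 0 i| + `|b 0 i| <= \sum_i (`|a 0 i| + `|b 0 i|).
  by rewrite (bigD1 i) //= lerDl sumr_ge0 // => j _; rewrite addr_ge0.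
split; first by apply: le_trans (ltW hM); exact: le_trans (le_trans (normr_ge0 _) (h 0)) (hs 0).
by move=> [i j] _ /=; rewrite (ord1 i) (le_trans (h j)) // (le_trans (hs j)) // ltW.
Qed.

Definition rational_center (a : rat * rat * rat * nat) : vec R :=
  point3 ((ratr a.1.1.1, ratr a.1.1.2), ratr a.1.2).

Definition rational_box a :=
  box (rational_center a - const_mx a.2.+1%:R^-1) (rational_center a + const_mx a.2.+1%:R^-1).
Definition rational_cbox a :=
  cbox (rational_center a - const_mx a.2.+1%:R^-1) (rational_center a + const_mx a.2.+1%:R^-1).

Lemma open_bigcup_rational_box (U : set (vec R)) : open U ->
  U = \bigcup_(a in [set a | rational_cbox a `<=` U]) rational_box a.
Proof.
move=> oU; apply/seteqP; split => [x Ux|x [a /= aU] xa]; last first.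
  apply: aU => i; have /andP[h1 h2] := xa i.
  by apply/andP; split; exact: ltW.
have [e e0 he] : exists2 e : R, 0 < e & ball x e `<=` U.
  by move: oU; rewrite openE => /(_ _ Ux) /nbhs_ballP[e /= e0 he]; exists e.
have [n hn] : exists n : nat, n.+1%:R^-1 < e / 2.
  have := @near_infty_natSinv_lt R (PosNum (divr_gt0 e0 (ltr0Sn _ 1))).
  by move=> [n _ /(_ n) /= h]; exists n; apply: h => /=.
have d0 : 0 < n.+1%:R^-1 :> R by rewrite invr_gt0.
have hq i : exists q : rat, `|x 0 i - ratr q| < n.+1%:R^-1.
  have : x 0 i - n.+1%:R^-1 < x 0 i + n.+1%:R^-1 by rewrite ltrBlDr -addrA ltrDl addr_gt0.
  move=> /rat_in_itvoo[q]; rewrite in_itv /= => /andP[h1 h2]; exists q.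
  by rewrite ltr_distlC h1 h2.
have [q0 h0] := hq 0; have [q1 h1] := hq 1; have [q2 h2] := hq 2.
pose a := (((q0, q1), q2), n) : rat * rat * rat * nat.
have hB i : `|x 0 i - rational_center a 0 i| < n.+1%:R^-1.
  by move: i; apply: forall_I3; rewrite [rational_center _ _ _]mxE.
have bE : rational_box a = ball (rational_center a) n.+1%:R^-1 by rewrite box_ball.
have cE : rational_cbox a `<=` ball x e.
  move=> y hy; split=> // i j; rewrite (ord1 i) /ball /=.
  have := hy j; have := hB j; rewrite ltr_distl.
  move: (rational_center a) => c; rewrite !mxE -[a.2]/n.
  move: hn; set d := n.+1%:R^-1 => ? /andP[? ?] /andP[? ?].
  rewrite ltr_distl; apply/andP; split; lra.
exists a; first by move=> y /cE; exact: he.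
by rewrite bE; split=> // i j; rewrite (ord1 i) /ball /= distrC; exact: hB.
Qed.

Definition box_preimages : set (set T3) :=
  [set S | exists a b, S = point3 @^-1` box a b].

Lemma open_box_generated (U : set (vec R)) : open U ->
  @measurable _ (g_sigma_algebraType box_preimages) (point3 @^-1` U).
Proof.
move=> oU; rewrite (open_bigcup_rational_box oU) preimage_bigcup.
rewrite bigcup_mkcond.
apply: countable_bigcupT_measurable => // a.
case: ifP => _; last exact: measurable0.
by apply: sub_sigma_algebra; eexists; eexists.
Qed.

(** Open sets are countable unions of boxes, so the coordinates are measurable for the sigma-algebra
    generated by the boxes, and with them the identity map into the product. *)
Lemma measurable_box_generated : @measurable _ T3 = <<s box_preimages >>.
Proof.
apply/seteqP; split; last first.
  apply: smallest_sub; first exact: sigma_algebra_measurable.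
  by move=> _ [a [b ->]]; exact: measurable_vset_box.
pose G := g_sigma_algebraType box_preimages.
have mi i : measurable_fun [set: G] (fun p => point3 p 0 i : mR).
  apply: (measurability _ (RGenOpens.measurableE R)).
  move=> _ [_ [a [b ->]] <-]; rewrite setTI.
  rewrite -[_ @^-1` _]/(point3 @^-1` ((fun x : vec R => x 0 i) @^-1` `]a, b[%classic)).
  apply: open_box_generated; apply: open_comp; last exact: interval_open.
  by move=> x _; exact: coord_continuous.
have mid : measurable_fun [set: G] (fun p : G => p : T3).
  have e i (g : T3 -> mR) : (forall p, point3 p 0 i = g p) -> measurable_fun [set: G] (g : G -> mR).
    by move=> h; have := mi i; congr measurable_fun; apply/funext => p; rewrite h.
  apply/measurable_fun_pairP; split; last by apply: (e 2) => p; rewrite mxE.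
  apply/measurable_fun_pairP; split; first by apply: (e 0) => p; rewrite mxE.
  by apply: (e 1) => p; rewrite mxE.
by move=> S mS; have := mid measurableT S mS; rewrite setTI.
Qed.

(** [mf] and [f0] are parameters so that the measure structure below can be attached to the term
    itself. *)
Definition density_measure (f : T3 -> \bar R) (mf : measurable_fun setT f)
  (f0 : forall x, (0 <= f x)%E) (S : set T3) : \bar R := (\int[leb3 R]_(x in S) f x)%E.

Section density.
Variables (f : T3 -> \bar R) (mf : measurable_fun setT f) (f0 : forall x, (0 <= f x)%E).

Let dm0 : density_measure mf f0 set0 = 0%E.
Proof. by rewrite /density_measure integral_set0. Qed.

Let dm_ge0 S : (0 <= density_measure mf f0 S)%E.
Proof. by apply: integral_ge0. Qed.

Let dm_sigma : semi_sigma_additive (density_measure mf f0).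
Proof.
move=> F mF tF mUF; rewrite /density_measure ge0_integral_bigcup //; last first.
  exact: measurable_funTS.
by apply: is_cvg_ereal_nneg_natsum_cond => n _ _; exact: integral_ge0.
Qed.

HB.instance Definition _ := isMeasure.Build _ _ _ (density_measure mf f0) dm0 dm_ge0 dm_sigma.
End density.

(* The measures with densities f and g agree on the pi-system of boxes. *)
Lemma box_integral_unique (f g : T3 -> \bar R) :
  (leb3 R).-integrable setT f -> (leb3 R).-integrable setT g ->
  (forall x, (0 <= f x)%E) -> (forall x, (0 <= g x)%E) ->
  (forall a b, \int[leb3 R]_(x in point3 @^-1` box a b) f x
             = \int[leb3 R]_(x in point3 @^-1` box a b) g x)%E ->
  forall S, measurable S -> (\int[leb3 R]_(x in S) f x = \int[leb3 R]_(x in S) g x)%E.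
Proof.
move=> fi gi f0 g0 fg S mS.
have mf := measurable_int _ fi; have mg := measurable_int _ gi.
apply: (@measure_unique _ _ _ box_preimages
  (fun n => point3 @^-1` box (const_mx (- n%:R)) (const_mx n%:R))
  measurable_box_generated _ _ _ (density_measure mf f0) (density_measure mg g0)) => //.
- by move=> _ _ [a [b ->]] [c [d ->]]; rewrite -preimage_setI boxI; eexists; eexists.
- by move=> n; eexists; eexists.
- apply/seteqP; split => // p _.
  have h i : exists n : nat, `|point3 p 0 i| < n%:R.
    by exists (Num.trunc `|point3 p 0 i|).+1; rewrite truncnS_gt.
  have [n0 h0] := h 0; have [n1 h1] := h 1; have [n2 h2] := h 2.
  exists (n0 + n1 + n2)%N => //= i; rewrite 2![const_mx _ _ _]mxE -ltr_norml.
  move: i; apply: forall_I3; [apply: lt_le_trans h0 _|apply: lt_le_trans h1 _|apply: lt_le_trans h2 _];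
  rewrite ler_nat; lia.
- by move=> _ [a [b ->]]; exact: fg.
- move=> n; apply: le_lt_trans (integrable_lty _ fi) => //.
  rewrite /density_measure; apply: ge0_subset_integral => //.
  exact: measurable_vset_box.
Qed.

(** An open set is covered by countably many boxes whose closures it contains, and a countable union
    of null sets is null. *)
Lemma ae3_box_cover (D : set (vec R)) (P : set (vec R)) : open D ->
  (forall a b, cbox a b `<=` D -> ae3 (box a b) P) -> ae3 D P.
Proof.
move=> oD h; rewrite /ae3 (open_bigcup_rational_box oD).
pose F (n : nat) : set T3 := if unpickle n is Some a then
  (if `[< rational_cbox a `<=` D >] then
    ~` [set p | rational_box a (point3 p) -> P (point3 p)] else set0) else set0.
have FN : (leb3 R).-negligible (\bigcup_n F n).
  apply: negligible_bigcup => n; rewrite /F; case: unpickle => [a|]; last exact: negligible_set0.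
  by case: asboolP => aD; [exact: (h _ _ aD)|exact: negligible_set0].
apply: negligibleS FN => p /= /not_implyP[[a /= aD pa] nP].
have FE : F (pickle a) = ~` [set p | rational_box a (point3 p) -> P (point3 p)].
  by rewrite /F pickleK asboolT.
apply: (@bigcup_sup _ _ (pickle a) setT F I); rewrite FE; exact/not_implyP.
Qed.

End Boxes.

(** * C^1 cutoffs and uniqueness of weak derivatives *)

Section Spline.
Variable R : realType.
Implicit Types s : R.

Definition ramp s : R := Num.max 0 s.
(* Primitive of the hat function dspline supported in [1, 3]; it increases from 0 to 1. *)
Definition spline s : R :=
  2^-1 * (ramp (s - 1) ^+ 2 - 2 * ramp (s - 2) ^+ 2 + ramp (s - 3) ^+ 2).
Definition dspline s : R := ramp (s - 1) - 2 * ramp (s - 2) + ramp (s - 3).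

Lemma rampE s : ramp s = 2^-1 * (s + `|s|).
Proof.
rewrite /ramp; have [h|h] := leP 0 s; first by rewrite ger0_norm //; field.
by rewrite ltr0_norm //; field.
Qed.

Lemma is_derive_cvg (V : normedModType R) (f : V -> R) (x v : V) (c : R) :
  (fun h : R => h^-1 *: (f (h *: v + x) - f x)) @ 0^' --> c -> is_derive x v f c.
Proof. by move=> h; split; [exact: cvgP h|exact: cvg_lim h]. Qed.

(** Serves to differentiate the square of [ramp] at its kink without one-sided limits: an error of
    h^2 divided by h tends to 0. *)
Lemma is_derive_quadratic_error (f : R -> R) (x c : R) :
  (forall h, `|f (h + x) - f x - c * h| <= h ^+ 2) -> is_derive x 1 f c.
Proof.
move=> hf; apply: is_derive_cvg; apply/cvgrPdist_le => e e0.
near=> h.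
have h0 : h != 0 by near: h; exact: nbhs_dnbhs_neq.
have he : `|h| <= e.
  by near: h; exact: dnbhs0_le.
have -> : c - h^-1 *: (f (h *: 1 + x) - f x) = - h^-1 * (f (h + x) - f x - c * h).
  rewrite /GRing.scale /= mulr1; by field.
rewrite normrM normrN normfV; apply: le_trans he.
have hp : 0 < `|h| by rewrite normr_gt0.
by rewrite ler_pdivrMl // -expr2 real_normK ?num_real //.
Unshelve. all: by end_near.
Qed.

Lemma is_derive_sqr_ramp (a s : R) :
  is_derive s 1 (fun t => ramp (t - a) ^+ 2) (2 * ramp (s - a)).
Proof.
apply: is_derive_quadratic_error => h; rewrite /ramp ler_norml.
have [h1|h1] := leP 0 (s - a); have [h2|h2] := leP 0 (h + s - a);
apply/andP; split; nra.
Qed.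

Lemma continuous_ramp a : continuous (fun s => ramp (s - a)).
Proof.
move=> s; rewrite (_ : (fun _ => _) = fun s => 2^-1 * ((s - a) + `|s - a|)); last first.
  by apply/funext => t; rewrite rampE.
apply: cvgM; first exact: cvg_cst.
have c : (fun t => t - a) @ s --> s - a by apply: cvgB; [exact: cvg_id|exact: cvg_cst].
by apply: cvgD => //; apply: cvg_norm.
Qed.

Lemma is_derive_spline s : is_derive s 1 spline (dspline s).
Proof.
have h1 := is_derive_sqr_ramp 1 s; have h2 := is_derive_sqr_ramp 2 s.
have h3 := is_derive_sqr_ramp 3 s.
have H := is_deriveZ 2^-1 (is_deriveD (is_deriveB h1 (is_deriveZ 2 h2)) h3).
apply: (is_derive_eq H); rewrite /dspline /GRing.scale /=; by field.
Qed.

Lemma continuous_dspline : continuous dspline.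
Proof.
move=> s; apply: cvgD; last exact: continuous_ramp.
apply: cvgB; first exact: continuous_ramp.
by apply: cvgM; [exact: cvg_cst|exact: continuous_ramp].
Qed.

Lemma continuous_spline : continuous spline.
Proof.
move=> s; apply/differentiable_continuous/derivable1_diffP.
by have [] := is_derive_spline s.
Qed.

Lemma spline_lt1 s : s <= 1 -> spline s = 0.
Proof.
by move=> h; rewrite /spline /ramp !max_l; [ring|lra..].
Qed.

Lemma spline_ge3 s : 3 <= s -> spline s = 1.
Proof.
by move=> h; rewrite /spline /ramp !max_r; [field|lra..].
Qed.

Lemma spline_itv s : 0 <= spline s <= 1.
Proof.
rewrite /spline /ramp.
have [h1|h1] := leP 0 (s - 1); have [h2|h2] := leP 0 (s - 2);
have [h3|h3] := leP 0 (s - 3); apply/andP; split; try nra.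
Qed.

Lemma dspline_itv s : 0 <= dspline s <= 1.
Proof.
rewrite /dspline /ramp.
have [h1|h1] := leP 0 (s - 1); have [h2|h2] := leP 0 (s - 2);
have [h3|h3] := leP 0 (s - 3); apply/andP; split; lra.
Qed.

Lemma dspline_out s : s <= 1 \/ 3 <= s -> dspline s = 0.
Proof. by rewrite /dspline /ramp => -[h|h]; [rewrite !max_l; [ring|lra..]|rewrite !max_r; [ring|lra..]]. Qed.

(** This unit mass is why the layers along a face converge to the face integral with coefficient 1.
    The interval contains the support [1, 3] of the hat. *)
Lemma integral_dspline :
  (\int[@lebesgue_measure R]_(s in `[0%R, 4%R]) (dspline s)%:E = 1)%E.
Proof.
rewrite (@continuous_FTC2 _ _ spline) //.
- by rewrite spline_ge3 ?spline_lt1 ?sube0 //; lra.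
- exact: continuous_subspaceT continuous_dspline.
- split.
  + by move=> s _; have [] := is_derive_spline s.
  + by apply: cvg_at_right_filter; exact: continuous_spline.
  + by apply: cvg_at_left_filter; exact: continuous_spline.
- by move=> s _; rewrite derive1E; have [] := is_derive_spline s.
Qed.

End Spline.

Section VectorAlgebra.
Variable R : realType.
Implicit Types u v w : vec R.

Lemma dotE u v : dot u v = u 0 0 * v 0 0 + u 0 1 * v 0 1 + u 0 2 * v 0 2.
Proof. by rewrite /dot sum_I3. Qed.

Lemma dotC u v : dot u v = dot v u.
Proof. by rewrite !dotE; ring. Qed.

Lemma dotDr u v w : dot u (v + w) = dot u v + dot u w.
Proof. by rewrite !dotE !mxE; ring. Qed.

Lemma dotDl u v w : dot (v + w) u = dot v u + dot w u.
Proof. by rewrite !dotE !mxE; ring. Qed.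

Lemma dotZr a u v : dot u (a *: v) = a * dot u v.
Proof. by rewrite !dotE !mxE; ring. Qed.

Lemma dotZl a u v : dot (a *: u) v = a * dot u v.
Proof. by rewrite !dotE !mxE; ring. Qed.

Lemma dotNr u v : dot u (- v) = - dot u v.
Proof. by rewrite !dotE !mxE; ring. Qed.

Lemma dotNl u v : dot (- u) v = - dot u v.
Proof. by rewrite !dotE !mxE; ring. Qed.

Lemma dotBr u v w : dot u (v - w) = dot u v - dot u w.
Proof. by rewrite dotDr dotNr. Qed.

Lemma dot0r u : dot u 0 = 0.
Proof. by rewrite !dotE !mxE; ring. Qed.

Lemma dot0l u : dot 0 u = 0.
Proof. by rewrite !dotE !mxE; ring. Qed.

Lemma dot_ge0 u : 0 <= dot u u.
Proof. by rewrite dotE !addr_ge0 // -expr2 sqr_ge0. Qed.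

Lemma dot_eq0 u : (dot u u == 0) = (u == 0).
Proof.
apply/eqP/eqP => [|->]; last exact: dot0r.
rewrite dotE => h; apply/rowP; apply: forall_I3; rewrite mxE.
- by apply/eqP; rewrite -sqrf_eq0; apply/eqP; nra.
- by apply/eqP; rewrite -sqrf_eq0; apply/eqP; nra.
- by apply/eqP; rewrite -sqrf_eq0; apply/eqP; nra.
Qed.

Lemma dot_delta u j : dot u (delta_mx 0 j) = u 0 j.
Proof. by move: j; apply: forall_I3; rewrite dotE !mxE /=; ring. Qed.

Lemma continuous_coord i : continuous (fun x : vec R => x 0 i).
Proof. exact: coord_continuous. Qed.

Lemma continuous_prod (T : topologicalType) (I : Type) (r : seq I) (P : pred I)
    (f : I -> T -> R) x : (forall i, {for x, continuous (f i)}) ->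
  {for x, continuous (fun x => \prod_(i <- r | P i) f i x)}.
Proof.
move=> cf; elim: r => [|i r IH]; rewrite /prop_for /continuous_at.
  by rewrite big_nil; under eq_fun do rewrite big_nil; exact: cvg_cst.
rewrite big_cons; under eq_fun do rewrite big_cons.
by case: ifP => _ //; apply: cvgM => //; exact: cf.
Qed.

Lemma continuous_sum (T : topologicalType) (I : Type) (r : seq I) (P : pred I)
    (f : I -> T -> R) x : (forall i, {for x, continuous (f i)}) ->
  {for x, continuous (fun x => \sum_(i <- r | P i) f i x)}.
Proof.
move=> cf; elim: r => [|i r IH]; rewrite /prop_for /continuous_at.
  by rewrite big_nil; under eq_fun do rewrite big_nil; exact: cvg_cst.
rewrite big_cons; under eq_fun do rewrite big_cons.
by case: ifP => _ //; apply: cvgD => //; exact: cf.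
Qed.

Lemma continuous_dot (f g : vec R -> vec R) x :
  (forall i, {for x, continuous (fun y => f y 0 i)}) ->
  (forall i, {for x, continuous (fun y => g y 0 i)}) ->
  {for x, continuous (fun y => dot (f y) (g y))}.
Proof.
move=> cf cg; apply: (@continuous_sum _ _ _ _ (fun i y => f y 0 i * g y 0 i)) => i.
exact: cvgM (cf i) (cg i).
Qed.

Lemma continuous_dotl u : continuous (dot u).
Proof.
move=> x; apply: (@continuous_dot (fun=> u) id x) => i /=; last exact: continuous_coord.
exact: cst_continuous.
Qed.
End VectorAlgebra.

Section Cutoff.
Variable R : realType.

Lemma prod_itv01 (I : Type) (r : seq I) (P : pred I) (f : I -> R) :
  (forall i, 0 <= f i <= 1) -> 0 <= \prod_(i <- r | P i) f i <= 1.
Proof.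
move=> h; apply: (big_ind (fun x => 0 <= x <= 1)) => //; first by rewrite ler01 lexx.
move=> x y /andP[x0 x1] /andP[y0 y1]; rewrite mulr_ge0 //=.
by rewrite -[1]mulr1 ler_pM.
Qed.

(** Restriction to a line makes the chain rule for functions of one real variable applicable. *)
Lemma is_derive_line (V : normedModType R) (f : V -> R) (x v : V) (d : R) :
  is_derive (0 : R) 1 (fun h : R => f (h *: v + x)) d -> is_derive x v f d.
Proof.
move=> [dv <-].
have E : (fun h : R => h^-1 *: (((fun h : R => f (h *: v + x)) \o shift 0) (h *: 1) - f (0 *: v + x)))
  = (fun h : R => h^-1 *: ((f \o shift x) (h *: v) - f x)).
  by apply/funext => h /=; rewrite scale0r add0r addr0 /GRing.scale /= mulr1.
split; first by move: dv; rewrite /derivable E.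
by rewrite /derive E.
Qed.

Lemma is_derive_prod (V : normedModType R) (I : eqType) (r : seq I)
    (f : I -> V -> R) (df : I -> R) (x v : V) : uniq r ->
  (forall i, is_derive x v (f i) (df i)) ->
  is_derive x v (fun y => \prod_(i <- r) f i y)
    (\sum_(i <- r) df i * \prod_(k <- r | k != i) f k x).
Proof.
move=> + hf; elim: r => [_|a r IH /= /andP[ar ur]].
  rewrite big_nil; under eq_fun do rewrite big_nil.
  exact: is_derive_cst.
under eq_fun do rewrite big_cons.
have H := is_deriveM (hf a) (IH ur); apply: (is_derive_eq H).
rewrite big_cons [X in _ = _ * X + _]big_cons eqxx /= addrC; congr (_ + _).
  rewrite /GRing.scale /= mulrC; congr (_ * _).
  rewrite big_seq [RHS]big_seq_cond; apply: eq_bigl => i.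
  by case: (boolP (i \in r)) => //= ir; apply/esym; apply: contraNneq ar => <-.
rewrite scaler_sumr; apply: eq_big_seq => i ir.
rewrite big_cons; have -> : a != i by apply: contraNneq ar => ->.
by rewrite /GRing.scale /= mulrCA.
Qed.

Variables (I : finType) (l : I -> vec R * R).

Definition ell (i : I) (x : vec R) : R := dot (l i).1 x + (l i).2.
(** An approximation from inside of the indicator of the open polyhedron where all [ell i] are
    positive: zero as soon as one form is at most 1/(n+1), one where all are at least 3/(n+1). Boxes
    and simplices are both of this kind. *)
Definition cutoff (n : nat) (x : vec R) : R := \prod_i spline (n.+1%:R * ell i x).

Lemma continuous_ell i : continuous (ell i).
Proof. move=> x; exact: cvgD (@continuous_dotl _ (l i).1 x) (@cst_continuous _ _ (l i).2 x). Qed.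

Lemma is_derive_cutoff n j x : is_derive x (delta_mx 0 j) (cutoff n)
  (\sum_i n.+1%:R * (l i).1 0 j * dspline (n.+1%:R * ell i x) *
     \prod_(k | k != i) spline (n.+1%:R * ell k x)).
Proof.
apply: is_derive_prod; first exact: index_enum_uniq.
move=> i; apply: is_derive_line.
have -> : (fun h : R => spline (n.+1%:R * ell i (h *: delta_mx 0 j + x))) =
   @spline R \o (fun h => n.+1%:R * (l i).1 0 j * h + n.+1%:R * ell i x).
  apply/funext => h /=; rewrite /ell dotDr dotZr dot_delta; congr spline; ring.
rewrite [X in is_derive _ _ _ X]mulrC; apply: is_derive1_comp.
  by rewrite /= mulr0 add0r; exact: is_derive_spline.
have H := is_deriveD (is_deriveZ (n.+1%:R * (l i).1 0 j) (is_derive_id (0:R) 1))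
  (is_derive_cst (n.+1%:R * ell i x) (0:R) 1).
by apply: (is_derive_eq H); rewrite addr0 /GRing.scale /= mulr1.
Qed.

Lemma partial_cutoff n j x : partial j (cutoff n) x =
  \sum_i n.+1%:R * (l i).1 0 j * dspline (n.+1%:R * ell i x) *
     \prod_(k | k != i) spline (n.+1%:R * ell k x).
Proof. by have [_] := is_derive_cutoff n j x. Qed.

Lemma continuous_spline_ell n i : continuous (fun x => spline (n.+1%:R * ell i x)).
Proof.
move=> x; apply: (@continuous_comp _ _ _ (fun x => n.+1%:R * ell i x) (@spline R)).
  exact: cvgM (@cst_continuous _ _ (n.+1%:R : R) x) (@continuous_ell i x).
exact: continuous_spline.
Qed.

Lemma continuous_dspline_ell n i : continuous (fun x => dspline (n.+1%:R * ell i x)).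
Proof.
move=> x; apply: (@continuous_comp _ _ _ (fun x => n.+1%:R * ell i x) (@dspline R)).
  exact: cvgM (@cst_continuous _ _ (n.+1%:R : R) x) (@continuous_ell i x).
exact: continuous_dspline.
Qed.

Lemma continuous_cutoff n : continuous (cutoff n).
Proof.
by move=> x; apply: continuous_prod => i; exact: continuous_spline_ell.
Qed.

Lemma cutoff_itv n x : 0 <= cutoff n x <= 1.
Proof.
by apply: prod_itv01 => i; exact: spline_itv.
Qed.

Lemma cutoff_eq0 n x i : ell i x <= n.+1%:R^-1 -> cutoff n x = 0.
Proof.
move=> h; rewrite /cutoff (bigD1 i) //= spline_lt1 ?mul0r //.
by rewrite -ler_pdivlMl // mulr1.
Qed.

Lemma cvg_cutoff x : (forall i, 0 < ell i x) -> cutoff n x @[n --> \oo] --> (1 : R).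
Proof.
move=> h; apply: cvg_near_cst.
have : \forall n \near \oo, forall i, 3 <= n.+1%:R * ell i x.
  apply: filter_forall => i.
  have := @near_infty_natSinv_lt R (PosNum (divr_gt0 (h i) (ltr0Sn _ 2))).
  apply: filterS => n /= hn; have n0 : 0 < n.+1%:R :> R by [].
  have := mulVf (lt0r_neq0 n0); set m := n.+1%:R^-1 in hn *; nra.
by apply: filterS => n hn; rewrite /cutoff big1 // => i _; rewrite spline_ge3.
Qed.

(** The support lies in the shrunken polyhedron where every form is at least 1/(n+1), a closed
    subset of the compact one. *)
Lemma test_function_cutoff (D : set (vec R)) n :
  compact [set x | forall i, 0 <= ell i x] ->
  [set x | forall i, 0 < ell i x] `<=` D ->
  test_function D (cutoff n).
Proof.
move=> cK PD; split.
- by move=> x j; have [] := is_derive_cutoff n j x.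
- move=> j; rewrite (funext (partial_cutoff n j)).
  move=> x; apply: continuous_sum => i.
  apply: (cvgM (cvgM (@cst_continuous _ _ (n.+1%:R * (l i).1 0 j : R) x)
    (@continuous_dspline_ell n i x))).
  by apply: continuous_prod => k; exact: continuous_spline_ell.
- exists [set x | forall i, n.+1%:R^-1 <= ell i x]; split.
  + apply: (subclosed_compact _ cK); last first.
      by move=> x h i; apply: le_trans (h i); rewrite invr_ge0.
    have -> : [set x | forall i, n.+1%:R^-1 <= ell i x] =
      \bigcap_(i in [set: I]) (ell i @^-1` [set y | n.+1%:R^-1 <= y]).
      by apply/seteqP; split => x /= h i => [_|]; [exact: h|exact: (h i Logic.I)].
    apply: closed_bigI => i _; apply: closed_comp; last exact: closed_ge.
    by move=> x _; exact: continuous_ell.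
  + by move=> x h; apply: PD => i; apply: lt_le_trans (h i); rewrite invr_gt0.
  + move=> x h; have [i /negP hi] : exists i, ~ (n.+1%:R^-1 <= ell i x).
      by apply/existsNP.
    by apply: (cutoff_eq0 (i := i)); rewrite ltW // ltNge.
Qed.
End Cutoff.

Section DominatedConvergence.
Context d (T : measurableType d) (R : realType).
Variables (mu : {measure set T -> \bar R}) (D : set T).

Lemma Rintegral_dominated_convergence (f_ : nat -> T -> R) (f g : T -> R) :
  measurable D -> (forall n, measurable_fun D (f_ n)) -> measurable_fun D f ->
  {ae mu, forall x, D x -> f_ ^~ x @ \oo --> f x} ->
  mu.-integrable D (EFin \o g) -> (forall n x, D x -> `|f_ n x| <= g x) ->
  mu.-integrable D (EFin \o f) /\
  (\int[mu]_(x in D) f_ n x) @[n --> \oo] --> \int[mu]_(x in D) f x.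
Proof.
move=> mD mf_ mf cf ig fg.
have [] := @dominated_convergence _ _ _ mu D mD (fun n => EFin \o f_ n) (EFin \o f) (EFin \o g).
- by move=> n; apply/measurable_EFinP; exact: mf_.
- exact/measurable_EFinP.
- apply: filterS cf => x h Dx; apply: cvg_EFin; last exact: h.
  by near=> n.
- exact: ig.
- by apply: aeW => x n Dx; rewrite /= lee_fin; exact: fg.
move=> fi _ h; split => //; rewrite /Rintegral; apply: fine_cvg.
by rewrite fineK //; exact: integrable_fin_num.
Unshelve. all: by end_near.
Qed.

Lemma Rintegral_subset (A B : set T) (f : T -> R) : A `<=` B ->
  (forall x, B x -> ~ A x -> f x = 0) ->
  \int[mu]_(x in B) f x = \int[mu]_(x in A) f x.
Proof.
move=> AB h; rewrite Rintegral_mkcond [RHS]Rintegral_mkcond; congr Rintegral.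
apply/funext => x; rewrite /patch.
have [xA|xA] := boolP (x \in A); first by rewrite mem_set //; apply: AB; rewrite -inE.
case: ifPn => // xB; apply: h; first by rewrite -inE.
by move: xA; rewrite notin_setE.
Qed.
End DominatedConvergence.

(** * Almost everywhere uniqueness of weak derivatives *)

Section WeakPartial.
Variable R : realType.
Notation mR := (measurableTypeR R).
Notation T3 := (mR * mR * mR)%type.
Implicit Types (D : set (vec R)) (f g : vec R -> R).

Lemma int3_subset (A B : set (vec R)) f : A `<=` B ->
  (forall x, B x -> ~ A x -> f x = 0) -> int3 B f = int3 A f.
Proof.
move=> AB h; apply: Rintegral_subset; first by move=> p; exact: AB.
by move=> p Bp Ap; exact: h.
Qed.

Lemma integrable3S (A B : set (vec R)) f : measurable_vset A -> measurable_vset B ->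
  A `<=` B -> integrable3 B f -> integrable3 A f.
Proof. by move=> mA mB AB; apply: integrableS => // p; exact: AB. Qed.

Lemma integrable3_measurable D f : integrable3 D f -> measurable3 D f.
Proof. by move=> /measurable_int/measurable_EFinP. Qed.

Lemma open_ell_gt0 (I : finType) (l : I -> vec R * R) :
  open [set x | forall i, 0 < ell l i x].
Proof.
rewrite openE => x Px.
suff : \forall y \near x, forall i, 0 < ell l i y by [].
apply: (@filter_forall _ _ (fun i y => 0 < ell l i y) (nbhs x) _) => i.
exact: (cvgr_gt (ell l i x) (@continuous_ell _ _ l i x) 0 (Px i)).
Qed.

Lemma cvg_int3_cutoff (I : finType) (l : I -> vec R * R) D g :
  [set x | forall i, 0 < ell l i x] `<=` D ->
  integrable3 [set x | forall i, 0 < ell l i x] g ->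
  int3 D (fun x => g x * cutoff l n x) @[n --> \oo] -->
  int3 [set x | forall i, 0 < ell l i x] g.
Proof.
set P := [set x | _] => PD gi.
have mP : measurable_vset P by apply: open_measurable_vset; exact: open_ell_gt0.
have E n : int3 D (fun x => g x * cutoff l n x) = int3 P (fun x => g x * cutoff l n x).
  apply: int3_subset => // x _ /existsNP[i /negP]; rewrite -leNgt => hi.
  rewrite (cutoff_eq0 (i := i)) ?mulr0 //; apply: le_trans hi _.
  by rewrite invr_ge0.
under eq_fun do rewrite E.
have gm := integrable3_measurable gi.
have [] := @Rintegral_dominated_convergence _ _ _ (leb3 R) (point3 @^-1` P)
  (fun n p => g (point3 p) * cutoff l n (point3 p)) (fun p => g (point3 p))
  (fun p => `|g (point3 p)|) mP; last by [].
- move=> n; apply: measurable_funM => //.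
  by apply: continuous_measurable3 => //; exact: continuous_cutoff.
- exact: gm.
- apply: aeW => p Pp; rewrite -[X in _ --> X]mulr1; apply: cvgM; first exact: cvg_cst.
  exact: cvg_cutoff.
- exact: integrable_norm.
- move=> n p Pp; rewrite normrM -[leRHS]mulr1 ler_wpM2l //.
  by have /andP[h0 h1] := cutoff_itv l n (point3 p); rewrite ger0_norm.
Qed.

Section box_cutoff.
Variables a b : vec R.

(** Presents a box as a polyhedron with six faces, to which the cutoffs apply. *)
Definition box_ell (k : 'I_3 * bool) : vec R * R :=
  if k.2 then (delta_mx 0 k.1, - a 0 k.1) else (- delta_mx 0 k.1, b 0 k.1).

Lemma box_ell_gt0 : [set x | forall k, 0 < ell box_ell k x] = box a b.
Proof.
apply/seteqP; split => x /= h i.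
  have := h (i, true); have := h (i, false); rewrite /ell /box_ell /=.
  rewrite dotNl dotC dot_delta => h1 h2; apply/andP; split; lra.
case: i => i [] /=; have /andP[h1 h2] := h i; rewrite /ell /box_ell /= ?dotNl dotC dot_delta; lra.
Qed.

Lemma box_ell_ge0 : [set x | forall k, 0 <= ell box_ell k x] = cbox a b.
Proof.
apply/seteqP; split => x /= h i.
  have := h (i, true); have := h (i, false); rewrite /ell /box_ell /=.
  rewrite dotNl dotC dot_delta => h1 h2; apply/andP; split; lra.
case: i => i [] /=; have /andP[h1 h2] := h i; rewrite /ell /box_ell /= ?dotNl dotC dot_delta; lra.
Qed.
End box_cutoff.

Lemma box_sub_cbox (a b : vec R) : box a b `<=` cbox a b.
Proof. by move=> x h i; have /andP[/ltW -> /ltW ->] := h i. Qed.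

Lemma measurable_vset_cbox (a b : vec R) : measurable_vset (cbox a b).
Proof. by apply: closed_measurable_vset; exact: cbox_closed. Qed.

Lemma integrable3_box D g a b : cbox a b `<=` D -> locally_integrable3 D g ->
  integrable3 (box a b) g.
Proof.
move=> bD gl; have := gl _ (@cbox_compact _ a b) bD.
apply: integrable3S; [exact: measurable_vset_box|exact: measurable_vset_cbox|].
exact: box_sub_cbox.
Qed.

(** Against the cutoffs of the box both candidates have the same integrals, and these converge to
    the integrals over the box. *)
Lemma weak_partial_box D j f g1 g2 a b : cbox a b `<=` D ->
  is_weak_partial D j f g1 -> is_weak_partial D j f g2 ->
  int3 (box a b) g1 = int3 (box a b) g2.
Proof.
move=> bD [l1 h1] [l2 h2].
have t n : test_function D (cutoff (box_ell a b) n).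
  apply: test_function_cutoff; first by rewrite box_ell_ge0; exact: cbox_compact.
  by rewrite box_ell_gt0; exact: subset_trans (@box_sub_cbox a b) bD.
have c g : locally_integrable3 D g ->
    int3 D (fun x => g x * cutoff (box_ell a b) n x) @[n --> \oo] --> int3 (box a b) g.
  move=> gl; rewrite -box_ell_gt0; apply: cvg_int3_cutoff; rewrite box_ell_gt0.
    exact: subset_trans (@box_sub_cbox a b) bD.
  exact: integrable3_box bD gl.
apply: (cvg_unique _ (c _ l1)) => //.
have -> : (fun n => int3 D (fun x => g1 x * cutoff (box_ell a b) n x)) =
          (fun n => int3 D (fun x => g2 x * cutoff (box_ell a b) n x)).
  by apply/funext => n; apply: oppr_inj; rewrite -(h1 _ (t n)) -(h2 _ (t n)).
exact: c.
Qed.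

(** The difference h integrates to 0 over every small box. Boxes determine nonnegative densities, so
    the argument is run on |h| + h and |h| - h, whose equality forces h = 0. *)
Lemma weak_partial_unique D j f g1 g2 : open D ->
  is_weak_partial D j f g1 -> is_weak_partial D j f g2 ->
  ae3 D [set x | g1 x = g2 x].
Proof.
move=> oD w1 w2; apply: ae3_box_cover => // a b bD.
have i1 := integrable3_box bD (proj1 w1); have i2 := integrable3_box bD (proj1 w2).
set B := point3 @^-1` box a b : set T3.
have mB : measurable B := measurable_vset_box a b.
pose h (p : T3) : R := g1 (point3 p) - g2 (point3 p).
have hi : (leb3 R).-integrable B (EFin \o h).
  by apply: eq_integrable (integrableB mB i1 i2).
pose P (p : T3) : \bar R := ((fun p => `|h p| + h p) \_ B p)%:E.
pose N (p : T3) : \bar R := ((fun p => `|h p| - h p) \_ B p)%:E.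
have iP : (leb3 R).-integrable setT P.
  have := integrableD mB (integrable_norm hi) hi.
  move=> /(integrable_mkcond _ mB); apply: eq_integrable => // p _.
  by rewrite /P /patch; case: ifP.
have iN : (leb3 R).-integrable setT N.
  have := integrableB mB (integrable_norm hi) hi.
  move=> /(integrable_mkcond _ mB); apply: eq_integrable => // p _.
  by rewrite /N /patch; case: ifP.
have P0 p : (0 <= P p)%E.
  rewrite /P /patch; case: ifP => // _; rewrite lee_fin.
  by have := ler_norm (- h p); rewrite normrN; lra.
have N0 p : (0 <= N p)%E.
  rewrite /N /patch; case: ifP => // _; rewrite lee_fin.
  by have := ler_norm (h p); lra.
have key S : measurable S -> (\int[leb3 R]_(p in S) P p = \int[leb3 R]_(p in S) N p)%E.
  apply: box_integral_unique => // c d.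
  set E := point3 @^-1` box c d : set T3.
  have mE : measurable E := measurable_vset_box c d.
  have mBE : measurable (E `&` B) by exact: measurableI.
  have hE : (leb3 R).-integrable (E `&` B) (EFin \o h).
    by apply: integrableS hi => //; exact: subIsetr.
  have h0 : (\int[leb3 R]_(p in E `&` B) (h p)%:E = 0)%E.
    have : \int[leb3 R]_(p in E `&` B) h p = 0.
      rewrite RintegralB //; last 2 first.
      - by apply: integrableS i1 => //; exact: subIsetr.
      - by apply: integrableS i2 => //; exact: subIsetr.
      rewrite /E /B -preimage_setI boxI; apply/eqP; rewrite subr_eq0; apply/eqP.
      apply: (weak_partial_box _ w1 w2); apply: subset_trans bD => x hx i.
      have := hx i; rewrite !mxE ge_max le_min.
      by case/andP => /andP[_ ->] /andP[_ ->].
    rewrite /Rintegral => e; rewrite -[LHS]fineK ?e //; exact: integrable_fin_num.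
  have E1 (k : T3 -> R) : (\int[leb3 R]_(p in E) ((k \_ B) p)%:E
      = \int[leb3 R]_(p in E `&` B) (k p)%:E)%E.
    rewrite integral_mkcondr; apply: eq_integral => p _.
    by rewrite /patch; case: ifP.
  have nE : (leb3 R).-integrable (E `&` B) (EFin \o (fun p => `|h p|)).
    exact: integrable_norm hE.
  rewrite /P /N !E1 (integralD_EFin mBE nE hE) (integralB_EFin mBE nE hE).
  by rewrite h0 sube0 adde0.
have := integral_ae_eq measurableT iP (measurable_int _ iN) (fun S _ => key S).
apply: filterS => p /(_ Logic.I) /= hp Bp.
move: hp; rewrite /P /N /patch mem_set //= => -[] hp.
by apply/eqP; rewrite -subr_eq0; apply/eqP; move: hp; rewrite -/(h p); lra.
Qed.

End WeakPartial.

(** * Barycentric coordinates and facets *)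

Section Cross.
Variable R : realType.
Implicit Types u v w : vec R.

Lemma crossE u v : cross u v = \row_(i < 3)
  [:: u 0 1 * v 0 2 - u 0 2 * v 0 1; u 0 2 * v 0 0 - u 0 0 * v 0 2;
      u 0 0 * v 0 1 - u 0 1 * v 0 0]`_i.
Proof.
have e : [/\ 0 + 1 = 1 :> 'I_3, 0 + 2 = 2 :> 'I_3, 1 + 1 = 2 :> 'I_3 &
   [/\ 1 + 2 = 0 :> 'I_3, 2 + 1 = 0 :> 'I_3 & 2 + 2 = 1 :> 'I_3]].
  by do ![split]; apply: val_inj.
have [e1 e2 e3 [e4 e5 e6]] := e.
by apply/rowP; apply: forall_I3; rewrite !mxE ?e1 ?e2 ?e3 ?e4 ?e5 ?e6.
Qed.

Lemma dot_cross_l u v : dot (cross u v) u = 0.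
Proof. by rewrite crossE dotE !mxE /=; ring. Qed.

Lemma dot_cross_r u v : dot (cross u v) v = 0.
Proof. by rewrite crossE dotE !mxE /=; ring. Qed.

Lemma det_rows (A : 'M[R]_3) :
  \det A = dot (cross (row 0 A) (row 1 A)) (row 2 A).
Proof. by rewrite crossE dotE det3 !mxE /=; ring. Qed.

Lemma cross_lin u v a b c d :
  cross (a *: u + b *: v) (c *: u + d *: v) = (a * d - b * c) *: cross u v.
Proof. by rewrite !crossE; apply/rowP; apply: forall_I3; rewrite !mxE /=; ring. Qed.

Lemma enorm_ge0 u : 0 <= enorm u. Proof. exact: sqrtr_ge0. Qed.

Lemma sqr_enorm u : enorm u ^+ 2 = dot u u.
Proof. by rewrite sqr_sqrtr // dot_ge0. Qed.

Lemma enormZ a u : enorm (a *: u) = `|a| * enorm u.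
Proof. by rewrite /enorm dotZl dotZr mulrA -expr2 sqrtrM ?sqr_ge0 // sqrtr_sqr. Qed.

Lemma enorm_gt0 u : u != 0 -> 0 < enorm u.
Proof. by move=> u0; rewrite sqrtr_gt0 lt_neqAle dot_ge0 eq_sym dot_eq0 u0. Qed.
End Cross.

Lemma forall_I4 (P : 'I_4 -> Prop) : P 0 -> P 1 -> P 2 -> P 3 -> forall i, P i.
Proof.
move=> P0 P1 P2 P3 [[|[|[|[|//]]]] h].
- by move: P0; congr P; apply: val_inj.
- by move: P1; congr P; apply: val_inj.
- by move: P2; congr P; apply: val_inj.
- by move: P3; congr P; apply: val_inj.
Qed.

Section Element.
Variables (R : realType) (M : mesh R) (t : 'I_(nelem M)).
Hypothesis ndeg : \det (\matrix_(i < 3) (vtx t (lift 0 i) - vtx t 0)) != 0.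

(** Triple product of the edges issuing from the first vertex of the side: up to sign, six times the
    volume of the element. *)
Definition fdet (s : side M) : R := dot (facet_cross s) (vtx s.1 s.2 - fvtx s 0).

(* Linear part and constant term of the i-th barycentric coordinate. *)
Definition bary_form (i : 'I_4) : vec R * R :=
  ((fdet (t, i))^-1 *: facet_cross (t, i),
   - (dot (facet_cross (t, i)) (fvtx (t, i) 0) / fdet (t, i))).
Definition bary i x := ell bary_form i x.

Lemma baryE i x : bary i x = dot (facet_cross (t, i)) (x - fvtx (t, i) 0) / fdet (t, i).
Proof. by rewrite /bary /ell /bary_form /= dotZl dotBr mulrBl mulrC. Qed.

(** The sign depends on the omitted vertex, hence the squares. *)
Lemma fdet_sqr i : fdet (t, i) ^+ 2 = (\det (\matrix_(i < 3) (vtx t (lift 0 i) - vtx t 0))) ^+ 2.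
Proof.
pose a n := vtx t (inord n).
have e j : vtx t j = a j by rewrite /a inord_val.
rewrite det_rows !rowK /fdet /facet_cross /fvtx /=.
move: i; apply: forall_I4; rewrite !e /= /bump /=;
rewrite !crossE !dotE !mxE /=; ring.
Qed.

Lemma fdet_neq0 i : fdet (t, i) != 0.
Proof. by rewrite -sqrf_eq0 fdet_sqr sqrf_eq0. Qed.

Lemma bary_vtx i j : bary i (vtx t j) = (i == j)%:R.
Proof.
have [<-|ij] := eqVneq i j; first by rewrite baryE divff // fdet_neq0.
rewrite baryE; have [k ->] := unlift_some ij.
suff -> : dot (facet_cross (t, i)) (vtx t (lift i k) - fvtx (t, i) 0) = 0 by rewrite mul0r.
move: k; apply: forall_I3.
- by rewrite subrr dot0r.
- exact: dot_cross_l.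
- exact: dot_cross_r.
Qed.

Lemma bary_affine i (l : 'I_4 -> R) : \sum_j l j = 1 ->
  bary i (\sum_j l j *: vtx t j) = l i.
Proof.
move=> l1; rewrite /bary /ell -[(bary_form i).2]mul1r -l1 mulr_suml.
have -> : dot (bary_form i).1 (\sum_j l j *: vtx t j)
   = \sum_j l j * dot (bary_form i).1 (vtx t j).
  rewrite !big_ord_recl !big_ord0 !(dotDr, dotZr, dot0r); ring.
rewrite -big_split /= (eq_bigr (fun j => l j * (i == j)%:R)); last first.
  by move=> j _; rewrite -mulrDr -[_ + _]/(bary i (vtx t j)) bary_vtx.
rewrite (bigD1 i) //= eqxx mulr1 big1 ?addr0 // => j ji.
by rewrite eq_sym (negbTE ji) mulr0.
Qed.

Lemma bary_exists x : exists l : 'I_4 -> R, \sum_j l j = 1 /\ x = \sum_j l j *: vtx t j.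
Proof.
pose A : 'M[R]_3 := \matrix_(i < 3) (vtx t (lift 0 i) - vtx t 0).
pose y := (x - vtx t 0) *m invmx A.
(* Coordinates of [x - vtx t 0] in the basis of edges, completed at vertex 0 so that the sum is
   1. *)
exists (fun j => if unlift ord0 j is Some k then y 0 k else 1 - \sum_k y 0 k).
have e : x - vtx t 0 = \sum_k y 0 k *: (vtx t (lift 0 k) - vtx t 0).
  have uA : A \in unitmx by rewrite unitmxE unitfE.
  rewrite -[LHS](mulmxKV uA).
  rewrite -/y mulmx_sum_row; apply: eq_bigr => k _; by rewrite rowK.
have lk k : unlift ord0 (lift ord0 k : 'I_4) = Some k by exact: liftK.
split.
  rewrite big_ord_recl unlift_none [X in _ + X](eq_bigr (fun k => y 0 k)) ?subrK //.
  by move=> k _; rewrite lk.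
rewrite big_ord_recl unlift_none
  [X in _ + X](eq_bigr (fun k => y 0 k *: vtx t (lift ord0 k))); last first.
  by move=> k _; rewrite lk.
rewrite -[LHS](subrK (vtx t 0)) e.
rewrite (eq_bigr (fun k => y 0 k *: vtx t (lift ord0 k) - y 0 k *: vtx t 0)); last first.
  by move=> k _; rewrite scalerBr.
rewrite sumrB -scaler_suml scalerBl scale1r -addrA addrC.
by congr (_ + _); rewrite addrC.
Qed.

Lemma sum_bary x : \sum_i bary i x = 1.
Proof.
have [l [l1 ->]] := bary_exists x.
by rewrite -[RHS]l1; apply: eq_bigr => i _; rewrite bary_affine.
Qed.

Lemma baryK x : x = \sum_i bary i x *: vtx t i.
Proof.
have [l [l1 e]] := bary_exists x; rewrite {1}e.
by apply: eq_bigr => i _; rewrite e bary_affine.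
Qed.

Lemma elem_bary : elem t = [set x | forall i, 0 <= bary i x].
Proof.
apply/seteqP; split => [x [l [l0 l1 ->]] i|x h]; first by rewrite bary_affine.
by exists (bary^~ x); split => //; [exact: sum_bary|exact: baryK].
Qed.

Lemma baryZD i a x y : bary i (a *: (y - x) + x) = bary i x + a * (bary i y - bary i x).
Proof. by rewrite /bary /ell dotDr dotZr dotBr; ring. Qed.

(** At an interior point the i-th coordinate cannot vanish: a small move away from vertex [i] would
    make it negative. *)
Lemma oelem_bary : oelem t = [set x | forall i, 0 < bary i x].
Proof.
rewrite /oelem elem_bary; apply/seteqP; split => [x|x h]; last first.
  apply: (filterS (P := [set y | forall i, 0 < bary i y])).
    by move=> y hy i; exact: ltW.
  by apply: open_nbhs_nbhs; split => //; exact: open_ell_gt0.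
move=> h i.
have h' : \forall e \near (0 : R), 0 <= bary i (e *: (vtx t i - x) + x).
  have c : (fun e : R => e *: (vtx t i - x) + x) @ (0 : R) --> (0 : R) *: (vtx t i - x) + x.
    exact: (cvgD (cvgZ cvg_id (cvg_cst _)) (cvg_cst _)).
  rewrite scale0r add0r in c.
  have c2 : \forall e \near (0 : R), [set y | forall i, 0 <= bary i y] (e *: (vtx t i - x) + x).
    exact: c _ h.
  by apply: filterS c2 => e /(_ i).
have [e [e0 he]] : exists e : R, e < 0 /\ 0 <= bary i (e *: (vtx t i - x) + x).
  have /nbhs_ballP[r /= r0 hr] := h'.
  exists (- (r / 2)); split; first by rewrite oppr_lt0 divr_gt0.
  apply: hr; rewrite /ball /= sub0r opprK gtr0_norm ?divr_gt0 //.
  by rewrite ltr_pdivrMr // ltr_pMr // ltr1n.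
have x0 : 0 <= bary i x.
  by have := nbhs_singleton h'; rewrite scale0r add0r.
rewrite lt_neqAle x0 andbT; apply/eqP => b0; move: he.
rewrite baryZD -b0 bary_vtx eqxx subr0 add0r mulr1; by rewrite leNgt e0.
Qed.

Lemma elem_compact : compact (elem t).
Proof.
apply: bounded_closed_compact; last first.
  rewrite elem_bary.
  have -> : [set x | forall i, 0 <= bary i x] =
      \bigcap_(i in [set: 'I_4]) (bary i @^-1` [set y | 0 <= y]).
    by apply/seteqP; split => x /= h i => [_|]; [exact: h|exact: (h i Logic.I)].
  apply: closed_bigI => i _; apply: closed_comp; last exact: closed_ge.
  by move=> x _; exact: continuous_ell.
exists (\sum_i `|vtx t i|); split; first exact: num_real.
move=> C hC x /=; rewrite elem_bary => hx; apply: le_trans (ltW hC).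
rewrite {1}(baryK x); apply: (le_trans (ler_norm_sum _ _ _)).
apply: ler_sum => i _; rewrite normrZ ger0_norm //; apply: ler_piMl => //.
have := sum_bary x; rewrite (bigD1 i) //= => <-; rewrite lerDl.
by apply: sumr_ge0 => j _.
Qed.

Lemma open_oelem : open (oelem t).
Proof. exact: open_interior. Qed.

Lemma oelem_sub : oelem t `<=` elem t.
Proof. exact: interior_subset. Qed.

Lemma bary_facet_param i (q : R * R) :
  [/\ bary i (facet_param (t, i) q) = 0,
      bary (lift i 0) (facet_param (t, i) q) = 1 - q.1 - q.2,
      bary (lift i 1) (facet_param (t, i) q) = q.1 &
      bary (lift i 2) (facet_param (t, i) q) = q.2].
Proof.
have e j : bary j (facet_param (t, i) q) = bary j (vtx t (lift i 0))
   + q.1 * (bary j (vtx t (lift i 1)) - bary j (vtx t (lift i 0)))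
   + q.2 * (bary j (vtx t (lift i 2)) - bary j (vtx t (lift i 0))).
  by rewrite /bary /ell /facet_param /fvtx /= !(dotDr, dotZr, dotBr, dotNr); ring.
have n k : (i == lift i k) = false by apply/negbTE; exact: neq_lift.
have li k m : (lift i k == lift i m :> 'I_4) = (k == m) by rewrite (inj_eq lift_inj).
have n' k : (lift i k == i) = false by rewrite eq_sym n.
by split; rewrite e !bary_vtx ?li ?n /=; ring.
Qed.

End Element.

Lemma within_compact_bounded (R : realType) (T : topologicalType) (K : set T) (f : T -> R) :
  compact K -> {within K, continuous f} -> exists C, 0 <= C /\ forall x, K x -> `|f x| <= C.
Proof.
move=> cK cf; have [C [_ hC]] := compact_bounded (continuous_compact cf cK).
exists (`|C| + 1); split; first by rewrite addr_ge0.
move=> x Kx; apply: hC; last by exists x.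
by rewrite (le_lt_trans (ler_norm C)) // ltrDl.
Qed.

(** * Integrability of bounded functions on bounded sets *)

Section FiniteVolume.
Variable R : realType.
Notation mR := (measurableTypeR R).
Notation mu := (@lebesgue_measure R).
Notation T3 := (mR * mR * mR)%type.

Lemma cbox_preimage (a b : vec R) : point3 @^-1` cbox a b =
  (`[a 0 0, b 0 0]%classic `*` `[a 0 1, b 0 1]%classic) `*` `[a 0 2, b 0 2]%classic.
Proof.
apply/seteqP; split => -[[x y] z] /=.
  by move=> h; have := h 0; have := h 1; have := h 2; rewrite !mxE /= !in_itv.
rewrite !in_itv /= => -[[h0 h1] h2]; apply: forall_I3; by rewrite !mxE.
Qed.

Lemma vol_cbox_lty (a b : vec R) : (vol (cbox a b) < +oo)%E.
Proof.
rewrite /vol cbox_preimage.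
have fi c d : (mu `[c, d]%classic < +oo)%E.
  by rewrite lebesgue_measure_itv /=; case: ifP => _; rewrite ?ltry // -EFinD ltry.
pose J i : set mR := `[a 0 i, b 0 i]%classic.
have mJ i : measurable (J i) by exact: measurable_itv.
rewrite -/(J 0) -/(J 1) -/(J 2).
have -> : leb3 R ((J 0 `*` J 1) `*` J 2) = (mu (J 0%R) * mu (J 1%R) * mu (J 2%R))%E.
  apply: etrans (product_measure1E (leb2 R) mu _ (mJ 2)) _; first exact: measurableX.
  by congr (_ * _)%E; exact: (product_measure1E mu mu (mJ 0) (mJ 1)).
have hJ i : mu (J i) \is a fin_num by rewrite ge0_fin_numE; [exact: fi|exact: measure_ge0].
by rewrite lte_mul_pinfty ?mule_ge0 ?fin_numM //; exact: fi.
Qed.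

Lemma compact_sub_cbox (K : set (vec R)) : compact K -> exists c : R, K `<=` cbox (const_mx (- c)) (const_mx c).
Proof.
move=> cK.
have h i : exists C, 0 <= C /\ forall x, K x -> `|x 0 i| <= C.
  apply: within_compact_bounded => //; apply: continuous_subspaceT.
  exact: continuous_coord.
have [c0 [p0 h0]] := h 0; have [c1 [p1 h1]] := h 1; have [c2 [p2 h2]] := h 2.
exists (c0 + c1 + c2) => x Kx i; rewrite !mxE -ler_norml.
move: i; apply: forall_I3; [have := h0 _ Kx|have := h1 _ Kx|have := h2 _ Kx]; lra.
Qed.

Lemma compact_vol_lty (K A : set (vec R)) : compact K -> A `<=` K ->
  measurable_vset A -> (vol A < +oo)%E.
Proof.
move=> cK AK mA; have [c Kc] := compact_sub_cbox cK.
apply: le_lt_trans (vol_cbox_lty (const_mx (- c)) (const_mx c)).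
by apply: le_measure; rewrite ?inE; [exact: mA|exact: measurable_vset_cbox|move=> p /AK /Kc].
Qed.

Lemma bounded_integrable3 (K A : set (vec R)) (f : vec R -> R) (C : R) : compact K -> A `<=` K ->
  measurable_vset A -> measurable3 A f -> (forall x, A x -> `|f x| <= C) -> integrable3 A f.
Proof.
move=> cK AK mA mf fC; apply: measurable_bounded_integrable => //.
  exact: compact_vol_lty cK AK mA.
exists C; split; first exact: num_real.
by move=> y Cy p Ap /=; apply: le_trans (ltW Cy); exact: fC.
Qed.
End FiniteVolume.

(** * The reference triangle and its null edges *)

Section Triangle.
Variable R : realType.
Notation mR := (measurableTypeR R).
Notation mu := (@lebesgue_measure R).
Notation T2 := (mR * mR)%type.

Definition open_triangle : set T2 := [set p | [/\ 0 < p.1, 0 < p.2 & p.1 + p.2 < 1]].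
Definition triangle_edges : set T2 :=
  [set p | p.1 = 0] `|` [set p | p.2 = 0] `|` [set p | p.1 + p.2 = 1].

Lemma triangle_diff : @ref_triangle R `\` triangle_edges = open_triangle.
Proof.
apply/seteqP; split => p /=.
  move=> [[h0 h1 h2] /not_orP[/not_orP[n0 n1] n2]].
  by split; rewrite lt_neqAle; apply/andP; split => //; apply/eqP => // e; [apply: n0|apply: n1].
move=> [h0 h1 h2]; split; first by split; exact: ltW.
by move=> [[e|e]|e]; move: h0 h1 h2; rewrite e ltxx.
Qed.

Lemma measurable_sum2 : measurable_fun setT (fun p : T2 => p.1 + p.2 : mR).
Proof. by apply: measurable_funD; [exact: measurable_fst|exact: measurable_snd]. Qed.

Lemma measurable_ref_triangle : measurable (@ref_triangle R : set T2).
Proof.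
have -> : @ref_triangle R = (fst @^-1` `[0, +oo[%classic) `&` (snd @^-1` `[0, +oo[%classic)
   `&` ((fun p : T2 => p.1 + p.2 : mR) @^-1` `]-oo, 1]%classic) :> set T2.
  apply/seteqP; split => p /=.
    by move=> [h0 h1 h2]; split; [split|]; rewrite /= in_itv /= ?andbT.
  by move=> [[+ +] +]; rewrite /= !in_itv /= !andbT => h0 h1 h2.
have h (f : T2 -> mR) i : measurable_fun setT f -> measurable (f @^-1` [set` Interval i.1 i.2] : set T2).
  by move=> mf; rewrite -[X in measurable X]setTI; apply: mf => //; exact: measurable_itv.
do 2?apply: measurableI.
- exact: (h _ (BLeft 0, BInfty R false) (measurable_fst)).
- exact: (h _ (BLeft 0, BInfty R false) (measurable_snd)).
- exact: (h _ (BInfty R true, BRight 1) measurable_sum2).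
Qed.

Lemma measurable_triangle_edges : measurable triangle_edges.
Proof.
have h (f : T2 -> mR) (a : R) : measurable_fun setT f -> measurable ([set p | f p = a] : set T2).
  by move=> mf; have := mf measurableT [set a] (measurable_set1 a); rewrite setTI.
apply: measurableU; last exact: h measurable_sum2.
by apply: measurableU; [exact: h measurable_fst|exact: h measurable_snd].
Qed.

Lemma leb2_triangle_edges : leb2 R triangle_edges = 0%E.
Proof.
have h (f : T2 -> mR) (a : R) : measurable_fun setT f -> measurable ([set p | f p = a] : set T2).
  by move=> mf; have := mf measurableT [set a] (measurable_set1 a); rewrite setTI.
rewrite /triangle_edges null_set_setU //.
- by apply: measurableU; [exact: h measurable_fst|exact: h measurable_snd].
- exact: h measurable_sum2.
- apply: null_set_setU; [exact: h measurable_fst|exact: h measurable_snd| |].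
  + have -> : [set p : T2 | p.1 = 0] = [set 0] `*` setT.
      by apply/seteqP; split => p //= [].
    apply: etrans (product_measure1E mu mu _ _) _ => //.
    by apply/eqP; rewrite mule_eq0; apply/orP; left; apply/eqP; exact: lebesgue_measure_set1.
  + have -> : [set p : T2 | p.2 = 0] = setT `*` [set 0].
      by apply/seteqP; split => p //= [].
    apply: etrans (product_measure1E mu mu _ _) _ => //.
    by apply/eqP; rewrite mule_eq0; apply/orP; right; apply/eqP; exact: lebesgue_measure_set1.
- transitivity (\int[mu]_x mu (xsection [set p : T2 | (p.1 + p.2)%R = 1%R] x))%E => //.
  rewrite integral0_eq // => x _ /=.
  rewrite (_ : xsection _ x = [set 1 - x]) ?lebesgue_measure_set1 //.
  apply/seteqP; split => y /=; rewrite /xsection /= inE /=; first by move=> <-; rewrite addrAC subrr add0r.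
  by move=> ->; rewrite addrC subrK.
Qed.

(** The boundary values of [alpha] are prescribed on open facets, and the layers below have a limit
    described over the open triangle; both are transferred to the closed triangle here. *)
Lemma Rintegral_open_triangle (f : T2 -> R) :
  (leb2 R).-integrable (@ref_triangle R : set T2) (EFin \o f) ->
  \int[leb2 R]_(p in @ref_triangle R) f p = \int[leb2 R]_(p in open_triangle) f p.
Proof.
move=> fi; rewrite -triangle_diff /Rintegral.
congr fine; apply: negligible_integral => //.
- exact: measurable_triangle_edges.
- exact: measurable_ref_triangle.
- exact: leb2_triangle_edges.
Qed.

Lemma leb2_ref_triangle_lty : (leb2 R (@ref_triangle R) < +oo)%E.
Proof.
apply: (@le_lt_trans _ _ (leb2 R (`[0%R, 1%R]%classic `*` `[0%R, 1%R]%classic))).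
  apply: le_measure; rewrite ?inE; first exact: measurable_ref_triangle.
  - by apply: measurableX; exact: measurable_itv.
  - by move=> p [h0 h1 h2]; split; rewrite /= in_itv /=; apply/andP; split; lra.
have -> : leb2 R (`[0%R, 1%R]%classic `*` `[0%R, 1%R]%classic) =
   (mu `[0%R, 1%R]%classic * mu `[0%R, 1%R]%classic)%E.
  by apply: (product_measure1E mu mu).
rewrite lebesgue_measure_itv /= lte_fin ltr01 -EFinD -EFinM; exact: ltry.
Qed.

Lemma bounded_integrable_triangle (f : T2 -> R) (C : R) :
  measurable_fun (@ref_triangle R : set T2) f ->
  (forall p, @ref_triangle R p -> `|f p| <= C) ->
  (leb2 R).-integrable (@ref_triangle R : set T2) (EFin \o f).
Proof.
move=> mf fC; apply: measurable_bounded_integrable => //.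
- exact: measurable_ref_triangle.
- exact: leb2_ref_triangle_lty.
exists C; split; first exact: num_real.
by move=> y Cy p Ap /=; apply: le_trans (ltW Cy); exact: fC.
Qed.
End Triangle.

(** Meant for functions continuous only relative to a closed element, followed along points that
    eventually stay in it. *)
Lemma within_cvg_comp (T U : topologicalType) (A : set T) (f : T -> U)
    (I : Type) (G : set_system I) (FG : Filter G) (u : I -> T) (x : T) :
  {within A, continuous f} -> A x -> u @ G --> x -> (\forall n \near G, A (u n)) ->
  f (u n) @[n --> G] --> f x.
Proof.
move=> /subspace_continuousP cf Ax ux Au W Wfx.
have h : \forall n \near G, A (u n) -> W (f (u n)) by exact: ux (cf _ Ax _ Wfx).
have : \forall n \near G, W (f (u n)) by apply: filterS2 h Au => n /[apply].
by [].
Qed.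

(** * Concentration of the cutoff gradients on a face *)

Section SideChange.
Variables (R : realType) (M : mesh R) (t : 'I_(nelem M)).
Hypothesis ndeg : \det (\matrix_(i < 3) (vtx t (lift 0 i) - vtx t 0)) != 0.
Notation mR := (measurableTypeR R).
Notation mu := (@lebesgue_measure R).
Notation T3 := (mR * mR * mR)%type.
Notation T2 := (mR * mR)%type.
Variable i : 'I_4.
Let s : side M := (t, i).
Local Notation bary := (@bary R M t).

(* Flattens the layer of width 1/(n+1) along the face s: the third reference coordinate
   is n+1 times the barycentric coordinate that vanishes on s. *)
Definition side_mx (n : nat) : 'M[R]_3 :=
  \matrix_(k < 3) [:: fvtx s 1 - fvtx s 0; fvtx s 2 - fvtx s 0;
                      n.+1%:R^-1 *: (vtx t i - fvtx s 0)]`_k.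

Definition side_map n : T3 -> T3 := affine3 (fvtx s 0) (side_mx n).

Lemma det_side_mx n : \det (side_mx n) = fdet s / n.+1%:R.
Proof. by rewrite det_rows !rowK /= dotZr mulrC. Qed.

Lemma det_side_mx_neq0 n : \det (side_mx n) != 0.
Proof. by rewrite det_side_mx mulf_neq0 ?invr_eq0 ?fdet_neq0. Qed.

Lemma point3_side_map n p : point3 (side_map n p) =
  facet_param s p.1 + (p.2 / n.+1%:R) *: (vtx t i - fvtx s 0).
Proof.
rewrite unpoint3K mulmx_sum_row !big_ord_recl big_ord0 addr0 !rowK /= !mxE /=.
by rewrite scalerA /facet_param !addrA.
Qed.

(** Moving from the face towards the apex takes weight from the vertex [fvtx s 0] alone, whence the
    factor [(k == 0)%:R]. *)
Lemma bary_side_map n p k : bary i (point3 (side_map n p)) = p.2 / n.+1%:R /\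
  bary (lift i k) (point3 (side_map n p)) =
  bary (lift i k) (facet_param s p.1) - (p.2 / n.+1%:R) * (k == 0)%:R.
Proof.
rewrite point3_side_map.
have e j : bary j (facet_param s p.1 + (p.2 / n.+1%:R) *: (vtx t i - fvtx s 0)) =
  bary j (facet_param s p.1) + (p.2 / n.+1%:R) * (bary j (vtx t i) - bary j (fvtx s 0)).
  by rewrite /bary /ell dotDr dotZr dotBr; ring.
have [b0 _ _ _] := bary_facet_param ndeg i p.1.
rewrite !e b0 /fvtx /= !bary_vtx // eqxx (inj_eq lift_inj).
have -> : (i == lift i 0) = false by apply/negbTE; exact: neq_lift.
have -> : (lift i k == i) = false by apply/negbTE; rewrite eq_sym; exact: neq_lift.
split; rewrite ?subr0 ?mulr1 ?add0r ?sub0r ?mulrN //.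
Qed.

Lemma measurable_side_map n : measurable_fun setT (side_map n).
Proof. exact: measurable_affine3 (det_side_mx_neq0 n). Qed.

Lemma measurable_facet_param : measurable_fun setT (fun q : T2 => unpoint3 (facet_param s q)).
Proof.
have -> : (fun q : T2 => unpoint3 (facet_param s q)) = side_map 0 \o (fun q => (q, 0)).
  apply/funext => q /=; rewrite -[RHS](point3K (side_map 0 (q, 0))) point3_side_map /=.
  by rewrite mul0r scale0r addr0.
apply: measurableT_comp; first exact: measurable_side_map.
exact: pair2_measurable.
Qed.

Lemma facet_param_elem q : ref_triangle q -> elem t (facet_param s q).
Proof.
move=> [h0 h1 h2]; rewrite elem_bary // => j.
have [b0 b1 b2 b3] := bary_facet_param ndeg i q.
have [ij|ij] := eqVneq i j; first by rewrite -ij [X in _ <= X]b0.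
have [k ->] := unlift_some ij.
move: k; apply: forall_I3; rewrite ?b1 ?b2 ?b3; lra.
Qed.

Lemma measurable_facet (F : vec R -> R) : {within elem t, continuous F} ->
  measurable_fun (@ref_triangle R : set T2) (fun q => F (facet_param s q)).
Proof.
move=> cF; have mE : measurable_vset (elem t).
  by apply: closed_measurable_vset; exact: compact_closed (elem_compact ndeg).
have mF := within_continuous_measurable3 mE cF.
rewrite (_ : (fun _ => _) = (F \o point3) \o (fun q => unpoint3 (facet_param s q))); last first.
  by apply/funext => q /=; rewrite unpoint3K.
apply: (measurable_comp mE _ mF); last exact: measurable_funTS measurable_facet_param.
by move=> _ [q hq <-] /=; rewrite unpoint3K; exact: facet_param_elem.
Qed.

Lemma side_change n (H : vec R -> R) : integrable3 (oelem t) H ->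
  int3 (oelem t) H = `|fdet s| / n.+1%:R *
    \int[leb3 R]_(p in side_map n @^-1` (point3 @^-1` oelem t)) H (point3 (side_map n p)).
Proof.
move=> Hi; rewrite -[X in X * _](_ : `|\det (side_mx n)| = _); last first.
  by rewrite det_side_mx normrM normfV (ger0_norm (ler0n _ _)).
have mO : measurable (point3 @^-1` oelem t : set T3).
  by apply: open_measurable_vset; exact: open_oelem.
by rewrite (Rintegral_affine3 _ (det_side_mx_neq0 n) mO Hi).
Qed.

Section limit.
Variable F : vec R -> R.
Hypothesis cF : {within elem t, continuous F}.

(* Up to a constant vector and the factor n+1, the term of the gradient of the cutoff
   that concentrates on the face opposite to the i-th vertex. *)
Definition layer n (x : vec R) : R := dspline (n.+1%:R * bary i x) *
  \prod_(k | k != i) spline (n.+1%:R * bary k x).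

Lemma layer_itv n x : 0 <= layer n x <= 1.
Proof.
have /andP[h1 h2] := dspline_itv (n.+1%:R * bary i x).
have /andP[h3 h4] : 0 <= \prod_(k | k != i) spline (n.+1%:R * bary k x) <= 1.
  by apply: prod_itv01 => k; exact: spline_itv.
by rewrite mulr_ge0 //= -[1]mulr1 ler_pM.
Qed.

Lemma continuous_layer n : continuous (layer n).
Proof.
move=> x; apply: (cvgM (@continuous_dspline_ell _ _ _ n i x)).
by apply: continuous_prod => k; exact: continuous_spline_ell.
Qed.

Let mO : measurable_vset (oelem t).
Proof. by apply: open_measurable_vset; exact: open_oelem. Qed.

Lemma within_oelem_measurable3 : measurable3 (oelem t) F.
Proof.
apply: within_continuous_measurable3 => //.
by apply: continuous_subspaceW cF; exact: oelem_sub.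
Qed.

Lemma layer_integrable n : integrable3 (oelem t) (fun x => F x * layer n x).
Proof.
have [C [C0 hC]] := within_compact_bounded (elem_compact ndeg) cF.
apply: (bounded_integrable3 (C := C) (elem_compact ndeg)) => //.
- exact: oelem_sub.
- apply: measurable_funM; first exact: within_oelem_measurable3.
  by apply: continuous_measurable3 => //; exact: continuous_layer.
- move=> x hx; have /andP[h0 h1] := layer_itv n x.
  rewrite normrM (ger0_norm h0) -[C]mulr1 ler_pM //; apply: hC; exact: oelem_sub.
Qed.

(** The integrand in flattened coordinates, extended by zero so that all [n] share one domain. *)
Let pre n (p : T3) : R := ((fun p => F (point3 (side_map n p)) * layer n (point3 (side_map n p)))
  \_ (side_map n @^-1` (point3 @^-1` oelem t))) p.
(** Pointwise limit of [pre]: the trace on the face times the hat function of the transverse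
    coordinate. *)
Let lim (p : T3) : R := ((fun q => F (facet_param s q)) \_ (@open_triangle R)) p.1 * dspline p.2.

Let mS n : measurable (side_map n @^-1` (point3 @^-1` oelem t)).
Proof. by have := @measurable_side_map n measurableT _ mO; rewrite setTI. Qed.

Let mpre n : measurable_fun setT (pre n).
Proof.
apply/(measurable_restrictT _ (mS n)).
by have := integrable_affine3 (fvtx s 0) (det_side_mx_neq0 n) mO (layer_integrable n)
  => /measurable_int/measurable_EFinP.
Qed.

Let sub_tri : @open_triangle R `<=` @ref_triangle R.
Proof. by move=> p [h0 h1 h2]; split; exact: ltW. Qed.

Let m_otri : measurable (@open_triangle R).
Proof.
rewrite -triangle_diff; apply: measurableD; first exact: measurable_ref_triangle.
exact: measurable_triangle_edges.
Qed.

Let mu0 : measurable_fun setT ((fun q : T2 => F (facet_param s q)) \_ (@open_triangle R)).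
Proof.
apply/(measurable_restrictT _ m_otri).
by apply: measurable_funS (measurable_facet cF) => //; exact: measurable_ref_triangle.
Qed.

Let mlim : measurable_fun setT lim.
Proof.
apply: measurable_funM; first by apply: (measurableT_comp mu0 measurable_fst).
apply: (measurableT_comp _ measurable_snd).
by apply: continuous_measurable_fun; exact: continuous_dspline.
Qed.

(** Where the hat vanishes both sides are 0. Otherwise, over the open triangle the remaining factors
    of the layer are eventually 1; off it some coordinate is nonpositive on the face and does not
    grow towards the apex, so its factor is 0 for every [n]. *)
Let pre_cvg p : pre n p @[n --> \oo] --> lim p.
Proof.
have bi n : n.+1%:R * bary i (point3 (side_map n p)) = p.2.
  by have [-> _] := bary_side_map n p 0; rewrite mulrC divfK.
have [d0|d0] := eqVneq (dspline p.2) 0.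
  rewrite /lim d0 mulr0; apply: cvg_near_cst; apply: nearW => n.
  by rewrite /pre /patch /layer bi d0 mul0r mulr0; case: ifP.
have /andP[p1 p3] : 1 < p.2 < 3.
  apply/andP; split; rewrite ltNge; apply: contra_neqN d0 => h; apply: dspline_out; tauto.
have bk n k : bary (lift i k) (point3 (side_map n p)) =
    bary (lift i k) (facet_param s p.1) - p.2 / n.+1%:R * (k == 0)%:R.
  by have [_ ->] := bary_side_map n p k.
have [otri|notri] := pselect (open_triangle p.1).
  have bpos k : 0 < bary (lift i k) (facet_param s p.1).
    have [_ b1 b2 b3] := bary_facet_param ndeg i p.1; have [q1 q2 q3] := otri.
    move: k; apply: forall_I3; rewrite ?b1 ?b2 ?b3; lra.
  have ev : \forall n \near \oo, forall k, 3 <= n.+1%:R * bary (lift i k) (point3 (side_map n p)).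
    apply: filter_forall => k.
    (* Dividing by 6 yields (n+1) b > 6, which leaves the required 3 after the loss of at most
       [p.2 < 3]. *)
    have := @near_infty_natSinv_lt R (PosNum (divr_gt0 (bpos k) (ltr0Sn _ 5))).
    apply: filterS => n /= hn; have n0 : 0 < n.+1%:R :> R by [].
    rewrite bk; move: (bary (lift i k) _) hn => b hn.
    have nb : 1 < n.+1%:R * (b / 6) by rewrite -ltr_pdivrMl // mulr1.
    have -> : n.+1%:R * (b - p.2 / n.+1%:R * (k == 0)%:R) =
        6 * (n.+1%:R * (b / 6)) - p.2 * (k == 0)%:R.
      by field; rewrite lt0r_neq0.
    by case: (k == 0); rewrite /= ?mulr1 ?mulr0; lra.
  have inO : \forall n \near \oo, oelem t (point3 (side_map n p)).
    apply: filterS ev => n h; rewrite oelem_bary // => j.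
    have [ij|ij] := eqVneq i j.
      by rewrite -ij; have [-> _] := bary_side_map n p 0; rewrite divr_gt0 //; lra.
    have [k ->] := unlift_some ij; have := h k.
    by move=> h3; rewrite -(pmulr_rgt0 _ (ltr0Sn R n)); lra.
  have prodE : \forall n \near \oo, pre n p = F (point3 (side_map n p)) * dspline p.2.
    apply: filterS2 ev inO => n h hO.
    rewrite /pre /patch mem_set // /layer bi big1 ?mulr1 // => j; rewrite eq_sym => ij.
    by have [k ->] := unlift_some ij; rewrite spline_ge3.
  have cF' : F (point3 (side_map n p)) @[n --> \oo] --> F (facet_param s p.1).
    apply: (@within_cvg_comp _ _ _ _ nat \oo _ (fun n => point3 (side_map n p)) _ cF).
    - by apply: facet_param_elem; exact: sub_tri.
    - have h : (fun n => facet_param s p.1 + (p.2 / n.+1%:R) *: (vtx t i - fvtx s 0)) @ \oo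
          --> facet_param s p.1 + (p.2 * 0) *: (vtx t i - fvtx s 0).
        exact: (cvgD (cvg_cst _) (cvgZr_tmp (cvgM (cvg_cst _) (@cvg_harmonic R)))).
      rewrite mulr0 scale0r addr0 in h.
      by rewrite (_ : (fun n => point3 (side_map n p)) = fun n => facet_param s p.1 +
        (p.2 / n.+1%:R) *: (vtx t i - fvtx s 0)) //; apply/funext => n; exact: point3_side_map.
    - by apply: filterS inO => n; exact: oelem_sub.
  rewrite /lim /patch mem_set //.
  have h := cvgM cF' (cvg_cst (dspline p.2)).
  have E : {near \oo, (fun n => F (point3 (side_map n p)) * dspline p.2) =1 pre ^~ p}.
    by apply: filterS prodE => n ->.
  by move=> W /h hW; apply: (near_eq_cvg E).
rewrite /lim /patch memNset // mul0r; apply: cvg_near_cst; apply: nearW => n.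
rewrite /pre /patch /layer; case: ifP => // _.
have [k hk] : exists k, bary (lift i k) (facet_param s p.1) <= 0.
  apply: contrapT => h; apply: notri.
  have hk k : 0 < bary (lift i k) (facet_param s p.1).
    by rewrite ltNge; apply/negP => h'; apply: h; exists k.
  have [_ b1 b2 b3] := bary_facet_param ndeg i p.1.
  have := hk 0; have := hk 1; have := hk 2; rewrite b1 b2 b3 => *; split => //; lra.
rewrite (bigD1 (lift i k)) /=; last by rewrite eq_sym neq_lift.
rewrite spline_lt1 ?mul0r ?mulr0 // bk mulrBr.
have n0 : 0 < n.+1%:R :> R by [].
have e1 : n.+1%:R * (p.2 / n.+1%:R * (k == 0)%:R) = p.2 * (k == 0)%:R.
  by rewrite mulrA [_ * (_ / _)]mulrC divfK // lt0r_neq0.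
rewrite e1.
have : n.+1%:R * bary (lift i k) (facet_param s p.1) <= 0 by rewrite mulr_ge0_le0.
have : 0 <= p.2 * (k == 0)%:R by apply: mulr_ge0; [lra|exact: ler0n].
lra.
Qed.

Let slab : set T3 := (`[0%R, 1%R]%classic `*` `[0%R, 1%R]%classic) `*` `[0%R, 4%R]%classic.

Let mslab : measurable slab.
Proof. by apply: measurableX; [apply: measurableX|]; exact: measurable_itv. Qed.

(** Inside the element the first two reference coordinates are themselves barycentric coordinates,
    hence in [0, 1], and the hat confines the third to [1, 3]. One integrable bound thus serves all
    [n]. *)
Let pre_le C n p : 0 <= C -> (forall x, elem t x -> `|F x| <= C) ->
  `|pre n p| <= C * \1_slab p.
Proof.
move=> C0 hC; rewrite /pre /patch; case: ifPn; last first.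
  by rewrite normr0 => _; rewrite mulr_ge0.
rewrite inE /= => hO.
have /andP[l0 l1] := layer_itv n (point3 (side_map n p)).
have [hs|hs] := pselect (slab p).
  rewrite indicE mem_set // mulr1 normrM (ger0_norm l0) -[C]mulr1 ler_pM //.
  by apply: hC; exact: oelem_sub.
suff -> : layer n (point3 (side_map n p)) = 0.
  by rewrite mulr0 normr0 mulr_ge0.
have bi : n.+1%:R * bary i (point3 (side_map n p)) = p.2.
  by have [-> _] := bary_side_map n p 0; rewrite mulrC divfK.
rewrite /layer bi; have [d0|d0] := eqVneq (dspline p.2) 0; first by rewrite d0 mul0r.
exfalso; apply: hs.
have /andP[p1 p3] : 1 < p.2 < 3.
  apply/andP; split; rewrite ltNge; apply: contra_neqN d0 => h; apply: dspline_out; tauto.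
rewrite oelem_bary // in hO.
have sb := sum_bary ndeg (point3 (side_map n p)).
have le1 j : bary j (point3 (side_map n p)) <= 1.
  rewrite -sb (bigD1 j) //= lerDl; apply: sumr_ge0 => k _; exact: ltW (hO k).
have [_ _ b2 b3] := bary_facet_param ndeg i p.1.
have [_ e1] := bary_side_map n p 1; have [_ e2] := bary_side_map n p 2.
rewrite b2 /= mulr0 subr0 in e1; rewrite b3 /= mulr0 subr0 in e2.
have := hO (lift i 1); have := le1 (lift i 1); have := hO (lift i 2); have := le1 (lift i 2).
rewrite e1 e2 => *.
by split; [split|]; rewrite /= in_itv /=; apply/andP; split; lra.
Qed.

Let leb3_slab : (leb3 R slab < +oo)%E.
Proof.
have -> : slab = point3 @^-1` cbox 0 (point3 ((1, 1), 4)).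
  by rewrite cbox_preimage !mxE.
exact: vol_cbox_lty.
Qed.

Lemma integral_layer_limit : (leb3 R).-integrable setT (EFin \o lim) ->
  \int[leb3 R]_p lim p = \int[leb2 R]_(q in @ref_triangle R) F (facet_param s q).
Proof.
move=> li.
have [C [C0 hC]] := within_compact_bounded (elem_compact ndeg) cF.
rewrite Rintegral_open_triangle; last first.
  apply: (bounded_integrable_triangle (C := C)); first exact: measurable_facet.
  by move=> q hq; apply: hC; exact: facet_param_elem.
rewrite /Rintegral; congr fine.
have h := @integral12_prod_meas1 _ _ _ _ _ (leb2 R) mu _ li.
rewrite -[LHS]h [RHS]integral_mkcond; apply: eq_integral => q _.
rewrite /fubini_F /lim /=.
set c := (_ \_ _) q.
have -> : (\int[mu]_y (c * dspline y)%:E = \int[mu]_(y in `[0%R, 4%R]) (c * dspline y)%:E)%E.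
  rewrite [RHS]integral_mkcond; apply: eq_integral => y _; rewrite /patch.
  case: ifPn => //; rewrite notin_setE /= in_itv /= => /negP hy.
  rewrite dspline_out ?mulr0 //; move: hy; rewrite negb_and -!ltNge => /orP[] hy; lra.
have i4 : mu.-integrable `[0%R, 4%R]%classic (EFin \o @dspline R).
  apply: continuous_compact_integrable; first exact: segment_compact.
  exact: continuous_subspaceT (@continuous_dspline R).
under eq_integral do rewrite EFinM.
have m4 : measurable (`[0%R, 4%R]%classic : set mR) by exact: measurable_itv.
rewrite (integralZl m4 i4).
by rewrite integral_dspline mule1 /c /patch; case: ifP.
Qed.

(** The factor n+1 cancels the Jacobian |fdet s|/(n+1) of the flattening; dominated convergence does
    the rest. *)
Lemma cvg_int3_layer :
  n.+1%:R * int3 (oelem t) (fun x => F x * layer n x) @[n --> \oo] -->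
  `|fdet s| * \int[leb2 R]_(q in @ref_triangle R) F (facet_param s q).
Proof.
have [C [C0 hC]] := within_compact_bounded (elem_compact ndeg) cF.
have [] := @Rintegral_dominated_convergence _ _ _ (leb3 R) setT pre lim
  (fun p => C * \1_slab p) measurableT.
- exact: mpre.
- exact: mlim.
- by apply: aeW => p _; exact: pre_cvg.
- have h : (leb3 R).-integrable slab (EFin \o cst C).
    apply: measurable_bounded_integrable => //.
    exists `|C|; split; first exact: num_real.
    by move=> y Cy p _ /=; exact: ltW.
  apply: eq_integrable ((integrable_mkcond _ mslab).1 h) => // p _.
  rewrite /patch /= indicE; case: (p \in slab); by rewrite ?mulr1 ?mulr0.
- by move=> n p _; exact: pre_le.
move=> li h; rewrite -(integral_layer_limit li).
have -> : (fun n => n.+1%:R * int3 (oelem t) (fun x => F x * layer n x)) =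
    (fun n => `|fdet s| * \int[leb3 R]_p pre n p).
  apply/funext => n; rewrite (side_change n (layer_integrable n)) mulrA mulrCA divff //.
  by rewrite mulr1 [X in _ * X = _]Rintegral_mkcond.
exact: (cvgM (cvg_cst _) h).
Qed.

End limit.
End SideChange.

(** * Polynomials and products with weakly differentiable functions *)

Section Smooth.
Variable R : realType.
Implicit Types f g : vec R -> R.

(** Generated syntactically rather than by coefficients, so that continuity, differentiability and
    stability under derivatives are inductions. *)
Inductive polyfun : (vec R -> R) -> Prop :=
| polyfun_cst c : polyfun (fun=> c)
| polyfun_coord i : polyfun (fun x => x 0 i)
| polyfun_add f g : polyfun f -> polyfun g -> polyfun (fun x => f x + g x)
| polyfun_mul f g : polyfun f -> polyfun g -> polyfun (fun x => f x * g x).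

Lemma polyfun_continuous f : polyfun f -> continuous f.
Proof.
elim=> [c|i|f1 f2 _ h1 _ h2|f1 f2 _ h1 _ h2] x.
- exact: cst_continuous.
- exact: continuous_coord.
- exact: cvgD (h1 x) (h2 x).
- exact: cvgM (h1 x) (h2 x).
Qed.

Lemma polyfun_is_derive f j : polyfun f ->
  exists g, polyfun g /\ forall x, is_derive x (delta_mx 0 j) f (g x).
Proof.
elim=> [c|i|f1 f2 p1 [g1 [q1 h1]] p2 [g2 [q2 h2]]|f1 f2 p1 [g1 [q1 h1]] p2 [g2 [q2 h2]]].
- by exists (fun=> 0); split; [exact: polyfun_cst|move=> x; exact: is_derive_cst].
- exists (fun=> (i == j)%:R); split; first exact: polyfun_cst.
  move=> x; apply: is_derive_line.
  have -> : (fun h : R => (h *: delta_mx 0 j + x) 0 i) = (fun h => (i == j)%:R * h + x 0 i).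
    by apply/funext => h; rewrite !mxE eqxx /= mulrC.
  have H := is_deriveD (is_deriveZ (i == j)%:R (is_derive_id (0:R) 1)) (is_derive_cst (x 0 i) (0:R) 1).
  by apply: (is_derive_eq H); rewrite addr0 /GRing.scale /= mulr1.
- exists (fun x => g1 x + g2 x); split; first exact: polyfun_add.
  by move=> x; exact: is_deriveD (h1 x) (h2 x).
- exists (fun x => f1 x * g2 x + f2 x * g1 x); split.
    by apply: polyfun_add; apply: polyfun_mul.
  by move=> x; exact: is_deriveM (h1 x) (h2 x).
Qed.

Lemma polyfun_derivable f j x : polyfun f -> derivable f x (delta_mx 0 j).
Proof. by move=> /(polyfun_is_derive j)[g [_ /(_ x)[]]]. Qed.

Lemma polyfun_partial f j : polyfun f -> polyfun (partial j f).
Proof.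
move=> /(polyfun_is_derive j)[g [pg h]].
by have -> : partial j f = g; [apply/funext => x; have [] := h x|].
Qed.

Lemma polyfun_opp f : polyfun f -> polyfun (fun x => - f x).
Proof.
move=> pf; have -> : (fun x => - f x) = (fun x => -1 * f x).
  by apply/funext => x; rewrite mulN1r.
by apply: polyfun_mul => //; exact: polyfun_cst.
Qed.

Lemma polyfun_exp f n : polyfun f -> polyfun (fun x => f x ^+ n).
Proof.
move=> pf; elim: n => [|n IH]; first exact: polyfun_cst.
have -> : (fun x => f x ^+ n.+1) = (fun x => f x * f x ^+ n) by apply/funext => x; rewrite exprS.
exact: polyfun_mul.
Qed.

Lemma polyfun_sum (I : Type) (r : seq I) (P : pred I) (f : I -> vec R -> R) :
  (forall i, polyfun (f i)) -> polyfun (fun x => \sum_(i <- r | P i) f i x).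
Proof.
move=> pf; elim: r => [|i r IH].
  by under eq_fun do rewrite big_nil; exact: polyfun_cst.
under eq_fun do rewrite big_cons.
by case: (P i) => //; exact: polyfun_add.
Qed.

Lemma poly_deg_le_polyfun k f : poly_deg_le k f -> polyfun f.
Proof.
move=> [c fE]; rewrite (funext fE); do 3!(apply: polyfun_sum => ?).
have pX i n : polyfun (fun x => x 0 i ^+ n) by apply: polyfun_exp; exact: polyfun_coord.
apply: polyfun_mul (pX 2 _); apply: polyfun_mul (pX 1 _); apply: polyfun_mul (pX 0 _).
exact: polyfun_cst.
Qed.

Section C1.
Variable f : vec R -> R.
Hypotheses (df : forall x j, derivable f x (delta_mx 0 j))
  (cf : forall j, continuous (partial j f)).

Lemma partial_mean_value z j h : exists c,
  `|c| <= `|h| /\ f (h *: delta_mx 0 j + z) - f z = partial j f (c *: delta_mx 0 j + z) * h.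
Proof.
pose g (s : R) := f (s *: delta_mx 0 j + z).
have dg (s : R) : is_derive s 1 g (partial j f (s *: delta_mx 0 j + z)).
  have H : is_derive (s *: delta_mx 0 j + z) (delta_mx 0 j) f (partial j f (s *: delta_mx 0 j + z)).
    by split; [exact: df|].
  have E : (fun h : R => h^-1 *: ((f \o shift (s *: delta_mx 0 j + z)) (h *: delta_mx 0 j) - f (s *: delta_mx 0 j + z)))
    = (fun h : R => h^-1 *: ((g \o shift s) (h *: 1) - g s)).
    apply/funext => e /=; rewrite /g /GRing.scale /= mulr1; congr (_ * (f _ - _)).
    by rewrite addrA; congr (_ + _); apply/rowP => k; rewrite !mxE; ring.
  by case: H; rewrite /derivable /derive E => h1 h2; split.
have cg (s : R) : {for s, continuous g}.
  by apply/differentiable_continuous/derivable1_diffP; have [] := dg s.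
have [h0|h0] := leP 0 h.
  have [c] := @MVT_segment _ g (fun s => partial j f (s *: delta_mx 0 j + z)) 0 h h0 (fun s _ => dg s)
    (continuous_subspaceT cg).
  rewrite in_itv /= => /andP[c0 ch] e; exists c; split; first by rewrite !ger0_norm.
  by move: e; rewrite /g scale0r add0r subr0.
have [c] := @MVT_segment _ g (fun s => partial j f (s *: delta_mx 0 j + z)) h 0 (ltW h0) (fun s _ => dg s)
    (continuous_subspaceT cg).
rewrite in_itv /= => /andP[c0 ch] e; exists c; split.
  by rewrite !ler0_norm ?lerN2 // ltW.
by move: e; rewrite /g scale0r add0r sub0r => e; rewrite -opprB e mulrN opprK.
Qed.

(** A [test_function] is described by its partial derivatives alone. Continuity of the function
    follows from the mean value theorem on the three coordinate steps that lead from [x] to a nearby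
    point. *)
Lemma C1_continuous : continuous f.
Proof.
move=> x; apply: (iffRL (@cvgrPdist_lt _ _ _ (nbhs x) (nbhs_filter x) f (f x))) => e e0.
pose C := 1 + \sum_j `|partial j f x|.
have C0 : 0 < C by rewrite ltr_pwDl // sumr_ge0.
have [r r0 hr] : exists2 r : R, 0 < r & forall y, ball x r y -> forall j, `|partial j f y| <= C.
  have : \forall y \near x, forall j, `|partial j f y| <= C.
    apply: (@filter_forall _ _ (fun j y => `|partial j f y| <= C) (nbhs x) (nbhs_filter x)) => j.
    have /cvgrPdist_le/(_ 1 ltr01) := @cf j x.
    apply: filterS => y hy; rewrite -[partial j f y](subrK (partial j f x)).
    apply: (le_trans (ler_normD _ _)); rewrite /C distrC lerD //.
    by rewrite (bigD1 j) //= lerDl sumr_ge0.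
  by move=> /nbhs_ballP[r /= r0 h]; exists r.
(* With this radius each of the three coordinate steps costs at most e/4. *)
have d0 : 0 < Num.min r (e / (4 * C)) by rewrite lt_min r0 divr_gt0 // mulr_gt0.
near=> y.
have hy : ball x (Num.min r (e / (4 * C))) y.
  near: y; exact: nbhsx_ballx.
have hyk k : `|x 0 k - y 0 k| < Num.min r (e / (4 * C)) by case: hy => _; exact.
have step (z : vec R) k : (forall i, `|x 0 i - z 0 i| < r) -> (forall c, `|c| <= `|y 0 k - x 0 k| ->
     `|x 0 k - (c + z 0 k)| < r) ->
    `|f ((y 0 k - x 0 k) *: delta_mx 0 k + z) - f z| <= C * (e / (4 * C)).
  move=> hz hc; have [c [ch ->]] := partial_mean_value z k (y 0 k - x 0 k).
  rewrite normrM ler_pM //; last first.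
    by rewrite distrC ltW //; have := hyk k; rewrite lt_min => /andP[].
  apply: hr; split => // i l; rewrite (ord1 i) /ball /= !mxE /=.
  by have [->|lk] := eqVneq l k; rewrite ?mulr1 ?mulr0 ?add0r; [exact: hc|exact: hz].
have hx k : `|x 0 k - y 0 k| < r by have := hyk k; rewrite lt_min => /andP[].
pose z1 := (y 0 0 - x 0 0) *: delta_mx 0 0 + x.
pose z2 := (y 0 1 - x 0 1) *: delta_mx 0 1 + z1.
have z3 : y = (y 0 2 - x 0 2) *: delta_mx 0 2 + z2.
  by apply/rowP; apply: forall_I3; rewrite !mxE /=; ring.
have s1 : `|f z1 - f x| <= C * (e / (4 * C)).
  apply: step => [i|c hc]; first by rewrite subrr normr0.
  by rewrite opprD addrCA subrr addr0 normrN (le_lt_trans hc) // distrC.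
have z1E i : z1 0 i = if i == 0 then y 0 0 else x 0 i.
  by rewrite !mxE /=; move: i; apply: forall_I3 => /=; ring.
have z2E i : z2 0 i = if i == 2 then x 0 2 else y 0 i.
  by rewrite !mxE /=; move: i; apply: forall_I3 => /=; ring.
have s2 : `|f z2 - f z1| <= C * (e / (4 * C)).
  apply: step => [i|c hc].
    by rewrite z1E; case: eqP => [->|_]; rewrite ?subrr ?normr0.
  by rewrite z1E /= opprD addrCA subrr addr0 normrN (le_lt_trans hc) // distrC.
have s3 : `|f y - f z2| <= C * (e / (4 * C)).
  rewrite {1}z3; apply: step => [i|c hc].
    by rewrite z2E; case: eqP => [->|_]; rewrite ?subrr ?normr0.
  by rewrite z2E /= opprD addrCA subrr addr0 normrN (le_lt_trans hc) // distrC.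
have eC : C * (e / (4 * C)) = e / 4 by field; rewrite lt0r_neq0.
rewrite eC in s1 s2 s3.
have -> : f x - f y = - (f z1 - f x) - (f z2 - f z1) - (f y - f z2) by ring.
apply: (le_lt_trans (ler_normB _ _)).
have := ler_normB (- (f z1 - f x)) (f z2 - f z1); rewrite normrN; lra.
Unshelve. all: by end_near.
Qed.
End C1.

Lemma partial_eq0 (K : set (vec R)) f j x : closed K -> (forall y, ~ K y -> f y = 0) ->
  ~ K x -> partial j f x = 0.
Proof.
move=> cK f0 Kx.
suff : is_derive x (delta_mx 0 j) f 0 by move=> [].
apply: is_derive_cvg; apply: cvg_near_cst.
have oK : nbhs x (~` K) by apply: open_nbhs_nbhs; split => //; exact: closed_openC.
have c : (fun h : R => h *: delta_mx 0 j + x) @ (0 : R) --> (0 : R) *: delta_mx 0 j + x.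
  exact: (cvgD (cvgZ cvg_id (cvg_cst _)) (cvg_cst _)).
rewrite scale0r add0r in c.
have h : \forall h \near (0 : R), ~ K (h *: delta_mx 0 j + x) by exact: c _ oK.
apply: nbhs_dnbhs; apply: filterS h => h hK.
by rewrite !f0 // subrr scaler0.
Qed.

End Smooth.

(** * Calculus of [int3], essentially bounded functions and the weak product rule *)

Section Int3.
Variable R : realType.
Implicit Types (D : set (vec R)) (f g : vec R -> R).

Lemma integrable3D D f g : measurable_vset D -> integrable3 D f -> integrable3 D g ->
  integrable3 D (fun x => f x + g x).
Proof. by move=> mD fi gi; apply: eq_integrable (integrableD mD fi gi). Qed.

Lemma integrable3Zl D a f : measurable_vset D -> integrable3 D f ->
  integrable3 D (fun x => a * f x).
Proof. by move=> mD fi; apply: eq_integrable (integrableZl mD a fi). Qed.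

Lemma integrable3_sum (I : Type) (r : seq I) (h : I -> vec R -> R) D : measurable_vset D ->
  (forall i, integrable3 D (h i)) -> integrable3 D (fun x => \sum_(i <- r) h i x).
Proof.
move=> mD hi; elim: r => [|i r IH].
  by under eq_fun do rewrite big_nil; apply: eq_integrable (integrable0 _ _).
by under eq_fun do rewrite big_cons; exact: integrable3D.
Qed.

Lemma int3D D f g : measurable_vset D -> integrable3 D f -> integrable3 D g ->
  int3 D (fun x => f x + g x) = int3 D f + int3 D g.
Proof. by move=> mD fi gi; exact: RintegralD. Qed.

Lemma int3Zl D a f : measurable_vset D -> integrable3 D f ->
  int3 D (fun x => a * f x) = a * int3 D f.
Proof. by move=> mD fi; exact: RintegralZl. Qed.

Lemma int3B D f g : measurable_vset D -> integrable3 D f -> integrable3 D g ->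
  int3 D (fun x => f x - g x) = int3 D f - int3 D g.
Proof. by move=> mD fi gi; exact: RintegralB. Qed.

Lemma int3_sum (I : Type) (r : seq I) (h : I -> vec R -> R) D : measurable_vset D ->
  (forall i, integrable3 D (h i)) ->
  int3 D (fun x => \sum_(i <- r) h i x) = \sum_(i <- r) int3 D (h i).
Proof.
move=> mD hi; elim: r => [|i r IH].
  by under eq_fun do rewrite big_nil; rewrite big_nil /int3 Rintegral_cst // mul0r.
under eq_fun do rewrite big_cons; rewrite big_cons int3D ?IH //.
exact: integrable3_sum.
Qed.

Let FF : Filter (almost_everywhere (leb3 R)).
Proof. exact: ae_filter_ringOfSetsType. Qed.

Lemma ae3S D (P Q : set (vec R)) : (forall x, D x -> P x -> Q x) -> ae3 D P -> ae3 D Q.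
Proof.
by rewrite /ae3 => h; apply: (@filterS _ _ FF) => p k Dp; apply: h => //; exact: k.
Qed.

Lemma ae3S2 D (P Q S : set (vec R)) : (forall x, D x -> P x -> Q x -> S x) ->
  ae3 D P -> ae3 D Q -> ae3 D S.
Proof.
rewrite /ae3 => h; apply: (@filterS2 _ _ FF) => p k1 k2 Dp.
by apply: h => //; [exact: k1|exact: k2].
Qed.

Lemma ae3W D (P : set (vec R)) : (forall x, D x -> P x) -> ae3 D P.
Proof. by move=> h; apply: aeW => p; exact: h. Qed.

Lemma ae3_sub A B (P : set (vec R)) : A `<=` B -> ae3 B P -> ae3 A P.
Proof. by move=> AB; rewrite /ae3; apply: (@filterS _ _ FF) => p h Ap; apply: h; exact: AB. Qed.

Lemma eq_int3 D f g : (forall x, D x -> f x = g x) -> int3 D f = int3 D g.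
Proof. by move=> h; apply: eq_Rintegral => p; rewrite inE => /h. Qed.

Lemma ae_eq_int3 D f g : measurable_vset D -> measurable3 D f -> measurable3 D g ->
  ae3 D [set x | f x = g x] -> int3 D f = int3 D g.
Proof.
move=> mD mf mg fg; rewrite /int3 /Rintegral; congr fine.
apply: ae_eq_integral => //; [exact/measurable_EFinP|exact/measurable_EFinP|].
by move: fg; rewrite /ae3; apply: (@filterS _ _ FF) => p h Dp /=; rewrite h.
Qed.

Lemma ge0_int3_ae D f : measurable_vset D -> measurable3 D f ->
  ae3 D [set x | 0 <= f x] -> 0 <= int3 D f.
Proof.
move=> mD mf f0; rewrite (@ae_eq_int3 _ _ (fun x => `|f x|)) //.
- by apply: Rintegral_ge0.
- by apply: measurableT_comp mf.
- by apply: ae3S f0 => x _ /= h; rewrite ger0_norm.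
Qed.

Lemma ae_le_int3 D f g : measurable_vset D -> integrable3 D f -> integrable3 D g ->
  ae3 D [set x | f x <= g x] -> int3 D f <= int3 D g.
Proof.
move=> mD fi gi fg; rewrite -subr_ge0 -int3B //; apply: ge0_int3_ae => //.
  exact: (measurable_funB (integrable3_measurable gi) (integrable3_measurable fi)).
by apply: ae3S fg => x _ /= h; rewrite subr_ge0.
Qed.

Lemma integrable3_bounded_mul D f g C : measurable_vset D -> integrable3 D f ->
  measurable3 D g -> (forall x, D x -> `|g x| <= C) -> integrable3 D (fun x => f x * g x).
Proof.
move=> mD fi mg gC; have mf := integrable3_measurable fi.
have Ci : integrable3 D (fun x => `|C| * f x) by exact: integrable3Zl.
apply: (le_integrable mD _ _ Ci); first by apply/measurable_EFinP; exact: measurable_funM.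
move=> p Dp /=; rewrite lee_fin !normrM normr_id mulrC ler_wpM2r //.
by apply: le_trans (gC _ Dp) _; exact: ler_norm.
Qed.

(** Stable under sums and products, and sufficient for integrability on subsets of compact sets: all
    volume integrands of the method are of this kind. *)
Definition ess_bounded D f := measurable3 D f /\ exists C, ae3 D [set x | `|f x| <= C].

Lemma ess_boundedD D f g : ess_bounded D f -> ess_bounded D g ->
  ess_bounded D (fun x => f x + g x).
Proof.
move=> [mf [C hf]] [mg [C' hg]]; split; first exact: measurable_funD.
exists (C + C'); apply: ae3S2 hf hg => x _ /= h1 h2.
by apply: le_trans (ler_normD _ _) _; exact: lerD.
Qed.

Lemma ess_boundedM D f g : ess_bounded D f -> ess_bounded D g ->
  ess_bounded D (fun x => f x * g x).
Proof.
move=> [mf [C hf]] [mg [C' hg]]; split; first exact: measurable_funM.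
exists (C * C'); apply: ae3S2 hf hg => x _ /= h1 h2.
by rewrite normrM; exact: ler_pM.
Qed.

Lemma ess_bounded_cst D a : ess_bounded D (fun=> a).
Proof. by split; [exact: measurable_cst|exists `|a|; apply: ae3W => x _ /=]. Qed.

Lemma ess_boundedN D f : ess_bounded D f -> ess_bounded D (fun x => - f x).
Proof.
move=> h; have -> : (fun x => - f x) = (fun x => -1 * f x).
  by apply/funext => x; rewrite mulN1r.
by apply: ess_boundedM => //; exact: ess_bounded_cst.
Qed.

Lemma ess_bounded_sum (I : Type) (r : seq I) (h : I -> vec R -> R) D :
  (forall i, ess_bounded D (h i)) -> ess_bounded D (fun x => \sum_(i <- r) h i x).
Proof.
move=> hi; elim: r => [|i r IH].
  by under eq_fun do rewrite big_nil; exact: ess_bounded_cst.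
by under eq_fun do rewrite big_cons; exact: ess_boundedD.
Qed.

Lemma ess_bounded_dot D (f g : vec R -> vec R) :
  (forall i, ess_bounded D (fun x => f x 0 i)) -> (forall i, ess_bounded D (fun x => g x 0 i)) ->
  ess_bounded D (fun x => dot (f x) (g x)).
Proof. by move=> hf hg; apply: ess_bounded_sum => i; exact: ess_boundedM. Qed.

Lemma ess_boundedS A B f : measurable_vset A -> measurable_vset B -> A `<=` B ->
  ess_bounded B f -> ess_bounded A f.
Proof.
move=> mA mB AB [mf [C hC]]; split; first by apply: measurable_funS mf => // p; exact: AB.
by exists C; exact: ae3_sub AB hC.
Qed.

Lemma ae_eq_ess_bounded D f g : measurable3 D g -> ae3 D [set x | f x = g x] ->
  ess_bounded D f -> ess_bounded D g.
Proof.
move=> mg fg [mf [C hC]]; split => //; exists C.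
by apply: ae3S2 fg hC => x _ /= <-.
Qed.

Lemma ess_bounded_integrable3 K D f : compact K -> D `<=` K -> measurable_vset D ->
  ess_bounded D f -> integrable3 D f.
Proof.
move=> cK DK mD [mf [C hC]]; apply/integrableP; split; first exact/measurable_EFinP.
apply: le_lt_trans (@integral_le_bound _ _ _ _ _ _ `|C|%:E mD _ _ _) _.
- exact/measurable_EFinP.
- by rewrite lee_fin.
- move: hC; rewrite /ae3; apply: (@filterS _ _ FF) => p h Dp /=; rewrite lee_fin.
  by apply: le_trans (h Dp) _; exact: ler_norm.
- have := compact_vol_lty cK DK mD; rewrite /vol => v; by rewrite lte_mul_pinfty.
Qed.

Lemma within_ess_bounded K D f : compact K -> D `<=` K -> measurable_vset D ->
  {within K, continuous f} -> ess_bounded D f.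
Proof.
move=> cK DK mD cf; split.
  by apply: within_continuous_measurable3 => //; exact: continuous_subspaceW DK cf.
have [C [_ hC]] := within_compact_bounded cK cf.
by exists C; apply: ae3W => x /DK; exact: hC.
Qed.

Lemma continuous_ess_bounded K D f : compact K -> D `<=` K -> measurable_vset D ->
  continuous f -> ess_bounded D f.
Proof.
by move=> cK DK mD cf; apply: (within_ess_bounded cK) => //; exact: continuous_subspaceT.
Qed.

Lemma compact_measurable_vset (K : set (vec R)) : compact K -> measurable_vset K.
Proof. by move=> cK; apply: closed_measurable_vset; exact: compact_closed. Qed.


Lemma locally_integrable3_mul D f g : locally_integrable3 D f -> {within D, continuous g} ->
  locally_integrable3 D (fun x => f x * g x).
Proof.
move=> fl cg K cK KD; have mK := compact_measurable_vset cK.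
have cgK : {within K, continuous g} by exact: continuous_subspaceW KD cg.
have [C [_ hC]] := within_compact_bounded cK cgK.
apply: (integrable3_bounded_mul mK (fl _ cK KD) _ hC).
exact: within_continuous_measurable3.
Qed.

Lemma within_continuousM D f g : {within D, continuous f} -> {within D, continuous g} ->
  {within D, continuous (fun x => f x * g x)}.
Proof. by move=> cf cg x; exact: cvgM (cf x) (cg x). Qed.

Lemma within_locally_integrable3 D f : {within D, continuous f} -> locally_integrable3 D f.
Proof.
move=> cf K cK KD; have mK := compact_measurable_vset cK.
have cfK : {within K, continuous f} by exact: continuous_subspaceW KD cf.
by apply: (ess_bounded_integrable3 cK) => //; exact: within_ess_bounded cfK.
Qed.

(** The product of [phi] with [p] is again a test function, and testing with it gives the product
    rule. All integrals are first moved to the compact set [K] carrying [phi], where every term is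
    integrable and the integral additive. *)
Lemma weak_partial_mul D D' j f g p : D `<=` D' ->
  {within D', continuous f} -> is_weak_partial D' j f g -> polyfun p ->
  is_weak_partial D j (fun x => f x * p x) (fun x => g x * p x + f x * partial j p x).
Proof.
move=> DD' cf [gl gw] pp.
have cp := polyfun_continuous pp; have cdp := polyfun_continuous (polyfun_partial j pp).
have cfD : {within D, continuous f} by exact: continuous_subspaceW DD' cf.
have glD : locally_integrable3 D g by move=> K cK KD; apply: gl => //; exact: subset_trans DD'.
have l1 : locally_integrable3 D (fun x => g x * p x).
  by apply: locally_integrable3_mul => //; exact: continuous_subspaceT.
have l2 : locally_integrable3 D (fun x => f x * partial j p x).
  by apply: within_locally_integrable3; apply: within_continuousM => //; exact: continuous_subspaceT.
split=> [K cK KD|phi [dphi cphi [K [cK KD phi0]]]].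
  by apply: integrable3D; [exact: compact_measurable_vset|exact: l1|exact: l2].
have phic := C1_continuous dphi cphi.
have mK := compact_measurable_vset cK; have KD' := subset_trans KD DD'.
have is_d x k : is_derive x (delta_mx 0 k) (fun y => phi y * p y)
    (phi x * partial k p x + p x * partial k phi x).
  have h1 : is_derive x (delta_mx 0 k) phi (partial k phi x) by split; [exact: dphi|].
  have h2 : is_derive x (delta_mx 0 k) p (partial k p x) by split; [exact: polyfun_derivable|].
  exact: is_deriveM h1 h2.
have pE k x : partial k (fun y => phi y * p y) x = phi x * partial k p x + p x * partial k phi x.
  by have [] := is_d x k.
have tp : test_function D' (fun x => phi x * p x).
  split=> [x k|k|]; first by have [] := is_d x k.
    rewrite (funext (pE k)) => x.
    have cpk := polyfun_continuous (polyfun_partial k pp).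
    exact: cvgD (cvgM (phic x) (cpk x)) (cvgM (cp x) (cphi k x)).
  by exists K; split => // x Kx; rewrite phi0 // mul0r.
have dphi0 x : ~ K x -> partial j phi x = 0.
  by apply: partial_eq0 phi0; exact: compact_closed.
have := gw _ tp.
have r h (E : set (vec R)) : K `<=` E -> (forall x, ~ K x -> h x = 0) -> int3 E h = int3 K h.
  by move=> KE h0; apply: int3_subset => // x _; exact: h0.
rewrite (r _ D') //; last first.
  by move=> x Kx; rewrite pE phi0 // dphi0 // mul0r mulr0 addr0 mulr0.
rewrite [X in _ = - X](r _ D') //; last by move=> x Kx; rewrite phi0 // mul0r mulr0.
rewrite (r _ D) //; last by move=> x Kx; rewrite dphi0 // mulr0.
rewrite [X in _ -> _ = - X](r _ D) //; last by move=> x Kx; rewrite phi0 // mulr0.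
have cT (h : vec R -> R) : continuous h -> {within K, continuous h} by exact: continuous_subspaceT.
have cfK : {within K, continuous f} by exact: continuous_subspaceW KD' cf.
have int_c (h : vec R -> R) : {within K, continuous h} -> integrable3 K h.
  by move=> ch; exact: (within_locally_integrable3 ch).
have i1 : integrable3 K (fun x => f x * p x * partial j phi x).
  apply: int_c; apply: within_continuousM; last exact: cT.
  by apply: within_continuousM => //; exact: cT.
have i2 : integrable3 K (fun x => f x * partial j p x * phi x).
  apply: int_c; apply: within_continuousM; last exact: cT.
  by apply: within_continuousM => //; exact: cT.
have i3 : integrable3 K (fun x => g x * p x * phi x).
  have [C [_ hC]] := within_compact_bounded cK (cT _ phic).
  apply: (integrable3_bounded_mul mK (l1 _ cK KD) _ hC).
  exact: continuous_measurable3.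
rewrite (@eq_int3 K _ (fun x => f x * p x * partial j phi x + f x * partial j p x * phi x)); last first.
  by move=> x _; rewrite pE; ring.
rewrite int3D // (@eq_int3 K (fun x => g x * _) (fun x => g x * p x * phi x)); last first.
  by move=> x _; ring.
rewrite [X in _ -> _ = - X](@eq_int3 K _ (fun x => g x * p x * phi x + f x * partial j p x * phi x));
  last by move=> x _; ring.
by rewrite int3D // => e; lra.
Qed.

End Int3.

Lemma cvg_sum_seq (R : realType) (I : Type) (r : seq I) (T : Type) (F : set_system T)
    (FF : Filter F) (u : I -> T -> R) (l : I -> R) : (forall i, u i x @[x --> F] --> l i) ->
  (\sum_(i <- r) u i x) @[x --> F] --> \sum_(i <- r) l i.
Proof.
move=> h; elim: r => [|i r IH].
  by rewrite big_nil; under eq_fun do rewrite big_nil; exact: cvg_cst.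
by rewrite big_cons; under eq_fun do rewrite big_cons; exact: cvgD (h i) IH.
Qed.

(** * The divergence theorem on an element *)

Section Divergence.
Variables (R : realType) (M : mesh R) (t : 'I_(nelem M)).
Hypothesis ndeg : \det (\matrix_(i < 3) (vtx t (lift 0 i) - vtx t 0)) != 0.

Lemma divergence_elem j (F G : vec R -> R) : {within elem t, continuous F} ->
  is_weak_partial (oelem t) j F G -> integrable3 (oelem t) G ->
  int3 (oelem t) G = \sum_(i < 4) normal (t, i) 0 j * facet_int (t, i) F.
Proof.
move=> cF [_ w] iG.
have mO : measurable_vset (oelem t) by apply: open_measurable_vset; exact: open_oelem.
(* Testing with the cutoff of the element: its gradient splits into four layers, one per face, each
   in the constant direction of a barycentric gradient. *)
have E n : \sum_(i < 4) (bary_form t i).1 0 j * (n.+1%:R * int3 (oelem t) (fun x => F x * layer t i n x))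
    = - int3 (oelem t) (fun x => G x * cutoff (bary_form t) n x).
  rewrite -w; last first.
    apply: test_function_cutoff; last by rewrite oelem_bary.
    have -> : [set x | forall i, 0 <= ell (bary_form t) i x] = elem t by rewrite elem_bary.
    exact: elem_compact.
  rewrite (@eq_int3 _ _ _ (fun x => \sum_(i < 4) ((bary_form t i).1 0 j * n.+1%:R) * (F x * layer t i n x))); last first.
    move=> x _; rewrite partial_cutoff mulr_sumr; apply: eq_bigr => i _.
    by rewrite /layer /bary; ring.
  rewrite int3_sum // => [|i]; last by apply: integrable3Zl => //; exact: layer_integrable.
  apply: eq_bigr => i _; rewrite int3Zl //; last exact: layer_integrable.
  by rewrite mulrA.
have c1 : - int3 (oelem t) (fun x => G x * cutoff (bary_form t) n x) @[n --> \oo] --> - int3 (oelem t) G.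
  apply: cvgN.
  have oE : oelem t = [set x | forall i, 0 < ell (bary_form t) i x] by rewrite oelem_bary.
  rewrite oE in iG *; exact: cvg_int3_cutoff.
have c2 : (\sum_(i < 4) (bary_form t i).1 0 j *
      (n.+1%:R * int3 (oelem t) (fun x => F x * layer t i n x))) @[n --> \oo] -->
    \sum_(i < 4) (bary_form t i).1 0 j * (`|fdet (t, i)| *
      \int[leb2 R]_(q in @ref_triangle R) F (facet_param (t, i) q)).
  have cs i : (bary_form t i).1 0 j *
      (n.+1%:R * int3 (oelem t) (fun x => F x * layer t i n x)) @[n --> \oo] -->
      (bary_form t i).1 0 j * (`|fdet (t, i)| *
      \int[leb2 R]_(q in @ref_triangle R) F (facet_param (t, i) q)).
    have h := @cvg_int3_layer _ _ _ ndeg i F cF.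
    by apply: cvgM; [exact: cvg_cst|exact: h].
  exact: cvg_sum_seq cs.
rewrite (funext E) in c2.
have e := cvg_unique _ c1 c2.
apply: oppr_inj; rewrite e; last by [].
rewrite -sumrN; apply: eq_bigr => i _.
have mz (a : R) (u : vec R) : (a *: u) 0 j = a * u 0 j by rewrite mxE.
rewrite /bary_form /= /normal /facet_int !mz.
set c := facet_cross (t, i); set d := fdet (t, i); set I := Rintegral _ _ _.
have d0 : d != 0 by exact: fdet_neq0.
have c0 : c != 0.
  by apply: contraNneq d0 => c0; rewrite /d /fdet -/c c0 dot0l.
have ec : enorm c != 0 by rewrite lt0r_neq0 // enorm_gt0.
(* This sign orients the cross product towards the apex, as barycentric gradients are; the minus
   sign of the weak derivative turns it into the outward normal. *)
have sd : d^-1 * `|d| = Num.sg d by rewrite normrEsg mulrCA mulVf // mulr1.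
have -> : dot c (vtx t i - fvtx (t, i) 0) = d by [].
transitivity ((d^-1 * `|d|) * c 0 j * I); first by ring.
rewrite sd; by field.
Qed.
End Divergence.

(** * The two sides of an interior facet *)

Section PlaneChange.
Variable R : realType.
Notation mR := (measurableTypeR R).
Notation mu := (@lebesgue_measure R).
Notation T2 := (mR * mR)%type.
Notation T3 := (mR * mR * mR)%type.
Variables (q0 q1 q2 : R * R).

Definition affine2 (q : T2) : T2 :=
  (q0.1 + q.1 * (q1.1 - q0.1) + q.2 * (q2.1 - q0.1),
   q0.2 + q.1 * (q1.2 - q0.2) + q.2 * (q2.2 - q0.2)).
Definition det2 : R :=
  (q1.1 - q0.1) * (q2.2 - q0.2) - (q1.2 - q0.2) * (q2.1 - q0.1).

Lemma measurable_affine2 : measurable_fun setT affine2.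
Proof.
have h a b c : measurable_fun setT (fun q : T2 => a + q.1 * b + q.2 * c : mR).
  apply: measurable_funD; last first.
    by apply: measurable_funM => //; exact: measurable_snd.
  by apply: measurable_funD => //; apply: measurable_funM => //; exact: measurable_fst.
by apply/measurable_fun_pairP; split; exact: h.
Qed.

(** Deduced from the change of variables in space, applied to the cylinder of height 1 over [S]. *)
Lemma leb2_affine2 S : det2 != 0 -> measurable S ->
  (`|det2|%:E * leb2 R (affine2 @^-1` S) = leb2 R S)%E.
Proof.
move=> d0 mS.
pose A : 'M[R]_3 := \matrix_(k < 3)
  [:: point3 ((q1.1 - q0.1, q1.2 - q0.2), 0);
      point3 ((q2.1 - q0.1, q2.2 - q0.2), 0); point3 ((0, 0), 1)]`_k.
have dA : \det A = det2.
  by rewrite det_rows !rowK /= crossE dotE !mxE /= /det2; ring.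
have I1 : mu (`[0%R, 1%R]%classic : set mR) = 1%E.
  by rewrite lebesgue_measure_itv /= lte_fin ltr01 sube0.
have mI : measurable (`[0%R, 1%R]%classic : set mR) by exact: measurable_itv.
have mS' : measurable (affine2 @^-1` S).
  by have := measurable_affine2 measurableT mS; rewrite setTI.
have e3 (E : set T2) : measurable E -> leb3 R (E `*` `[0%R, 1%R]%classic) = leb2 R E.
  move=> mE; apply: etrans (product_measure1E (leb2 R) mu mE mI) _.
  by rewrite [X in (_ * X)%E]I1 mule1.
have aE (p : T3) : affine3 (point3 (q0, 0)) A p = (affine2 p.1, p.2).
  rewrite -[RHS]point3K /affine3; congr unpoint3; apply/rowP; apply: forall_I3;
  rewrite !mxE sum_I3 !mxE /= /affine2 /=; ring.
have E : affine3 (point3 (q0, 0)) A @^-1` (S `*` `[0%R, 1%R]%classic) =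
    (affine2 @^-1` S) `*` `[0%R, 1%R]%classic.
  by rewrite (funext aE).
have dA0 : \det A != 0 by rewrite dA.
have := leb3_affine3 (point3 (q0, 0)) dA0 (measurableX mS mI).
rewrite E dA (e3 _ mS) (e3 _ mS'); exact.
Qed.

Lemma Rintegral_affine2 (D : set T2) (f : T2 -> R) : det2 != 0 -> measurable D ->
  (leb2 R).-integrable D (EFin \o f) ->
  `|det2| * \int[leb2 R]_(q in affine2 @^-1` D) f (affine2 q) = \int[leb2 R]_(q in D) f q.
Proof.
move=> d0; have k0 : 0 < `|det2| by rewrite normr_gt0.
exact: (@Rintegral_scaling _ _ _ (leb2 R) _ _ measurable_affine2 k0
  (fun S mS => leb2_affine2 d0 mS)).
Qed.
End PlaneChange.

Section Facets.
Variables (R : realType) (M : mesh R).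
Notation ndeg t := (\det (\matrix_(i < 3) (vtx t (lift 0 i) - vtx t 0)) != 0).
Hypothesis nd : forall t : 'I_(nelem M), ndeg t.
Implicit Types s : side M.

Lemma facet_paramE s : facet s = [set facet_param s q | q in @ref_triangle R].
Proof.
apply/seteqP; split => [x [l [l0 l1 ->]]|_ [q [h0 h1 h2] <-]].
  have e : l 0 = 1 - l 1 - l 2 by rewrite -l1 sum_I3; ring.
  exists (l 1, l 2).
    by split => //=; have := l0 0; rewrite e; lra.
  rewrite /facet_param /= !big_ord_recr big_ord0 /= add0r.
  have -> : widen_ord (leqnSn 2) (widen_ord (leqnSn 1) ord_max) = 0 :> 'I_3 by apply: val_inj.
  have -> : widen_ord (leqnSn 2) ord_max = 1 :> 'I_3 by apply: val_inj.
  have -> : ord_max = 2 :> 'I_3 by apply: val_inj.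
  by rewrite e; apply/rowP => k; rewrite !mxE; ring.
exists (fun k : 'I_3 => [:: 1 - q.1 - q.2; q.1; q.2]`_k); split.
- by apply: forall_I3 => /=; lra.
- by rewrite sum_I3 /=; ring.
- rewrite /facet_param /= !big_ord_recr big_ord0 /= add0r.
  have -> : widen_ord (leqnSn 2) (widen_ord (leqnSn 1) ord_max) = 0 :> 'I_3 by apply: val_inj.
  have -> : widen_ord (leqnSn 2) ord_max = 1 :> 'I_3 by apply: val_inj.
  have -> : ord_max = 2 :> 'I_3 by apply: val_inj.
  by apply/rowP => k; rewrite !mxE; ring.
Qed.

Lemma open_facet_param s q : open_triangle q -> ofacet s (facet_param s q).
Proof.
move=> [h0 h1 h2]; exists (fun k : 'I_3 => [:: 1 - q.1 - q.2; q.1; q.2]`_k); split.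
- by apply: forall_I3 => /=; lra.
- by rewrite sum_I3 /=; ring.
- rewrite /facet_param /= !big_ord_recr big_ord0 /= add0r.
  have -> : widen_ord (leqnSn 2) (widen_ord (leqnSn 1) ord_max) = 0 :> 'I_3 by apply: val_inj.
  have -> : widen_ord (leqnSn 2) ord_max = 1 :> 'I_3 by apply: val_inj.
  have -> : ord_max = 2 :> 'I_3 by apply: val_inj.
  by apply/rowP => k; rewrite !mxE; ring.
Qed.

Lemma facet_param_in s q : ref_triangle q -> facet s (facet_param s q).
Proof. by move=> h; rewrite facet_paramE; exists q. Qed.

Lemma facet_elem s : facet s `<=` elem s.1.
Proof. by rewrite facet_paramE => _ [q hq <-]; case: s => t i; exact: facet_param_elem. Qed.

Lemma facet_param_inj s q q' : facet_param s q = facet_param s q' -> q = q'.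
Proof.
case: s => t i e; have [_ _ b1 b2] := bary_facet_param (nd t) i q.
have [_ _ c1 c2] := bary_facet_param (nd t) i q'; rewrite -e in c1 c2.
by case: q q' {e} b1 b2 c1 c2 => [a b] [a' b'] /= -> -> -> ->.
Qed.

Lemma fvtx_param s : [/\ fvtx s 0 = facet_param s (0, 0),
  fvtx s 1 = facet_param s (1, 0) & fvtx s 2 = facet_param s (0, 1)].
Proof. by split; apply/rowP => k; rewrite !mxE /=; ring. Qed.

Lemma facet_cross_neq0 s : facet_cross s != 0.
Proof.
case: s => t i; have := fdet_neq0 (nd t) i; apply: contraNneq => c0.
by rewrite /fdet c0 dot0l.
Qed.

Lemma dot_facet_cross_param s q : dot (facet_cross s) (facet_param s q - fvtx s 0) = 0.
Proof.
have -> : facet_param s q - fvtx s 0 = q.1 *: (fvtx s 1 - fvtx s 0) + q.2 *: (fvtx s 2 - fvtx s 0).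
  by rewrite /facet_param; apply/rowP => k; rewrite !mxE; ring.
by rewrite dotDr !dotZr dot_cross_l dot_cross_r !mulr0 addr0.
Qed.

Section same_facet.
Variables s s' : side M.
Hypothesis ss' : facet s' = facet s.

(** Each vertex of one side has a parameter in the other, and both parametrizations are affine; so
    they differ by the affine map with these vertex images. It preserves the triangle because both
    parametrizations are injective with the same image. *)
Lemma same_facet_map : exists q0 q1 q2 : R * R,
  [/\ forall q, facet_param s' q = facet_param s (affine2 q0 q1 q2 q),
      facet_cross s' = det2 q0 q1 q2 *: facet_cross s, det2 q0 q1 q2 != 0 &
      affine2 q0 q1 q2 @^-1` @ref_triangle R = @ref_triangle R].
Proof.
have [e0 e1 e2] := fvtx_param s'.
have hq q : ref_triangle q -> exists2 q', ref_triangle q' & facet_param s q' = facet_param s' q.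
  by move=> /(facet_param_in s'); rewrite ss' facet_paramE.
have hq' q : ref_triangle q -> exists2 q', ref_triangle q' & facet_param s' q' = facet_param s q.
  by move=> /(facet_param_in s); rewrite -ss' facet_paramE.
have [|q0 t0 f0] := hq (0, 0); first by split => /=; lra.
have [|q1 t1 f1] := hq (1, 0); first by split => /=; lra.
have [|q2 t2 f2] := hq (0, 1); first by split => /=; lra.
rewrite -{}f0 in e0; rewrite -{}f1 in e1; rewrite -{}f2 in e2.
exists q0, q1, q2.
have pE q : facet_param s' q = facet_param s (affine2 q0 q1 q2 q).
  rewrite [LHS]/facet_param e0 e1 e2 /facet_param /affine2 /=.
  by apply/rowP => k; rewrite !mxE; ring.
have cE : facet_cross s' = det2 q0 q1 q2 *: facet_cross s.
  rewrite /facet_cross e0 e1 e2 /facet_param /det2 -cross_lin; congr cross;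
  by apply/rowP => k; rewrite !mxE; ring.
split => //.
  by have := facet_cross_neq0 s'; rewrite cE; apply: contraNneq => ->; rewrite scale0r.
apply/seteqP; split => q /= h.
  have [q' h' e'] := hq' _ h; rewrite -pE in e'.
  by rewrite -(facet_param_inj e').
have [q' h' e'] := hq _ h; rewrite pE in e'.
by rewrite -(facet_param_inj e').
Qed.

(** The Jacobian of the change of parameters is exactly the ratio of the two area factors. *)
Lemma facet_int_eq (f : vec R -> R) :
  (leb2 R).-integrable (@ref_triangle R : set (measurableTypeR R * measurableTypeR R)) (EFin \o (f \o facet_param s)) ->
  facet_int s' f = facet_int s f.
Proof.
move=> fi; have [q0 [q1 [q2 [pE cE d0 tE]]]] := same_facet_map.
rewrite /facet_int cE enormZ.
have := Rintegral_affine2 d0 (@measurable_ref_triangle R) fi; rewrite tE => <-.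
rewrite [`|_| * enorm _]mulrC -mulrA; congr (_ * (_ * _)).
by apply: eq_Rintegral => q _ /=; rewrite pE.
Qed.

End same_facet.

Hypothesis disj : forall t t' : 'I_(nelem M), t != t' -> (elem t)° `&` (elem t')° = set0.

Lemma opposite_apex s s' : facet s' = facet s -> s'.1 != s.1 ->
  dot (facet_cross s) (vtx s.1 s.2 - fvtx s 0) * dot (facet_cross s) (vtx s'.1 s'.2 - fvtx s 0) < 0.
Proof.
case: s s' => [t i] [t' i'] /= sE st; have [q0 [q1 [q2 [pE cE d0 tE]]]] := same_facet_map sE.
set D := dot _ _; set D' := dot _ _.
have D0 : D != 0 by exact: fdet_neq0 (nd t) i.
have w0E : dot (facet_cross (t, i)) (fvtx (t', i') 0 - fvtx (t, i) 0) = 0.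
  have [-> _ _] := fvtx_param (t', i'); rewrite pE; exact: dot_facet_cross_param.
have fd' : fdet (t', i') = det2 q0 q1 q2 * D'.
  rewrite /fdet cE dotZl /=; congr (_ * _).
  have -> : vtx t' i' - fvtx (t', i') 0 = (vtx t' i' - fvtx (t, i) 0) - (fvtx (t', i') 0 - fvtx (t, i) 0).
    by apply/rowP => k; rewrite !mxE; ring.
  by rewrite dotBr w0E subr0.
have D'0 : D' != 0.
  by have := fdet_neq0 (nd t') i'; rewrite fd' mulf_eq0 negb_or => /andP[].
rewrite ltNge; apply/negP => DD'.
have {}DD' : 0 < D' / D.
  have : D' / D = (D * D') / D ^+ 2 by field.
  by move=> ->; rewrite divr_gt0 // ?exprn_even_gt0 // lt_neqAle DD' eq_sym mulf_neq0.
(* A point of the relative interior of the common facet, pushed towards the apex,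
   would be interior to both elements. *)
have [q qt qE] : exists2 q, ref_triangle q & facet_param (t, i) q = facet_param (t', i') (3^-1, 3^-1).
  have : facet (t', i') (facet_param (t', i') (3^-1, 3^-1)).
    by apply: facet_param_in; split => /=; lra.
  by rewrite sE facet_paramE.
have [q' qt' qE'] : exists2 q, ref_triangle q & facet_param (t', i') q = facet_param (t, i) (3^-1, 3^-1).
  have : facet (t, i) (facet_param (t, i) (3^-1, 3^-1)).
    by apply: facet_param_in; split => /=; lra.
  by rewrite -sE facet_paramE.
(* Midpoint of the two centroids, each computed from the vertices of its own side. Seen from either
   side it is the midpoint of the centroid and a point of the triangle, hence has positive
   coordinates, whatever the vertex orders. *)
pose b := facet_param (t, i) ((q.1 + 3^-1) / 2, (q.2 + 3^-1) / 2).
have bE' : b = facet_param (t', i') ((q'.1 + 3^-1) / 2, (q'.2 + 3^-1) / 2).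
  have h (s0 : side M) (a c : R * R) : facet_param s0 ((a.1 + c.1) / 2, (a.2 + c.2) / 2) =
      2^-1 *: (facet_param s0 a + facet_param s0 c).
    by rewrite /facet_param; apply/rowP => k; rewrite !mxE /=; field.
  by rewrite /b (h _ q (_, _)) (h _ q' (_, _)) qE qE' addrC.
have bpos (t0 : 'I_(nelem M)) i0 (a : R * R) k : ref_triangle a ->
    0 < bary t0 (lift i0 k) (facet_param (t0, i0) ((a.1 + 3^-1) / 2, (a.2 + 3^-1) / 2)).
  move=> [h0 h1 h2].
  have [_ e0 e1 e2] := bary_facet_param (nd t0) i0 ((a.1 + 3^-1) / 2, (a.2 + 3^-1) / 2).
  by move: k; apply: forall_I3; rewrite ?e0 ?e1 ?e2 /=; lra.
pose x (h : R) := h *: (vtx t i - b) + b.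
have ev (t0 : 'I_(nelem M)) j : 0 < bary t0 j b -> \forall h \near 0^'+, 0 < bary t0 j (x h).
  move=> hb.
  have c : (fun h => bary t0 j (x h)) @ 0^'+ --> bary t0 j b.
    apply: cvg_at_right_filter.
    have -> : (fun h => bary t0 j (x h)) = fun h => bary t0 j b + h * (bary t0 j (vtx t i) - bary t0 j b).
      by apply/funext => h; rewrite /x baryZD.
    have c' : (fun h => bary t0 j b + h * (bary t0 j (vtx t i) - bary t0 j b)) @ (0 : R) -->
        bary t0 j b + 0 * (bary t0 j (vtx t i) - bary t0 j b).
      exact: (cvgD (cvg_cst _) (cvgM cvg_id (cvg_cst _))).
    by rewrite mul0r addr0 in c'.
  exact: (cvgr_gt _ c _ hb).
have ev1 : \forall h \near 0^'+, forall k, 0 < bary t (lift i k) (x h).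
  by apply: filter_forall => k; apply: ev; exact: bpos.
have ev2 : \forall h \near 0^'+, forall k, 0 < bary t' (lift i' k) (x h).
  by apply: filter_forall => k; apply: ev; rewrite bE'; exact: bpos.
have ev0 : \forall h \near (0:R)^'+, 0 < h by exact: nbhs_right_gt.
have ev3 : \forall h \near (0:R)^'+, [/\ forall k, 0 < bary t (lift i k) (x h),
    forall k, 0 < bary t' (lift i' k) (x h) & 0 < h].
  by apply: filterS3 ev1 ev2 ev0 => h h1 h2 h3; split.
have [h [h1 h2 h0]] : exists h, [/\ forall k, 0 < bary t (lift i k) (x h),
    forall k, 0 < bary t' (lift i' k) (x h) & 0 < h] by exact: (@filter_ex _ _ (at_right_proper_filter (0 : R)) _ ev3).
have o1 : (elem t)° (x h).
  rewrite -/(oelem t) (oelem_bary (nd t)) => j; have [<-|ij] := eqVneq i j.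
    rewrite /x baryZD bary_vtx // eqxx.
    have [e0 _ _ _] := bary_facet_param (nd t) i ((q.1 + 3^-1) / 2, (q.2 + 3^-1) / 2).
    by rewrite -/b in e0; rewrite e0 subr0 add0r mulr1.
  by have [k ->] := unlift_some ij.
have o2 : (elem t')° (x h).
  rewrite -/(oelem t') (oelem_bary (nd t')) => j; have [<-|ij] := eqVneq i' j.
    have -> : bary t' i' (x h) = h / (D' / D).
      rewrite baryE fd' cE dotZl.
      have -> : x h - fvtx (t', i') 0 = h *: (vtx t i - fvtx (t, i) 0) +
          (1 - h) *: (b - fvtx (t, i) 0) - (fvtx (t', i') 0 - fvtx (t, i) 0).
        by rewrite /x; apply/rowP => k; rewrite !mxE; ring.
      rewrite dotBr w0E dotDr !dotZr -/D /b dot_facet_cross_param.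
      by field; rewrite d0 D0 D'0.
    by rewrite divr_gt0.
  by have [k ->] := unlift_some ij.
have : ((elem t)° `&` (elem t')°) (x h) by [].
by rewrite disj // eq_sym.
Qed.

(** Both normals are multiples of one cross product, each oriented away from its own apex, and the
    apexes lie on different sides of the facet. *)
Lemma opposite_normals s s' : facet s' = facet s -> s'.1 != s.1 -> normal s' = - normal s.
Proof.
move=> ss' st; have opp := opposite_apex ss' st.
have [q0 [q1 [q2 [pE cE d0 tE]]]] := same_facet_map ss'.
have w0E : dot (facet_cross s) (fvtx s' 0 - fvtx s 0) = 0.
  have [-> _ _] := fvtx_param s'; rewrite pE; exact: dot_facet_cross_param.
rewrite /normal cE enormZ dotZl.
have -> : vtx s'.1 s'.2 - fvtx s' 0 = (vtx s'.1 s'.2 - fvtx s 0) - (fvtx s' 0 - fvtx s 0).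
  by apply/rowP => k; rewrite !mxE; ring.
rewrite dotBr w0E subr0 scalerA -[RHS]scaleNr; congr (_ *: _).
rewrite sgrM; set D := dot _ (vtx s.1 s.2 - _) in opp *; set D' := dot _ _ in opp *.
set d := det2 _ _ _ in d0 *; have n0 : enorm (facet_cross s) != 0.
  by rewrite lt0r_neq0 // enorm_gt0 // facet_cross_neq0.
have -> : Num.sg D' = - Num.sg D.
  have [Dp|Dn|D0] := ltgtP D 0; last by move: opp; rewrite D0 mul0r ltxx.
    have D'p : 0 < D' by rewrite -(nmulr_rlt0 _ Dp).
    by rewrite gtr0_sg // ltr0_sg // opprK.
  have D'n : D' < 0 by rewrite -(pmulr_rlt0 _ Dn).
  by rewrite ltr0_sg // gtr0_sg.
have dn : `|d| != 0 by rewrite normr_eq0.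
have S2 : Num.sg d * Num.sg d = 1 by rewrite -expr2 sqr_sg d0.
transitivity (- (Num.sg d * - Num.sg D / (`|d| * enorm (facet_cross s))) * (Num.sg d * `|d|)).
  by rewrite -numEsg.
transitivity ((Num.sg d * Num.sg d) * (Num.sg D / enorm (facet_cross s))).
  by field; rewrite n0 dn.
by rewrite S2 mul1r opprK.
Qed.

End Facets.

(** * Neighbours, and elements inside the domain *)

Section Neighbours.
Variables (R : realType) (Omega : set (vec R)) (M : mesh R).
Hypothesis hM : conforming_triangulation Omega M.
Implicit Types s : side M.

Lemma conforming_ndeg t : \det (\matrix_(i < 3) (@vtx R M t (lift 0 i) - vtx t 0)) != 0.
Proof. by have [nd _ _ _] := hM; exact: nd. Qed.

Lemma conforming_disj (t t' : 'I_(nelem M)) : t != t' -> (elem t)° `&` (elem t')° = set0.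
Proof. by have [_ _ d _] := hM; exact: d. Qed.

(** If the facets coincided, the vertex [i'] would lie on the facet opposite to it, where its
    barycentric coordinate is 0 and not 1. *)
Lemma facet_inj_vertex (t : 'I_(nelem M)) i i' :
  facet ((t, i) : side M) = facet ((t, i') : side M) -> i = i'.
Proof.
move=> e; apply/eqP; apply: contraT => ii'.
have [k ek] := unlift_some ii'.
have h : facet ((t, i') : side M) (vtx t i').
  rewrite -e; have -> : vtx t i' = fvtx ((t, i) : side M) k by rewrite /fvtx /= -ek.
  have [e0 e1 e2] := fvtx_param ((t, i) : side M).
  move: k {ek}; apply: forall_I3; rewrite ?e0 ?e1 ?e2; apply: facet_param_in; split => /=; lra.
move: h; rewrite facet_paramE => -[q _ qE].
have [b0 _ _ _] := bary_facet_param (conforming_ndeg t) i' q.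
move: b0; rewrite qE bary_vtx ?eqxx; last exact: conforming_ndeg.
by move/eqP; rewrite oner_eq0.
Qed.

Lemma neighbourP s s' : neighbour Omega s = Some s' ->
  [/\ ~~ boundary_facet Omega s, s'.1 != s.1 & facet s' = facet s].
Proof.
rewrite /neighbour; case: ifP => // bs; case: pickP => // s0 /andP[h1 /asboolP h2] [<-].
by split.
Qed.

Lemma boundary_facet_eq s s' : facet s' = facet s ->
  boundary_facet Omega s' = boundary_facet Omega s.
Proof. by rewrite /boundary_facet => ->. Qed.

Lemma neighbour_exists s : ~~ boundary_facet Omega s -> exists s', neighbour Omega s = Some s'.
Proof.
move=> bs; rewrite /neighbour (negbTE bs); case: pickP => [s' _|h]; first by exists s'.
have [_ _ _ /(_ s)[b|[s' [h1 h2]]]] := hM.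
  by move: bs => /asboolPn /(_ b).
by have := h s'; rewrite h1 asboolT.
Qed.

(** Three elements on one facet would have three apexes, pairwise on different sides of a plane.
    Uniqueness makes the choice in [neighbour] symmetric. *)
Lemma neighbour_unique s s1 s2 : facet s1 = facet s -> s1.1 != s.1 ->
  facet s2 = facet s -> s2.1 != s.1 -> s1 = s2.
Proof.
move=> f1 n1 f2 n2; have nd := conforming_ndeg; have dj := conforming_disj.
have [e|n12] := eqVneq s2.1 s1.1.
  case: s1 s2 e f1 f2 {n1 n2} => [t1 i1] [t2 i2] /= -> f1 f2.
  by rewrite (facet_inj_vertex (etrans f1 (esym f2))).
have o1 := opposite_apex nd dj f1 n1; have o2 := opposite_apex nd dj f2 n2.
have f12 : facet s2 = facet s1 by rewrite f1 f2.
have o12 := opposite_apex nd dj f12 n12.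
have [q0 [q1 [q2 [pE cE d0 tE]]]] := same_facet_map nd f1.
have w0E : dot (facet_cross s) (fvtx s1 0 - fvtx s 0) = 0.
  have [-> _ _] := fvtx_param s1; rewrite pE; exact: dot_facet_cross_param.
have sh x : dot (facet_cross s1) (x - fvtx s1 0) =
    det2 q0 q1 q2 * dot (facet_cross s) (x - fvtx s 0).
  rewrite cE dotZl; congr (_ * _).
  have -> : x - fvtx s1 0 = (x - fvtx s 0) - (fvtx s1 0 - fvtx s 0).
    by apply/rowP => k; rewrite !mxE; ring.
  by rewrite dotBr w0E subr0.
move: o12; rewrite !sh.
move: o1 o2; set a := dot _ _; set b := dot _ _; set c := dot _ _; set d := det2 _ _ _ => ab ac.
have := mulr_gt0 (_ : 0 < - (a * b)) (_ : 0 < - (a * c)).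
rewrite !oppr_gt0 => /(_ ab ac) abc.
have a2 : 0 < a ^+ 2 by rewrite exprn_even_gt0 //=; apply: contraTneq ab => ->; rewrite mul0r ltxx.
have bc : 0 < b * c by rewrite -(pmulr_rgt0 _ a2); move: abc; congr (0 < _); ring.
have d2 : 0 < d ^+ 2 by rewrite exprn_even_gt0.
move=> h; have : 0 < d * b * (d * c).
  have -> : d * b * (d * c) = d ^+ 2 * (b * c) by ring.
  exact: mulr_gt0.
by move=> /lt_trans /(_ h); rewrite ltxx.
Qed.

Lemma neighbour_sym s s' : neighbour Omega s = Some s' -> neighbour Omega s' = Some s.
Proof.
move=> /neighbourP[bs st sf].
have bs' : ~~ boundary_facet Omega s' by rewrite (boundary_facet_eq sf).
have [s'' h] := neighbour_exists bs'; rewrite h; congr Some.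
have [_ st' sf'] := neighbourP h.
by apply: (@neighbour_unique s') => //; rewrite eq_sym.
Qed.

(** Passing to the neighbour is an involution of the interior sides that flips the label, so the
    sides with false label are reindexed by those with true label. *)
Lemma sum_interior_sides (lab : side M -> bool) (X : side M -> R) : labelling Omega lab ->
  \sum_(s | ~~ boundary_facet Omega s) X s =
  \sum_(s | interior_facet Omega lab s)
    (X s + (if neighbour Omega s is Some s' then X s' else 0)).
Proof.
(* The default [s] makes [nb] an involution on all sides, boundary sides being fixed. *)
move=> hlab; pose nb s := odflt s (neighbour Omega s).
have nbP s : ~~ boundary_facet Omega s -> neighbour Omega s = Some (nb s).
  by move=> /neighbour_exists[s' h]; rewrite /nb h.
have iE s : interior_facet Omega lab s = ~~ boundary_facet Omega s && lab s.
  rewrite /interior_facet; congr (_ && _).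
  have [b|b] := boolP (boundary_facet Omega s); first by rewrite /neighbour b.
  by rewrite nbP.
rewrite (bigID lab) /= big_split /=; congr (_ + _).
  by apply: eq_bigl => s; rewrite iE.
have nbK s : nb (nb s) = s.
  rewrite /nb; case e: (neighbour Omega s) => [s'|] /=; last by rewrite e.
  by rewrite (neighbour_sym e).
rewrite (reindex_onto nb nb) /=; last by move=> s _; exact: nbK.
apply: eq_big => [s|s]; last first.
  move=> /andP[/andP[b l] _].
  have e : neighbour Omega s = Some (nb s).
    by have := neighbour_sym (nbP _ b); rewrite nbK.
  by rewrite e.
rewrite nbK eqxx andbT iE.
have [b|b] := boolP (boundary_facet Omega s).
  have -> : nb s = s by rewrite /nb /neighbour b.
  by rewrite b.
have [b' _ _] := neighbourP (neighbour_sym (nbP _ b)).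
by rewrite b' /= (hlab _ _ (nbP _ b)) negbK.
Qed.

Lemma sum_elem_sides (X : side M -> R) : \sum_t \sum_(i < 4) X (t, i) = \sum_s X s.
Proof. by rewrite pair_big /=; apply: eq_bigr => -[]. Qed.

Lemma elem_sub_closure t : @elem R M t `<=` closure Omega.
Proof. by have [_ -> _ _] := hM => x tx; exists t. Qed.

(* At a boundary point of a Lipschitz domain the complement has interior points arbitrarily
   close, hence the domain is the interior of its closure. *)
Lemma oelem_sub_domain t : lipschitz_polyhedral_domain Omega -> @oelem R M t `<=` Omega.
Proof.
move=> [[oO _ _ _] [lip _]] x tx; apply: contrapT => nOx.
have bx : bnd Omega x.
  split; first by apply: elem_sub_closure; exact: oelem_sub tx.
  by move=> /interior_subset.
have [Q [r [L [phi [QQ r0 lipphi Dphi]]]]] := lip _ bx.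
(* Direction that changes only the graph coordinate: subtracting it moves [x], which is not above
   the graph, strictly below it. *)
pose u : vec R := delta_mx 0 2 *m Q^T.
have uQ : u *m Q = delta_mx 0 2 by rewrite /u -mulmxA (mulmx1C QQ) mulmx1.
pose y (h : R) : vec R := (- h) *: u + x.
have yQ h i : (y h *m Q) 0 i = (x *m Q) 0 i - h * (i == 2)%:R.
  by rewrite mulmxDl -scalemxAl uQ !mxE eqxx /= addrC mulNr.
have cy : (fun h => y h) @ (0 : R) --> x.
  have c : (fun h : R => (- h) *: u + x) @ (0 : R) --> (- 0) *: u + x.
    exact: (cvgD (cvgZ (cvgN cvg_id) (cvg_cst _)) (cvg_cst _)).
  by rewrite oppr0 scale0r add0r in c.
have ev1 : \forall h \near (0 : R)^'+, oelem t (y h).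
  have nb : nbhs x (oelem t) by apply: open_nbhs_nbhs; split => //; exact: open_interior.
  exact: (cvg_at_right_filter cy) _ nb.
have nlt z : (enorm z < r) = (dot z z < r ^+ 2).
  by rewrite -sqr_enorm ltr_pXn2r // nnegrE ?enorm_ge0 // ltW.
have cdot z0 : {for z0, continuous (fun z : vec R => dot (z - x) (z - x))}.
  have c i : {for z0, continuous (fun z : vec R => (z - x) 0 i)}.
    have -> : (fun z : vec R => (z - x) 0 i) = fun z => z 0 i - x 0 i.
      by apply/funext => z; rewrite !mxE.
    exact: (cvgB (@continuous_coord _ i z0) (cvg_cst _)).
  exact: continuous_dot.
have ev2 : \forall h \near (0 : R)^'+, enorm (y h - x) < r.
  have c : (fun h => dot (y h - x) (y h - x)) @ (0 : R)^'+ --> dot (x - x) (x - x).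
    apply: cvg_at_right_filter => W hW; exact: (cy _ (cdot x _ hW)).
  have : \forall h \near (0 : R)^'+, dot (y h - x) (y h - x) < r ^+ 2.
    by apply: (cvgr_lt _ c (r ^+ 2)); rewrite subrr dot0r exprn_gt0.
  by apply: filterS => h; rewrite nlt.
have ev3 : \forall h \near (0 : R)^'+, [/\ oelem t (y h), enorm (y h - x) < r & 0 < h].
  have ev0 : \forall h \near (0:R)^'+, 0 < h by exact: nbhs_right_gt.
  by apply: filterS3 ev1 ev2 ev0 => h h1 h2 h3; split.
have [h [yt yr h0]] : exists h, [/\ oelem t (y h), enorm (y h - x) < r & 0 < h].
  exact: (@filter_ex _ _ (at_right_proper_filter (0 : R)) _ ev3).
have phix : (x *m Q) 0 2 <= phi ((x *m Q) 0 0) ((x *m Q) 0 1).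
  rewrite leNgt; apply/negP => lt; apply: nOx; apply/(Dphi x) => //.
  by rewrite nlt subrr dot0r exprn_gt0.
have phiy : (y h *m Q) 0 2 < phi ((y h *m Q) 0 0) ((y h *m Q) 0 1).
  by rewrite !yQ /= !mulr0 !subr0 mulr1; lra.
have cQ i : {for y h, continuous (fun z : vec R => (z *m Q) 0 i)}.
  have -> : (fun z : vec R => (z *m Q) 0 i) = fun z => \sum_(k < 3) z 0 k * Q k i.
    by apply/funext => z; rewrite !mxE.
  apply: (@continuous_sum _ _ _ _ _ (fun k (z : vec R) => z 0 k * Q k i)) => k.
  exact: (cvgM (@continuous_coord _ k (y h)) (cvg_cst _)).
(* By the Lipschitz bound, [w z] smaller than the graph height over [y h] keeps [z] below the graph,
   so a whole neighbourhood of [y h] misses [Omega]. The absolute value is there because the sign of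
   [L] is not given. *)
pose w (z : vec R) := (z *m Q) 0 2 + `|L| * (`|(z *m Q) 0 0 - (y h *m Q) 0 0| +
  `|(z *m Q) 0 1 - (y h *m Q) 0 1|).
have cw : {for y h, continuous w}.
  have cn i : {for y h, continuous (fun z : vec R => `|(z *m Q) 0 i - (y h *m Q) 0 i|)}.
    exact: cvg_norm (cvgB (cQ i) (cvg_cst _)).
  exact: (cvgD (cQ 2) (cvgM (cvg_cst _) (cvgD (cn 0) (cn 1)))).
have wy : w (y h) = (y h *m Q) 0 2 by rewrite /w !subrr normr0 addr0 mulr0 addr0.
have ev4 : \forall z \near y h, w z < phi ((y h *m Q) 0 0) ((y h *m Q) 0 1).
  by apply: (cvgr_lt _ cw); rewrite wy.
have ev5 : \forall z \near y h, dot (z - x) (z - x) < r ^+ 2.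
  by apply: (cvgr_lt _ (cdot (y h))); rewrite -nlt.
have := elem_sub_closure (oelem_sub yt) (filterI ev4 ev5).
move=> [z [Oz [/= wz rz]]].
have zr : enorm (z - x) < r by rewrite nlt.
have := (Dphi z zr).1 Oz.
have := lipphi ((z *m Q) 0 0) ((z *m Q) 0 1) ((y h *m Q) 0 0) ((y h *m Q) 0 1).
rewrite ler_norml => /andP[l1 _]; move: wz l1; rewrite /w.
set s := _ + `|_ - _|; have s0 : 0 <= s by rewrite addr_ge0.
have : L * s <= `|L| * s by rewrite ler_wpM2r // ler_norm.
by lra.
Qed.

End Neighbours.

(** * Existence of the lifting *)

Section FiniteDimensionalRiesz.
Variables (R : realFieldType) (V : lmodType R) (W : set V).
Hypotheses (W0 : W 0) (Wlin : forall a u v, W u -> W v -> W (a *: u + v)).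

(** The span as an induction principle: predicates stable under combinations pass from the
    generators to [u], with no coefficients to carry. *)
Definition linear_hull (ws : seq V) (u : V) : Prop :=
  forall S : set V, (forall w, w \in ws -> S w) -> S 0 ->
    (forall a x y, W x -> W y -> S x -> S y -> S (a *: x + y)) -> S u.

Definition linear_on (l : V -> R) := forall a u v, W u -> W v -> l (a *: u + v) = a * l u + l v.

Lemma linear_on0 l : linear_on l -> l 0 = 0.
Proof. by move=> /(_ (-1) 0 0 W0 W0); rewrite scaler0 addr0 mulN1r addNr. Qed.

Variable B : V -> V -> R.
Hypotheses (Bsym : forall u v, W u -> W v -> B u v = B v u)
  (Blin : forall u, W u -> linear_on (B u))
  (Bnull : forall u, W u -> B u u = 0 -> forall v, W v -> B u v = 0).

(* Gram-Schmidt for a semidefinite form, by induction on the generators: a generator of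
   null norm after projection does not contribute. *)
Lemma finite_riesz (ws : seq V) (l : V -> R) : (forall w, w \in ws -> W w) ->
  linear_on l -> (forall u, W u -> B u u = 0 -> l u = 0) ->
  exists r, [/\ W r, linear_hull ws r & forall w, w \in ws -> B r w = l w].
Proof.
elim: ws l => [|w ws IH] l hws hl l0.
  by exists 0; split => // S _.
have Ww : W w by apply: hws; rewrite mem_head.
have hws' x : x \in ws -> W x by move=> h; apply: hws; rewrite in_cons h orbT.
have [r0 [Wr0 hr0 er0]] := IH l hws' hl l0.
(* The induction hypothesis for the functional [B w] provides the orthogonal projection of [w] on
   the earlier generators. *)
have [p [Wp hp ep]] := IH (B w) hws' (Blin Ww) (fun u Wu u0 =>
  etrans (Bsym Ww Wu) (Bnull Wu u0 Ww)).
have WB u v : W u -> W v -> W (u - v).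
  by move=> Wu Wv; rewrite addrC -scaleN1r; exact: Wlin.
have up x : linear_hull ws x -> linear_hull (w :: ws) x.
  move=> h S Sw; apply: h => y hy; apply: Sw; by rewrite in_cons hy orbT.
have Ww' : W (w - p) by exact: WB.
have wE : w = 1 *: (w - p) + p by rewrite scale1r subrK.
have ext r : W r -> (forall x, x \in ws -> B r x = l x) -> B r p = l p.
  move=> Wr h; apply: (hp (fun u => B r u = l u)) => //.
    by rewrite !linear_on0 //; exact: Blin.
  by move=> a x y Wx Wy ex ey; rewrite (Blin Wr) // hl // ex ey.
have wperp x : x \in ws -> B (w - p) x = 0.
  move=> hx; have Wx := hws' _ hx.
  have : B w x = B (w - p) x + B p x.
    rewrite {1}wE Bsym //; last by rewrite -wE.
    by rewrite (Blin Wx) // mul1r (Bsym Wx Ww') (Bsym Wx Wp).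
  by rewrite ep // => /eqP; rewrite -subr_eq subrr => /eqP.
have [n0|n0] := eqVneq (B (w - p) (w - p)) 0.
  exists r0; split => //; first exact: up.
  move=> x; rewrite in_cons => /orP[/eqP ->|]; last exact: er0.
  by rewrite wE (Blin Wr0) // hl // (ext _ Wr0 er0) (l0 _ Ww' n0) (Bsym Wr0 Ww') (Bnull Ww' n0).
(* Corrects the value in the new direction [w - p]; the earlier values stay, this direction being
   orthogonal to them. *)
pose c := (l (w - p) - B r0 (w - p)) / B (w - p) (w - p).
have Wr : W (c *: (w - p) + r0) by exact: Wlin.
have Br x : W x -> B (c *: (w - p) + r0) x = c * B (w - p) x + B r0 x.
  by move=> Wx; rewrite Bsym // (Blin Wx) // (Bsym Wx Ww') (Bsym Wx Wr0).
have er x : x \in ws -> B (c *: (w - p) + r0) x = l x.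
  by move=> hx; rewrite Br ?wperp ?mulr0 ?add0r ?er0 //; exact: hws'.
exists (c *: (w - p) + r0); split => //.
  move=> S Sw S0 Slin; have Sp := up _ hp S Sw S0 Slin.
  have Sr0 := up _ hr0 S Sw S0 Slin.
  have Sw' : S (w - p).
    rewrite addrC -scaleN1r; apply: (Slin (-1) p w Wp Ww Sp).
    by apply: Sw; rewrite mem_head.
  exact: (Slin c _ _ Ww' Wr0 Sw' Sr0).
move=> x; rewrite in_cons => /orP[/eqP ->|]; last exact: er.
have key : B (c *: (w - p) + r0) (1 *: (w - p) + p) = l (1 *: (w - p) + p).
  by rewrite (Blin Wr) // hl // (ext _ Wr er) Br // /c divfK // mul1r subrK mul1r.
by rewrite -wE in key.
Qed.
End FiniteDimensionalRiesz.

Section Spanning.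
Variables (F : fieldType) (V : lmodType F) (W : set V) (N : nat) (e : 'I_N -> V).
Hypotheses (W0 : W 0) (Wlin : forall a u v, W u -> W v -> W (a *: u + v))
  (We : forall w, W w -> exists c : 'rV[F]_N, w = \sum_i c 0 i *: e i).

Let comb (c : 'rV[F]_N) : V := \sum_i c 0 i *: e i.

Let comb_lin a c d : comb (a *: c + d) = a *: comb c + comb d.
Proof.
rewrite /comb scaler_sumr -big_split /=; apply: eq_bigr => i _.
by rewrite !mxE scalerDl scalerA.
Qed.

(** [W] sits in a finite-dimensional space but comes without a basis. Take a space of coefficients
    of maximal rank all of whose combinations lie in [W]: adjoining the coefficients of some [w]
    cannot raise the rank, so they were already there. *)
Lemma finite_generation : exists ws : seq V, (forall w, w \in ws -> W w) /\
  forall (S : set V), (forall w, w \in ws -> S w) -> S 0 ->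
    (forall a x y, W x -> W y -> S x -> S y -> S (a *: x + y)) -> forall w, W w -> S w.
Proof.
pose Q (r : nat) := `[< exists m : 'M[F]_N,
  (forall u : 'rV_N, (u <= m)%MS -> W (comb u)) /\ \rank m = r >].
have comb0 : comb 0 = 0 by rewrite /comb big1 // => i _; rewrite mxE scale0r.
have Q0 : exists r, Q r.
  exists 0%N; apply/asboolP; exists 0; split; last exact: mxrank0.
  by move=> u; rewrite submx0 => /eqP ->; rewrite comb0.
have QN r : Q r -> (r <= N)%N.
  by move=> /asboolP[m [_ <-]]; exact: rank_leq_row.
case: (ex_maxnP Q0 QN) => r /asboolP[m [hm rm]] rmax.
exists [seq comb (row i m) | i <- enum 'I_N]; split.
  by move=> w /mapP[i _ ->]; apply: hm; exact: row_sub.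
move=> S Sw S0 Slin w Ww; have [c wc] := We Ww.
have {}wc : w = comb c by [].
have cm : (c <= m)%MS.
  have /rmax : Q (\rank (m + c)%MS).
    apply/asboolP; exists (m + c)%MS; split => // u /sub_addsmxP[[a b] /= ->].
    have [b' ->] : exists b' : F, b *m c = b' *: c.
      by exists (b 0 0); apply/rowP => j; rewrite !mxE big_ord1.
    by rewrite addrC comb_lin; apply: Wlin; [rewrite -wc|apply: hm; exact: submxMl].
  rewrite -rm => le; have := mxrank_leqif_sup (addsmxSl m c).
  move=> [_]; rewrite eqn_leq le mxrankS ?addsmxSl //= => /esym.
  by rewrite addsmx_sub => /andP[].
have [D cD] := submxP cm; rewrite wc cD mulmx_sum_row.
have h (s : seq 'I_N) : W (comb (\sum_(i <- s) D 0 i *: row i m)) /\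
    S (comb (\sum_(i <- s) D 0 i *: row i m)).
  elim: s => [|i s [IHW IHS]]; first by rewrite big_nil comb0.
  rewrite big_cons comb_lin.
  have Wi : W (comb (row i m)) by apply: hm; exact: row_sub.
  split; first exact: Wlin.
  by apply: Slin => //; apply: Sw; apply/mapP; exists i => //; rewrite mem_enum.
by have [] := h (index_enum _).
Qed.
End Spanning.

(** * Nonnegative continuous functions with zero integral *)

Section Positivity.
Variable R : realType.
Notation mR := (measurableTypeR R).
Notation mu := (@lebesgue_measure R).
Notation T3 := (mR * mR * mR)%type.

Lemma vol_cbox_gt0 (a b : vec R) : (forall i, a 0 i < b 0 i) -> (0 < vol (cbox a b))%E.
Proof.
move=> ab; rewrite /vol cbox_preimage.
pose J i : set mR := `[a 0 i, b 0 i]%classic.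
have mJ i : measurable (J i) by exact: measurable_itv.
rewrite -/(J 0) -/(J 1) -/(J 2).
have -> : leb3 R ((J 0 `*` J 1) `*` J 2) = (mu (J 0%R) * mu (J 1%R) * mu (J 2%R))%E.
  apply: etrans (product_measure1E (leb2 R) mu _ (mJ 2)) _; first exact: measurableX.
  by congr (_ * _)%E; exact: (product_measure1E mu mu (mJ 0) (mJ 1)).
have J0 i : (0 < mu (J i))%E.
  by rewrite lebesgue_measure_itv /= lte_fin ab -EFinD lte_fin subr_gt0.
by rewrite !mule_gt0.
Qed.

(** A positive value would persist, up to a factor 2, on a small box of positive volume. *)
Lemma int3_eq0 (D : set (vec R)) (f : vec R -> R) : open D -> continuous f ->
  integrable3 D f -> (forall x, 0 <= f x) -> int3 D f = 0 -> forall x, D x -> f x = 0.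
Proof.
move=> oD cf fi f0 If x Dx; apply/eqP; rewrite -[_ == _]negbK; apply/negP => fx.
have {}fx : 0 < f x by rewrite lt_neqAle eq_sym fx f0.
have h1 : \forall y \near x, f x / 2 < f y.
  by apply: (cvgr_gt _ (cf x)); rewrite ltr_pdivrMr // ltr_pMr // ltr1n.
have h2 : nbhs x D by exact: open_nbhs_nbhs.
have h : nbhs x [set y | f x / 2 < f y /\ D y] by apply: filterS2 h1 h2 => y; split.
have [e /= e0 he] := iffLR (nbhs_ballP _ _) h.
pose a : vec R := x - const_mx (e / 2); pose b : vec R := x + const_mx (e / 2).
have Ke y : cbox a b y -> f x / 2 < f y /\ D y.
  move=> hy; apply: he; split => // i j; rewrite (ord1 i) /ball /=.
  have := hy j; rewrite !mxE ltr_distlC => /andP[? ?]; apply/andP; split; lra.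
have mK := measurable_vset_cbox a b; have mD := open_measurable_vset oD.
have vK : (0 < vol (cbox a b))%E.
  by apply: vol_cbox_gt0 => i; rewrite !mxE; lra.
have fD : (\int[leb3 R]_(p in point3 @^-1` D) (f (point3 p))%:E = 0)%E.
  by rewrite -[LHS]fineK ?[fine _]If //; exact: integrable_fin_num.
have le1 : (\int[leb3 R]_(p in point3 @^-1` cbox a b) (f x / 2)%:E
    <= \int[leb3 R]_(p in point3 @^-1` D) (f (point3 p))%:E)%E.
  apply: (@le_trans _ _ (\int[leb3 R]_(p in point3 @^-1` cbox a b) (f (point3 p))%:E)%E).
    apply: ge0_le_integral => //.
    - by move=> p _; rewrite lee_fin divr_ge0.
    - by apply/measurable_EFinP; exact: continuous_measurable3.
    - by move=> p hp; rewrite lee_fin; have [/ltW h' _] := Ke _ hp.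
  apply: ge0_subset_integral => //.
  - by apply/measurable_EFinP; exact: continuous_measurable3.
  - by move=> p _; rewrite lee_fin.
  - by move=> p hp; have [_ h'] := Ke _ hp.
move: le1; rewrite fD integral_cst // leNgt mule_gt0 //.
by rewrite lte_fin divr_gt0.
Qed.
End Positivity.

Section Lifting.
Variables (R : realType) (Omega : set (vec R)) (M : mesh R) (k : nat) (Vh : set (bfield M)).
Variables (t : 'I_(nelem M)) (alpha : side M -> vec R -> R) (g : side M -> vec R -> vec R).
Hypothesis hVh : Hcurl_conforming_space Omega k Vh.
Hypothesis ndeg : \det (\matrix_(i < 3) (vtx t (lift 0 i) - vtx t 0)) != 0.
Notation T2 := (measurableTypeR R * measurableTypeR R)%type.

Lemma Vh_polyfun v s i : Vh v -> polyfun (fun x => v s x 0 i).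
Proof. by have [_ _ h _] := hVh => /h/(_ s i)/poly_deg_le_polyfun. Qed.

Lemma Vh_continuous v s i : Vh v -> continuous (fun x => v s x 0 i).
Proof. by move=> /(@Vh_polyfun v s i)/polyfun_continuous. Qed.

Lemma Vh_dot_continuous u v s s' : Vh u -> Vh v -> continuous (fun x => dot (u s x) (v s' x)).
Proof. by move=> hu hv x; apply: continuous_dot => i; exact: Vh_continuous. Qed.

Hypothesis gi : forall i v, Vh v -> (leb2 R).-integrable (@ref_triangle R : set T2)
  (EFin \o (fun q => alpha (t, i) (facet_param (t, i) q) *
    dot (g (t, i) (facet_param (t, i) q)) (v t (facet_param (t, i) q)))).

Let W : set (vec R -> vec R) := [set w | exists2 v, Vh v & w = v t].

Let l (w : vec R -> vec R) : R := \sum_(i < 4) facet_int (t, i)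
  (fun x => alpha (t, i) x * dot (g (t, i) x) (w x)).

Let mO : measurable_vset (oelem t).
Proof. by apply: open_measurable_vset; exact: open_oelem. Qed.

Let W0 : W 0. Proof. by have [h _ _ _] := hVh; exists (fun _ _ => 0). Qed.

Let Wlin a u v : W u -> W v -> W (a *: u + v).
Proof.
have [_ h _ _] := hVh; move=> [u' hu ->] [v' hv ->].
by exists (fun t x => a *: u' t x + v' t x); first exact: h.
Qed.

Let dot_int u v : W u -> W v -> integrable3 (oelem t) (fun x => dot (u x) (v x)).
Proof.
move=> [u' hu ->] [v' hv ->]; apply: (ess_bounded_integrable3 (elem_compact ndeg)) => //.
  exact: oelem_sub.
apply: (continuous_ess_bounded (elem_compact ndeg)) => //; first exact: oelem_sub.
exact: Vh_dot_continuous.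
Qed.

(** Vanishing on the open element extends to its boundary by continuity along the segment towards
    the barycentre; the facets matter because the functional to be lifted lives there. *)
Let Wnull u : W u -> L2ip (oelem t) u u = 0 -> forall x, elem t x -> u x = 0.
Proof.
move=> [u' hu ->] I0.
have cu := @Vh_dot_continuous u' u' t t hu hu.
have ou x : oelem t x -> dot (u' t x) (u' t x) = 0.
  have i0 : integrable3 (oelem t) (fun x => dot (u' t x) (u' t x)) by apply: dot_int; exists u'.
  exact: (@int3_eq0 _ _ (fun x => dot (u' t x) (u' t x)) (@open_oelem _ _ t) cu i0
    (fun y => dot_ge0 _) I0 x).
move=> x tx; apply/eqP; rewrite -dot_eq0; apply/eqP.
pose b : vec R := \sum_i (4^-1 : R) *: vtx t i.
have bb i : bary t i b = 4^-1.
  rewrite /b (@bary_affine _ _ _ ndeg i (fun=> 4^-1)) // sumr_const card_ord; by field.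
pose y (h : R) := h *: (b - x) + x.
have cy : (fun h => y h) @ (0 : R) --> x.
  have c : (fun h : R => h *: (b - x) + x) @ (0 : R) --> (0 : R) *: (b - x) + x.
    exact: (cvgD (cvgZ cvg_id (cvg_cst _)) (cvg_cst _)).
  by rewrite scale0r add0r in c.
have c1 : (fun h => dot (u' t (y h)) (u' t (y h))) @ (0 : R)^'+ --> dot (u' t x) (u' t x).
  apply: cvg_at_right_filter => S hS; exact: (cy _ (cu x _ hS)).
have c2 : (fun h => dot (u' t (y h)) (u' t (y h))) @ (0 : R)^'+ --> (0 : R).
  apply: cvg_near_cst.
  have e0 : \forall h \near (0:R)^'+, 0 < h by exact: nbhs_right_gt.
  have e1 : \forall h \near (0:R)^'+, h < 1 by exact: nbhs_right_lt.
  apply: filterS2 e0 e1 => h h0 h1; apply: ou.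
  rewrite oelem_bary // => i; rewrite /y baryZD bb.
  by have := tx; rewrite elem_bary // => /(_ i) hb; nra.
rewrite -(cvg_lim (@Rhausdorff R) c1); exact: (cvg_lim (@Rhausdorff R) c2).
Qed.

Let vecE (x : vec R) : x = \sum_(i < 3) x 0 i *: delta_mx 0 i.
Proof. exact: row_sum_delta. Qed.

Lemma Vh_spanned : exists N (e : 'I_N -> vec R -> vec R), forall w, W w ->
  exists c : 'rV[R]_N, w = \sum_i c 0 i *: e i.
Proof.
pose K : finType := ('I_3 * ('I_k.+1 * ('I_k.+1 * 'I_k.+1)))%type.
pose E (q : K) (x : vec R) : vec R :=
  (x 0 0 ^+ q.2.1 * x 0 1 ^+ q.2.2.1 * x 0 2 ^+ q.2.2.2) *: delta_mx 0 q.1.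
pose A : {pred K} := predT.
exists #|A|, (fun i : 'I_#|A| => E (enum_val i)) => _ [w hw ->].
have [_ _ hp _] := hVh.
have [c hc] := choice (fun i => hp w hw t i).
(* [K] indexes the full cube of exponents; coefficients of total degree above [k] are set to 0. *)
pose C (q : K) : R := if (q.2.1 + q.2.2.1 + q.2.2.2 <= k)%N then c q.1 q.2.1 q.2.2.1 q.2.2.2 else 0.
exists (\row_(i < #|A|) C (enum_val i)).
have -> : \sum_(i < #|A|) (\row_(j < #|A|) C (enum_val j)) 0 i *: E (enum_val i) = \sum_q C q *: E q.
  transitivity (\sum_(q in A) C q *: E q); last exact: eq_bigl.
  by rewrite [RHS]big_enum_val; apply: eq_bigr => i _; rewrite mxE.
apply/funext => x; rewrite fct_sumE [LHS]vecE.
rewrite -(pair_bigA _ (fun i q => (C (i, q) *: E (i, q)) x)) /=; apply: eq_bigr => i _.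
rewrite hc scaler_suml -(pair_bigA _ (fun a q => (C (i, (a, q)) *: E (i, (a, q))) x)) /=.
apply: eq_bigr => a _.
rewrite scaler_suml -(pair_bigA _ (fun b d => (C (i, (a, (b, d))) *: E (i, (a, (b, d)))) x)) /=.
apply: eq_bigr => b _.
rewrite scaler_suml [RHS](bigID (fun d : 'I_k.+1 => (a + b + d <= k)%N)) /= [X in _ = _ + X]big1 ?addr0.
  apply: eq_bigr => d hd; rewrite /C /= hd /E /=.
  rewrite -[RHS]/(_ *: (_ *: _)) scalerA; congr (_ *: _); ring.
by move=> d /negbTE hd; rewrite /C /= hd; exact: scale0r.
Qed.

Let facet_mul i u v a (x : vec R) : alpha (t, i) x * dot (g (t, i) x) ((a *: u + v) x : vec R) =
  a * (alpha (t, i) x * dot (g (t, i) x) (u x)) + alpha (t, i) x * dot (g (t, i) x) (v x).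
Proof. rewrite -[(_ + v) x]/(a *: u x + v x) dotDr dotZr; ring. Qed.

Let l_lin : linear_on W l.
Proof.
move=> a u v hu hv; rewrite /l mulr_sumr -big_split /=; apply: eq_bigr => i _.
move: hu hv => [u' hu ->] [v' hv ->].
rewrite /facet_int (_ : Rintegral _ _ _ = a * Rintegral (leb2 R) (@ref_triangle R)
   (fun q => alpha (t, i) (facet_param (t, i) q) * dot (g (t, i) (facet_param (t, i) q)) (u' t (facet_param (t, i) q)))
   + Rintegral (leb2 R) (@ref_triangle R)
   (fun q => alpha (t, i) (facet_param (t, i) q) * dot (g (t, i) (facet_param (t, i) q)) (v' t (facet_param (t, i) q)))).
  by ring.
have mT := @measurable_ref_triangle R.
rewrite -RintegralZl //; last exact: gi.
rewrite -RintegralD //; last 2 first.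
- by apply: eq_integrable (integrableZl mT a (gi i hu)).
- exact: gi.
by apply: eq_Rintegral => q _; exact: facet_mul.
Qed.

(** The L^2 product over the element enters as a semidefinite form on functions on R^3. A function
    in its kernel vanishes on the closed element, hence is killed by the facet functional, which is
    what the Riesz argument requires. *)
Lemma lifting_exists : exists r, is_lifting alpha Vh t g r.
Proof.
have [N [e he]] := Vh_spanned.
have [ws [hws hspan]] := finite_generation W0 Wlin he.
have Bsym u v : W u -> W v -> L2ip (oelem t) u v = L2ip (oelem t) v u.
  by move=> _ _; apply: eq_int3 => x _; exact: dotC.
have Blin u : W u -> linear_on W (L2ip (oelem t) u).
  move=> hu a v w hv hw; rewrite /L2ip -int3Zl //; last exact: dot_int.
  rewrite -int3D //; [|by apply: integrable3Zl => //; exact: dot_int|exact: dot_int].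
  by apply: eq_int3 => x _; rewrite -[(_ + w) x]/(a *: v x + w x) dotDr dotZr.
have Bnull u : W u -> L2ip (oelem t) u u = 0 -> forall v, W v -> L2ip (oelem t) u v = 0.
  move=> hu u0 v hv; rewrite /L2ip (@eq_int3 _ _ _ (fun=> 0 * 0)).
    by rewrite int3Zl ?mul0r //; apply: eq_integrable (integrable0 _ _).
  by move=> x hx; rewrite (Wnull hu u0) ?dot0l ?mul0r //; exact: oelem_sub.
have l0 u : W u -> L2ip (oelem t) u u = 0 -> l u = 0.
  move=> hu u0; rewrite /l big1 // => i _; rewrite /facet_int.
  rewrite (@eq_Rintegral _ _ _ _ _ (fun=> 0)) ?Rintegral_cst ?mul0r ?mulr0 //.
    exact: measurable_ref_triangle.
  move=> q; rewrite inE => hq; rewrite (Wnull hu u0) ?dot0r ?mulr0 //.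
  exact: facet_param_elem.
have [r [Wr _ hr]] := finite_riesz W0 Wlin Bsym Blin Bnull hws l_lin l0.
exists r; split; first by have [v hv ->] := Wr; exists v.
move=> w hw; have Ww : W (w t) by exists w.
apply: (hspan (fun u => L2ip (oelem t) r u = l u) hr _ _ (w t) Ww).
  by rewrite !(linear_on0 W0) //; exact: Blin.
by move=> a x y Wx Wy ex ey; rewrite (Blin r Wr) // l_lin // ex ey.
Qed.

Lemma liftingP : is_lifting alpha Vh t g (lifting alpha Vh g t).
Proof. by have [r hr] := lifting_exists; exact: (xgetPex (cst 0) (ex_intro _ r hr)). Qed.

End Lifting.

(** * Smallest eigenvalue and essential suprema *)

Section Rayleigh.
Variables (R : realType) (S : 'M[R]_3).
Hypothesis symS : S^T = S.

Let q (x : vec R) : R := dot x (x *m S).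

Lemma dot_mul_sym x y : dot x (y *m S) = dot y (x *m S).
Proof.
have e i j : S i j = S j i by rewrite -[in LHS]symS mxE.
by rewrite !dotE !mxE !sum_I3 (e 1 0) (e 2 0) (e 2 1); ring.
Qed.

Let q_cont : continuous q.
Proof.
move=> x; apply: continuous_dot => i; first exact: continuous_coord.
have -> : (fun z : vec R => (z *m S) 0 i) = fun z => \sum_(k < 3) z 0 k * S k i.
  by apply/funext => z; rewrite !mxE.
apply: (@continuous_sum _ _ _ _ _ (fun k (z : vec R) => z 0 k * S k i)) => k.
exact: (cvgM (@continuous_coord _ k x) (cvg_cst _)).
Qed.

Let n_cont : continuous (fun x : vec R => dot x x).
Proof. by move=> x; apply: continuous_dot => i; exact: continuous_coord. Qed.

(* The minimum of the Rayleigh quotient over the unit sphere is attained at an eigenvector. *)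
Lemma rayleigh_minimizer : exists (m : R) (u : vec R), [/\ u != 0, u *m S = m *: u &
  forall x, m * dot x x <= q x].
Proof.
pose K := [set x : vec R | dot x x = 1].
have Kc : compact K.
  apply: bounded_closed_compact; last first.
    have -> : K = (fun x : vec R => dot x x) @^-1` [set 1] by [].
    by apply: closed_comp; [move=> x _; exact: n_cont|exact: closed_eq].
  exists 1; split; first exact: num_real.
  move=> C C1 x Kx /=; rewrite [X in X <= _]mx_normrE; apply/bigmax_leP.
  split => [|[i j] _]; first by rewrite ltW // (lt_trans ltr01).
  rewrite /= (ord1 i); apply: le_trans (ltW C1).
  rewrite -(@ler_pXn2r _ 2) ?nnegrE // expr1n real_normK ?num_real //.
  move: Kx; rewrite /K /= dotE => <-; move: j; apply: forall_I3; nra.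
have K0 : K !=set0 by exists (delta_mx 0 0); rewrite /K /= dot_delta mxE.
have [u uK hu] := EVT_min_rV K0 Kc (continuous_subspaceT q_cont).
rewrite inE in uK; have u1 : dot u u = 1 by [].
have hom x : q u * dot x x <= q x.
  have [->|x0] := eqVneq x 0; first by rewrite /q mul0mx !dot0r mulr0.
  have xx : 0 < dot x x by rewrite lt_neqAle dot_ge0 eq_sym dot_eq0 x0.
  pose s := enorm x; have s2 : s * s = dot x x by rewrite -expr2 sqr_enorm.
  have s0 : 0 < s by exact: enorm_gt0.
  have : q u <= q (s^-1 *: x).
    apply: hu; rewrite inE /K /= dotZl dotZr -s2; field; exact: lt0r_neq0.
  rewrite /q -scalemxAl dotZl dotZr -/(q x) -/(q u) => h.
  rewrite -s2; have -> : q x = (s^-1 * (s^-1 * q x)) * (s * s) by field; exact: lt0r_neq0.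
  by rewrite ler_wpM2r // mulr_ge0 // ltW.
exists (q u), u; split => //.
  by apply: contra_eqN u1 => /eqP ->; rewrite dot0r eq_sym oner_eq0.
have [e eE] : exists e, e = u *m S - q u *: u by eexists.
pose a := dot e e; pose C := q e - q u * a.
have a0 : 0 <= a by exact: dot_ge0.
(* Minimality of [u] tested along [u + s *: e] with the residual [e]: the linear coefficient is
   twice the square norm of [e]. *)
have ineq s : 0 <= 2 * s * a + s ^+ 2 * C.
  have := hom (u + s *: e); rewrite -subr_ge0; congr (0 <= _).
  have ae : dot e (u *m S) - q u * dot e u = a.
    by rewrite /a {4}eE dotBr dotZr.
  rewrite /q mulmxDl -scalemxAl !(dotDl, dotDr, dotZl, dotZr) (dot_mul_sym u e) -/(q u) -/(q e) /C.
  rewrite -/a u1 (dotC u e) -ae; ring.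
have ea : a = 0.
  have D0 : 0 < `|C| + 1 by rewrite ltr_wpDl.
  (* For this [s] the linear term dominates the quadratic one, and the expression is negative unless
     [a = 0]. *)
  have := ineq (- (a / (`|C| + 1))); have cl := ler_norm C.
  have -> : 2 * - (a / (`|C| + 1)) * a + (- (a / (`|C| + 1))) ^+ 2 * C =
      (a / (`|C| + 1)) ^+ 2 * (C - 2 * (`|C| + 1)) by field; exact: lt0r_neq0.
  move=> h; apply/eqP; rewrite -[_ == _]negbK; apply/negP => an.
  have : 0 < (a / (`|C| + 1)) ^+ 2 by rewrite exprn_even_gt0 //= mulf_neq0 // invr_eq0 lt0r_neq0.
  have : C - 2 * (`|C| + 1) < 0 by have := normr_ge0 C; lra.
  by move=> hn hp; move: h; rewrite leNgt => /negP; apply; rewrite pmulr_rlt0.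
by apply/eqP; rewrite -subr_eq0 -dot_eq0 -eE -/a ea.
Qed.

(** The minimum of the Rayleigh quotient is an eigenvalue and a lower bound of the spectrum; the
    latter makes the infimum meaningful, the former bounds it. *)
Lemma lambda_min_le x rho : rho <= lambda_min S -> rho * dot x x <= q x.
Proof.
move=> h; have [m [u [u0 um hm]]] := rayleigh_minimizer.
apply: le_trans (hm x); apply: ler_wpM2r; first exact: dot_ge0.
apply: (le_trans h); apply: ge_inf; last by apply/eigenvalueP; exists u.
exists m => a /eigenvalueP[v va v0].
have vv : 0 < dot v v by rewrite lt_neqAle dot_ge0 eq_sym dot_eq0 v0.
by have := hm v; rewrite /q va dotZr ler_pM2r.
Qed.
End Rayleigh.

(** * Chosen weak derivatives and the essential supremum *)

Section WeakDerivativeFacts.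
Variable R : realType.
Notation mR := (measurableTypeR R).
Notation T3 := (mR * mR * mR)%type.
Implicit Types (D : set (vec R)) (f g : vec R -> R).

(** [D] is a countable union of closed boxes, on each of which integrability includes
    measurability. *)
Lemma locally_integrable_measurable3 D f : open D -> locally_integrable3 D f -> measurable3 D f.
Proof.
move=> oD fl mD Y mY.
pose C a : set T3 := if `[< rational_cbox a `<=` D >] then point3 @^-1` rational_cbox a else set0.
have mC a : measurable (C a).
  by rewrite /C; case: ifP => _; [exact: measurable_vset_cbox|exact: measurable0].
have -> : point3 @^-1` D `&` (f \o point3) @^-1` Y =
    \bigcup_a (C a `&` ((f \o point3) @^-1` Y)).
  rewrite -setI_bigcupl; congr (_ `&` _).
  apply/seteqP; split => [p Dp|p [a _]].
    have := open_bigcup_rational_box oD; move=> e.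
    have : D (point3 p) by [].
    rewrite {1}e => -[a /= aD pa]; exists a => //; rewrite /C asboolT //.
    exact: box_sub_cbox pa.
  by rewrite /C; case: asboolP => // aD /aD.
apply: countable_bigcupT_measurable => // a.
rewrite /C; case: asboolP => aD; last by rewrite set0I; exact: measurable0.
have mf : measurable3 (rational_cbox a) f.
  by apply: integrable3_measurable; apply: fl => //; exact: cbox_compact.
by apply: mf => //; exact: measurable_vset_cbox.
Qed.

Lemma weak_partialP D j f : (exists g, is_weak_partial D j f g) ->
  is_weak_partial D j f (weak_partial D j f).
Proof. by move=> [g hg]; exact: (xgetPex (cst 0) (ex_intro _ g hg)). Qed.

(** Continuity of [f1] and [f2] makes them integrable against derivatives of test functions, as
    additivity of the integral demands. *)
Lemma is_weak_partialD D j f1 f2 g1 g2 :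
  {within D, continuous f1} -> {within D, continuous f2} ->
  is_weak_partial D j f1 g1 -> is_weak_partial D j f2 g2 ->
  is_weak_partial D j (fun x => f1 x + f2 x) (fun x => g1 x + g2 x).
Proof.
move=> c1 c2 [l1 w1] [l2 w2]; split => [K cK KD|phi tphi].
  by apply: integrable3D; [exact: compact_measurable_vset|exact: l1|exact: l2].
have [dphi cphi [K [cK KD phi0]]] := tphi.
have mK := compact_measurable_vset cK.
have phic := C1_continuous dphi cphi.
have dphi0 x : ~ K x -> partial j phi x = 0.
  by apply: partial_eq0 phi0; exact: compact_closed.
have r h : (forall x, ~ K x -> h x = 0) -> int3 D h = int3 K h.
  by move=> h0; apply: int3_subset => // x _; exact: h0.
have := w1 _ tphi; have := w2 _ tphi.
rewrite !r; try by move=> x Kx; rewrite ?phi0 ?dphi0 ?mulr0.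
have cT (h : vec R -> R) : continuous h -> {within K, continuous h} by exact: continuous_subspaceT.
have ic f : {within D, continuous f} -> integrable3 K (fun x => f x * partial j phi x).
  move=> cf; have cfK : {within K, continuous f} by exact: continuous_subspaceW KD cf.
  apply: (within_locally_integrable3 (D := K)) => //.
  by apply: within_continuousM => //; exact: cT.
have ig g : locally_integrable3 D g -> integrable3 K (fun x => g x * phi x).
  move=> gl; have [C [_ hC]] := within_compact_bounded cK (cT _ phic).
  apply: (integrable3_bounded_mul mK (gl _ cK KD) _ hC); exact: continuous_measurable3.
move=> e2 e1.
rewrite (@eq_int3 _ K (fun x => (f1 x + f2 x) * _) (fun x => f1 x * partial j phi x + f2 x * partial j phi x));
  last by move=> x _; rewrite mulrDl.
rewrite (@eq_int3 _ K (fun x => (g1 x + g2 x) * _) (fun x => g1 x * phi x + g2 x * phi x));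
  last by move=> x _; rewrite mulrDl.
rewrite !int3D //; [lra|exact: ig|exact: ig|exact: ic|exact: ic].
Qed.

(** The norm of exponent +oo unfolds to the essential supremum once the whole space is known to have
    positive measure. *)
Lemma Linfty_normE D f : Linfty_norm D f =
  ess_sup (leb3 R) (fun p => `|((f \o point3) \_ (point3 @^-1` D)) p|%:E).
Proof.
rewrite /Linfty_norm unlock; have -> : (0 < leb3 R [set: T3])%E.
  have h : (0 < vol (cbox (0 : vec R) (const_mx (1%R : R))))%E.
    by apply: vol_cbox_gt0 => i; rewrite !mxE.
  apply: (lt_le_trans h); apply: le_measure => //; rewrite inE; last exact: measurableT.
  exact: measurable_vset_cbox.
by congr ess_sup; apply/funext => p.
Qed.

Lemma Linfty_ae D f : (Linfty_norm D f < +oo)%E ->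
  ae3 D [set x | `|f x| <= fine (Linfty_norm D f)].
Proof.
move=> h; have := ess_sup_ge (leb3 R)
  (fun p => `|((f \o point3) \_ (point3 @^-1` D)) p|%:E).
rewrite -Linfty_normE /ae3.
apply: (@filterS _ _ (ae_filter_ringOfSetsType (leb3 R))) => p /= + Dp.
rewrite /patch mem_set //=.
by case: (Linfty_norm D f) h => [r| |] //= _; rewrite lee_fin.
Qed.

Lemma Linfty_norm_le D C f : 0 <= C -> ae3 D [set x | `|f x| <= C] ->
  (0 <= Linfty_norm D f <= C%:E)%E.
Proof.
move=> C0 hC; apply/andP; split; first exact: Lnorm_ge0.
rewrite Linfty_normE; apply/ess_supP; move: hC; rewrite /ae3.
apply: (@filterS _ _ (ae_filter_ringOfSetsType (leb3 R))) => p h.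
rewrite /patch; case: ifPn => [|_]; last by rewrite normr0 lee_fin.
by rewrite inE => Dp; rewrite lee_fin; exact: h.
Qed.

Lemma Linfty_ess_bounded D f : Linfty D f -> ess_bounded D f.
Proof.
move=> [mf hf]; split => //; exists (fine (Linfty_norm D f)); exact: Linfty_ae.
Qed.

End WeakDerivativeFacts.

(** * The advection form on an element *)

Section AdvectionForm.
Variable R : realType.

Lemma curlE (f : vec R -> vec R) x : curl f x = \row_(i < 3)
  [:: partial 1 (fun y => f y 0 2) x - partial 2 (fun y => f y 0 1) x;
      partial 2 (fun y => f y 0 0) x - partial 0 (fun y => f y 0 2) x;
      partial 0 (fun y => f y 0 1) x - partial 1 (fun y => f y 0 0) x]`_i.
Proof.
have e : [/\ 0 + 1 = 1 :> 'I_3, 0 + 2 = 2 :> 'I_3, 1 + 1 = 2 :> 'I_3 &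
   [/\ 1 + 2 = 0 :> 'I_3, 2 + 1 = 0 :> 'I_3 & 2 + 2 = 1 :> 'I_3]].
  by do ![split]; apply: val_inj.
have [e1 e2 e3 [e4 e5 e6]] := e.
by apply/rowP; apply: forall_I3; rewrite !mxE ?e1 ?e2 ?e3 ?e4 ?e5 ?e6.
Qed.

Lemma polyfun_curl (f : vec R -> vec R) : (forall i, polyfun (fun x => f x 0 i)) ->
  forall i, polyfun (fun x => curl f x 0 i).
Proof.
move=> pf i.
have -> : (fun x => curl f x 0 i) = fun x => partial (i + 1) (fun y => f y 0 (i + 2)) x
   + - partial (i + 2) (fun y => f y 0 (i + 1)) x.
  by apply/funext => x; rewrite mxE.
by apply: polyfun_add; [|apply: polyfun_opp]; apply: polyfun_partial.
Qed.

Lemma polyfun_dot (f g : vec R -> vec R) : (forall i, polyfun (fun x => f x 0 i)) ->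
  (forall i, polyfun (fun x => g x 0 i)) -> polyfun (fun x => dot (f x) (g x)).
Proof.
by move=> pf pg; apply: (@polyfun_sum _ _ _ xpredT (fun i x => f x 0 i * g x 0 i)) => i; apply: polyfun_mul.
Qed.

Lemma partial_sqr_norm (u : vec R -> vec R) j x : (forall i, polyfun (fun x => u x 0 i)) ->
  partial j (fun y => dot (u y) (u y)) x =
  2 * \sum_(i < 3) u x 0 i * partial j (fun y => u y 0 i) x.
Proof.
move=> pu; have d i : derivable (fun y => u y 0 i) x (delta_mx 0 j) by exact: polyfun_derivable.
have -> : (fun y => dot (u y) (u y)) = ((fun y => u y 0 0) * (fun y => u y 0 0) +
   (fun y => u y 0 1) * (fun y => u y 0 1) + (fun y => u y 0 2) * (fun y => u y 0 2))%R.
  by apply/funext => y; rewrite dotE.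
have h i := is_deriveM (derivableP (d i)) (derivableP (d i)).
have D := is_deriveD (is_deriveD (h 0) (h 1)) (h 2).
rewrite /partial (@derive_val _ _ _ _ _ _ _ D) sum_I3 /GRing.scale /=; ring.
Qed.

(** With [B] and [D] the Jacobians of beta and u, grad(b.u) = b x curl u + (b.grad)u + u B removes
    the cross product, and (b.grad)u . u is half of b.grad |u|^2. The half divergence in the matrix
    cancels the one in the flux. *)
Lemma advection_identity (b u : vec R) (B D : 'M[R]_3) (g : R) :
  dot u (u *m ((g - (\sum_(i < 3) B i i) / 2)%:M + 2^-1 *: (B + B^T)))
  + 2^-1 * \sum_(j < 3) (B j j * dot u u + b 0 j * (2 * \sum_(i < 3) u 0 i * D i j))
  = dot (- cross b (\row_(i < 3)
           [:: D 2 1 - D 1 2; D 0 2 - D 2 0; D 1 0 - D 0 1]`_i)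
         + \row_(j < 3) \sum_(i < 3) (B i j * u 0 i + b 0 i * D i j) + g *: u) u.
Proof.
rewrite crossE !dotE !sum_I3 !mxE !sum_I3 !mxE /=.
move: (u 0 0) (u 0 1) (u 0 2) (b 0 0) (b 0 1) (b 0 2) => u0 u1 u2 b0 b1 b2.
move: (B 0 0) (B 0 1) (B 0 2) (B 1 0) (B 1 1) (B 1 2) (B 2 0) (B 2 1) (B 2 2).
move: (D 0 0) (D 0 1) (D 0 2) (D 1 0) (D 1 1) (D 1 2) (D 2 0) (D 2 1) (D 2 2).
by move=> *; field.
Qed.

Variables (Omega O K : set (vec R)) (beta u : vec R -> vec R).
Hypotheses (oOmega : open Omega) (oO : open O) (cK : compact K).
Hypotheses (subOK : O `<=` K) (subO : O `<=` Omega).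
Hypothesis cbK : forall i, {within K, continuous (fun x => beta x 0 i)}.
Hypothesis cbOmega : forall i, {within Omega, continuous (fun x => beta x 0 i)}.
Hypothesis hb : forall i, W1infty Omega (fun x => beta x 0 i).
Hypothesis pu : forall i, polyfun (fun x => u x 0 i).

Let B i j := weak_partial Omega j (fun x => beta x 0 i).
Let mO : measurable_vset O := open_measurable_vset oO.

(** [W1infty] provides some essentially bounded weak derivative; by uniqueness the chosen one agrees
    with it almost everywhere. *)
Lemma weak_partial_ess_bounded i j :
  is_weak_partial Omega j (fun x => beta x 0 i) (B i j) /\ ess_bounded O (B i j).
Proof.
have [_ /(_ j) [g [wg Lg]]] := hb i.
have wB : is_weak_partial Omega j (fun x => beta x 0 i) (B i j).
  by apply: weak_partialP; exists g.
split=> //; apply: (ess_boundedS mO (open_measurable_vset oOmega) subO).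
apply: (@ae_eq_ess_bounded _ _ g).
- by case: wB => lB _; exact: locally_integrable_measurable3.
- exact: weak_partial_unique oOmega wg wB.
- exact: Linfty_ess_bounded.
Qed.

Let polyfun_ess_bounded p : polyfun p -> ess_bounded O p.
Proof. by move=> /polyfun_continuous; exact: continuous_ess_bounded cK subOK mO. Qed.

Let beta_ess_bounded i : ess_bounded O (fun x => beta x 0 i).
Proof. exact: (within_ess_bounded cK subOK mO (@cbK i)).
Qed.

Let E j x := \sum_(i < 3) (B i j x * u x 0 i + beta x 0 i * partial j (fun y => u y 0 i) x).

Let E_ess_bounded j : ess_bounded O (E j).
Proof.
apply: (@ess_bounded_sum _ _ _ (fun i x => B i j x * u x 0 i + beta x 0 i * partial j (fun y => u y 0 i) x)) => i.
apply: ess_boundedD; apply: ess_boundedM.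
- exact: (weak_partial_ess_bounded i j).2.
- exact: polyfun_ess_bounded (pu i).
- exact: beta_ess_bounded.
- exact: polyfun_ess_bounded (polyfun_partial j (pu i)).
Qed.

Let weak_E j : is_weak_partial O j (fun x => dot (beta x) (u x)) (E j).
Proof.
pose f i x := beta x 0 i * u x 0 i.
pose g i x := B i j x * u x 0 i + beta x 0 i * partial j (fun y => u y 0 i) x.
have w i : is_weak_partial O j (f i) (g i).
  exact: (weak_partial_mul subO (@cbOmega i) (weak_partial_ess_bounded i j).1 (pu i)).
have c i : {within O, continuous (f i)}.
  apply: within_continuousM; first exact: continuous_subspaceW subO (@cbOmega i).
  apply: continuous_subspaceT; exact: polyfun_continuous.
have -> : (fun x => dot (beta x) (u x)) = fun x => f 0 x + f 1 x + f 2 x.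
  by apply/funext => x; rewrite dotE.
have -> : E j = fun x => g 0 x + g 1 x + g 2 x by apply/funext => x; rewrite /E sum_I3.
apply: is_weak_partialD => //; last exact: is_weak_partialD.
by move=> x; exact: (cvgD (c 0 x) (c 1 x)).
Qed.

(** The scheme uses the derivative chosen on the element, the coercivity assumption those chosen on
    [Omega]; uniqueness reconciles them. *)
Lemma weak_partial_dot j :
  ae3 O [set x | E j x = weak_partial O j (fun y => dot (beta y) (u y)) x].
Proof.
apply: (weak_partial_unique oO (weak_E j)); apply: weak_partialP; exists (E j); exact: weak_E.
Qed.

Lemma weak_partial_dot_ess_bounded j :
  ess_bounded O (weak_partial O j (fun y => dot (beta y) (u y))).
Proof.
apply: (ae_eq_ess_bounded _ (weak_partial_dot j) (E_ess_bounded j)).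
apply: locally_integrable_measurable3 => //.
by case: (weak_partialP (ex_intro _ _ (weak_E j))).
Qed.

(** Summed over [j], the divergence of |u|^2 beta. *)
Definition flux_div j x := B j j x * dot (u x) (u x)
  + beta x 0 j * partial j (fun y => dot (u y) (u y)) x.

Lemma flux_weak_partial j :
  is_weak_partial O j (fun x => beta x 0 j * dot (u x) (u x)) (flux_div j).
Proof.
apply: (weak_partial_mul subO (@cbOmega j) (weak_partial_ess_bounded j j).1).
exact: polyfun_dot.
Qed.

Lemma flux_div_ess_bounded j : ess_bounded O (flux_div j).
Proof.
apply: ess_boundedD; apply: ess_boundedM.
- exact: (weak_partial_ess_bounded j j).2.
- by apply: polyfun_ess_bounded; exact: polyfun_dot.
- exact: beta_ess_bounded.
- by apply: polyfun_ess_bounded; apply: polyfun_partial; exact: polyfun_dot.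
Qed.

Definition advection x := - cross (beta x) (curl u x)
  + weak_grad O (fun y => dot (beta y) (u y)) x.

Lemma advection_ess_bounded i : ess_bounded O (fun x => advection x 0 i).
Proof.
have pc := polyfun_curl pu.
have -> : (fun x => advection x 0 i) = fun x =>
  - (beta x 0 (i + 1) * curl u x 0 (i + 2) + - (beta x 0 (i + 2) * curl u x 0 (i + 1)))
  + weak_partial O i (fun y => dot (beta y) (u y)) x.
  by apply/funext => x; rewrite /advection !mxE.
apply: ess_boundedD (weak_partial_dot_ess_bounded i).
by apply: ess_boundedN; apply: ess_boundedD; [|apply: ess_boundedN]; apply: ess_boundedM => //;
  exact: polyfun_ess_bounded.
Qed.

Lemma advection_coercive rho0 (gamma : vec R -> R) :
  coercivity_assumption Omega rho0 beta gamma ->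
  ae3 O [set x | rho0 * dot (u x) (u x) + 2^-1 * \sum_(j < 3) flux_div j x
                 <= dot (advection x + gamma x *: u x) (u x)].
Proof.
move=> hc; have {hc} hc := ae3_sub subO hc.
have := ae3S2 _ hc (weak_partial_dot 0); move=> /(_ _ (fun x _ a b => conj a b)) h1.
have := ae3S2 _ (weak_partial_dot 1) (weak_partial_dot 2).
move=> /(_ _ (fun x _ a b => conj a b)) h2.
apply: (ae3S2 _ h1 h2) => x _ /= [hl e0] [e1 e2].
set S : 'M[R]_3 := (_ + _) in hl.
have symS : S^T = S.
  by apply/matrixP => i j; rewrite !mxE eq_sym [in LHS](addrC (weak_partial _ i _ _)).
apply: (le_trans (lerD (lambda_min_le symS (u x) hl) (lexx _))).
pose D : 'M[R]_3 := \matrix_(i, j) partial j (fun y => u y 0 i) x.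
have eJ i j : weak_jacobian Omega beta x i j = B i j x by rewrite mxE.
have eD i j : D i j = partial j (fun y => u y 0 i) x by rewrite mxE.
have := advection_identity (beta x) (u x) (weak_jacobian Omega beta x) D (gamma x).
have -> : \row_(i < 3) [:: D 2 1 - D 1 2; D 0 2 - D 2 0; D 1 0 - D 0 1]`_i = curl u x.
  by rewrite curlE !eD.
have -> : \row_(j < 3) \sum_(i < 3) (weak_jacobian Omega beta x i j * u x 0 i + beta x 0 i * D i j)
    = weak_grad O (fun y => dot (beta y) (u y)) x.
  have eE j : \sum_(i < 3) (weak_jacobian Omega beta x i j * u x 0 i + beta x 0 i * D i j) = E j x.
    by apply: eq_bigr => i _; rewrite eJ eD.
  apply/rowP; apply: forall_I3; rewrite mxE eE [RHS]mxE; [exact: e0|exact: e1|exact: e2].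
rewrite -/(advection x) => <-.
have -> : \sum_(i < 3) weak_jacobian Omega beta x i i = weak_div Omega beta x.
  by apply: eq_bigr => i _; rewrite eJ.
rewrite -/S lerD2l ler_pM2l; last by rewrite invr_gt0.
rewrite le_eqVlt; apply/orP; left; apply/eqP; apply: eq_bigr => j _.
rewrite /flux_div partial_sqr_norm // eJ; congr (_ + _ * (2 * _)).
by apply: eq_bigr => i _; rewrite eD.
Qed.

End AdvectionForm.

(** * Fluxes through the facets *)

Section FacetTerms.
Context {R : realType} (M : mesh R).
Notation mR := (measurableTypeR R).
Notation T2 := (mR * mR)%type.
Hypothesis nd : forall t : 'I_(nelem M),
  \det (\matrix_(i < 3) (vtx t (lift 0 i) - vtx t 0)) != 0.
Implicit Types (s : side M) (f g : vec R -> R).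

(** Unlike integrability, stable under products; it covers the facet integrands of the method. *)
Definition facet_bounded s f :=
  measurable_fun (@ref_triangle R : set T2) (f \o facet_param s) /\
  exists C, forall x, facet s x -> `|f x| <= C.

Lemma facet_bounded_integrable s f : facet_bounded s f ->
  (leb2 R).-integrable (@ref_triangle R : set T2) (EFin \o (f \o facet_param s)).
Proof.
move=> [mf [C hC]]; apply: (@bounded_integrable_triangle _ _ C) => // q hq.
by apply: hC; exact: facet_param_in.
Qed.

Lemma eq_facet_bounded s f g : (forall x, facet s x -> f x = g x) ->
  facet_bounded s f -> facet_bounded s g.
Proof.
move=> e [mf [C hC]]; split; last by exists C => x sx; rewrite -e //; exact: hC.
apply: (eq_measurable_fun (f \o facet_param s)) => // q.
by rewrite inE => hq; apply: e; exact: facet_param_in.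
Qed.

Lemma facet_boundedD s f g : facet_bounded s f -> facet_bounded s g ->
  facet_bounded s (fun x => f x + g x).
Proof.
move=> [mf [C hC]] [mg [C' hC']]; split; first exact: measurable_funD.
exists (C + C') => x sx; apply: (le_trans (ler_normD _ _)); exact: lerD (hC _ sx) (hC' _ sx).
Qed.

Lemma facet_boundedM s f g : facet_bounded s f -> facet_bounded s g ->
  facet_bounded s (fun x => f x * g x).
Proof.
move=> [mf [C hC]] [mg [C' hC']]; split; first exact: measurable_funM.
exists (C * C') => x sx; rewrite normrM; exact: ler_pM (normr_ge0 _) (normr_ge0 _) (hC _ sx) (hC' _ sx).
Qed.

Lemma facet_bounded_cst s a : facet_bounded s (fun=> a).
Proof. by split; [exact: measurable_cst|exists `|a| => x _]. Qed.

Lemma facet_bounded_norm s f : facet_bounded s f -> facet_bounded s (fun x => `|f x|).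
Proof.
move=> [mf [C hC]]; split; last by exists C => x sx; rewrite normr_id; exact: hC.
by apply: measurableT_comp => //; exact: measurable_normr.
Qed.

Lemma facet_bounded_within s f : {within elem s.1, continuous f} -> facet_bounded s f.
Proof.
move=> cf; split.
  by case: s cf => t i cf; apply: (@measurable_facet _ _ t (nd t) i f); exact: cf.
have [C [_ hC]] := within_compact_bounded (elem_compact (nd s.1)) cf.
by exists C => x sx; apply: hC; exact: facet_elem sx.
Qed.

Lemma eq_facet_int s f g : (forall x, facet s x -> f x = g x) -> facet_int s f = facet_int s g.
Proof.
move=> e; rewrite /facet_int; congr (_ * _); apply: eq_Rintegral => q.
by rewrite inE => hq; apply: e; exact: facet_param_in.
Qed.

Lemma eq_facet_int_open s f g : facet_bounded s f -> facet_bounded s g ->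
  (forall x, ofacet s x -> f x = g x) -> facet_int s f = facet_int s g.
Proof.
move=> /facet_bounded_integrable fi /facet_bounded_integrable gi e.
rewrite /facet_int; congr (_ * _).
rewrite (Rintegral_open_triangle fi) (Rintegral_open_triangle gi).
apply: eq_Rintegral => q; rewrite inE => hq; apply: e; exact: open_facet_param.
Qed.

Lemma facet_intD s f g : facet_bounded s f -> facet_bounded s g ->
  facet_int s (fun x => f x + g x) = facet_int s f + facet_int s g.
Proof.
move=> /facet_bounded_integrable fi /facet_bounded_integrable gi.
rewrite /facet_int -mulrDr; congr (_ * _).
by apply: RintegralD fi gi; exact: measurable_ref_triangle.
Qed.

Lemma facet_intZ s a f : facet_bounded s f ->
  facet_int s (fun x => a * f x) = a * facet_int s f.
Proof.
move=> /facet_bounded_integrable fi; rewrite /facet_int mulrCA; congr (_ * _).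
by apply: RintegralZl fi; exact: measurable_ref_triangle.
Qed.

Lemma facet_int_ge0 s f : (forall x, 0 <= f x) -> 0 <= facet_int s f.
Proof.
move=> f0; rewrite mulr_ge0 ?enorm_ge0 //; apply: Rintegral_ge0 => q _; exact: f0.
Qed.

End FacetTerms.

Section FluxBalance.
Context {R : realType} (Omega : set (vec R)) (M : mesh R) (k : nat).
Context (beta : vec R -> vec R) (lab : side M -> bool) (alpha : side M -> vec R -> R).
Context (Vh : set (bfield M)) (Cup : R).
Hypotheses (hM : conforming_triangulation Omega M)
  (hbeta : {within closure Omega, continuous beta})
  (hlab : labelling Omega lab)
  (hVh : Hcurl_conforming_space Omega k Vh)
  (halpha : weight_function Omega beta alpha) (hCup : 0 <= Cup)
  (hup : forall s, interior_facet Omega lab s -> forall x, facet s x ->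
     - dot (beta x) (nplus Omega lab s) * alpha_jump Omega lab alpha s x
     >= Cup * `|dot (beta x) (normal s)|).
Implicit Types (s : side M) (u v : bfield M).

Let nd := conforming_ndeg hM.
Let bn s x := dot (beta x) (normal s).

Lemma beta_coord_within i : {within closure Omega, continuous (fun x => beta x 0 i)}.
Proof.
move=> x; apply: (@cvg_comp _ _ _ beta (fun y : vec R => y 0 i) _ (nbhs (beta x)) _ (@hbeta x)).
exact: continuous_coord.
Qed.

Lemma facet_bounded_normal_flux s (n : vec R) : facet_bounded s (fun x => dot (beta x) n).
Proof.
apply: (facet_bounded_within nd).
apply: (@continuous_subspaceW _ _ _ (closure Omega)); first exact: elem_sub_closure.
have -> : (fun x => dot (beta x) n) = (fun x => \sum_(i < 3) beta x 0 i * n 0 i) by [].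
have c i : {within closure Omega, continuous (fun x => beta x 0 i * n 0 i)}.
  apply: within_continuousM; first exact: beta_coord_within.
  apply: continuous_subspaceT; exact: cst_continuous.
move=> x; have -> : (fun x => \sum_(i < 3) beta x 0 i * n 0 i) =
  (fun x => beta x 0 0 * n 0 0 + beta x 0 1 * n 0 1 + beta x 0 2 * n 0 2).
  by apply/funext => y; rewrite sum_I3.
exact: (cvgD (cvgD (c 0 x) (c 1 x)) (c 2 x)).
Qed.

Lemma facet_bounded_dot s t t' u v : Vh u -> Vh v ->
  facet_bounded s (fun x => dot (u t x) (v t' x)).
Proof.
move=> hu hv; apply: (facet_bounded_within nd); apply: continuous_subspaceT.
exact: Vh_dot_continuous hVh _ _ _ _ hu hv.
Qed.

Lemma facet_bounded_alpha s : facet_bounded s (alpha s).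
Proof. by have [[C hC] ma _ _] := halpha; split; [exact: ma|exists C => x; exact: hC]. Qed.

Lemma facet_bounded_jump s t u v : Vh u -> Vh v ->
  facet_bounded s (fun x => dot (jump Omega lab u s x) (v t x)).
Proof.
move=> hu hv; rewrite /jump; case: neighbour => [s'|]; last exact: facet_bounded_dot.
have h a b : facet_bounded s (fun x => dot (u a x - u b x) (v t x)).
  have -> : (fun x => dot (u a x - u b x) (v t x)) =
     fun x => dot (u a x) (v t x) + -1 * dot (u b x) (v t x).
    by apply/funext => x; rewrite dotDl dotNl mulN1r.
  apply: facet_boundedD; first exact: facet_bounded_dot.
  by apply: facet_boundedM; [exact: facet_bounded_cst|exact: facet_bounded_dot].
by case: lab.
Qed.

Lemma facet_bounded_jump_norm s v : Vh v ->
  facet_bounded s (fun x => enorm (jump Omega lab v s x) ^+ 2).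
Proof.
move=> hv.
have h t t' : facet_bounded s (fun x => enorm (v t x - v t' x) ^+ 2).
  have -> : (fun x => enorm (v t x - v t' x) ^+ 2) = fun x => dot (v t x) (v t x) +
      (dot (v t' x) (v t' x) + -2 * dot (v t x) (v t' x)).
    apply/funext => x; rewrite sqr_enorm !(dotDl, dotDr, dotNl, dotNr) (dotC (v t' x)); ring.
  by do ?[apply: facet_boundedD|apply: facet_boundedM|exact: facet_bounded_dot|exact: facet_bounded_cst].
rewrite /jump; case: neighbour => [s'|]; first by case: lab.
have -> : (fun x => enorm (v s.1 x) ^+ 2) = fun x => dot (v s.1 x) (v s.1 x).
  by apply/funext => x; rewrite sqr_enorm.
exact: facet_bounded_dot.
Qed.

Definition lifted_jump v s x := dot (beta x) (nplus Omega lab s) *: jump Omega lab v s x.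

Lemma facet_bounded_lifted s t u v : Vh u -> Vh v ->
  facet_bounded s (fun x => alpha s x * dot (lifted_jump u s x) (v t x)).
Proof.
move=> hu hv; apply: facet_boundedM; first exact: facet_bounded_alpha.
have -> : (fun x => dot (lifted_jump u s x) (v t x)) =
    fun x => dot (beta x) (nplus Omega lab s) * dot (jump Omega lab u s x) (v t x).
  by apply/funext => x; rewrite dotZl.
by apply: facet_boundedM; [exact: facet_bounded_normal_flux|exact: facet_bounded_jump].
Qed.

Lemma lifting_jump t v : Vh v ->
  is_lifting alpha Vh t (lifted_jump v) (lifting alpha Vh (lifted_jump v) t).
Proof.
move=> hv; apply: (liftingP hVh (nd t)) => i w hw.
exact: facet_bounded_integrable (facet_bounded_lifted _ _ hv hw).
Qed.

(** Share of one side in the advection form: half the flux from the divergence theorem, minus the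
    datum of the lifting tested with [v]. *)
Definition side_flux v s x := 2^-1 * (bn s x * dot (v s.1 x) (v s.1 x))
  - alpha s x * dot (lifted_jump v s x) (v s.1 x).

Lemma facet_bounded_flux s v : Vh v ->
  facet_bounded s (fun x => bn s x * dot (v s.1 x) (v s.1 x)).
Proof.
by move=> hv; apply: facet_boundedM; [exact: facet_bounded_normal_flux|exact: facet_bounded_dot].
Qed.

Lemma facet_bounded_side_flux s v : Vh v -> facet_bounded s (side_flux v s).
Proof.
move=> hv; have -> : side_flux v s = fun x => 2^-1 * (bn s x * dot (v s.1 x) (v s.1 x))
  + -1 * (alpha s x * dot (lifted_jump v s x) (v s.1 x)).
  by apply/funext => x; rewrite /side_flux mulN1r.
apply: facet_boundedD; apply: facet_boundedM; try exact: facet_bounded_cst.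
  exact: facet_bounded_flux.
exact: facet_bounded_lifted.
Qed.

Lemma facet_int_side_flux s v : Vh v -> facet_int s (side_flux v s) =
  2^-1 * facet_int s (fun x => bn s x * dot (v s.1 x) (v s.1 x))
  - facet_int s (fun x => alpha s x * dot (lifted_jump v s x) (v s.1 x)).
Proof.
move=> hv; have -> : side_flux v s = fun x => 2^-1 * (bn s x * dot (v s.1 x) (v s.1 x))
  + -1 * (alpha s x * dot (lifted_jump v s x) (v s.1 x)).
  by apply/funext => x; rewrite /side_flux mulN1r.
have h1 := facet_bounded_flux s hv; have h2 := facet_bounded_lifted s s.1 hv hv.
have c a := facet_bounded_cst s a.
rewrite (facet_intD (facet_boundedM (c _) h1) (facet_boundedM (c _) h2)).
by rewrite (facet_intZ _ h1) (facet_intZ _ h2) mulN1r.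
Qed.

(** The integrand is (1/2 - alpha) beta.n |v|^2, and the weight, 0 on outflow and 1 on inflow, gives
    1/2 - alpha the sign of beta.n. *)
Lemma boundary_side_flux s v : Vh v -> boundary_facet Omega s ->
  facet_int s (side_flux v s) =
  2^-1 * facet_int s (fun x => `|bn s x| * enorm (v s.1 x) ^+ 2).
Proof.
move=> hv bs; have [_ _ _ /(_ _ bs) ha] := halpha.
have nN : neighbour Omega s = None by rewrite /neighbour bs.
have h : facet_bounded s (fun x => `|bn s x| * enorm (v s.1 x) ^+ 2).
  apply: facet_boundedM; first by apply: facet_bounded_norm; exact: facet_bounded_normal_flux.
  have -> : (fun x => enorm (v s.1 x) ^+ 2) = fun x => dot (v s.1 x) (v s.1 x).
    by apply/funext => x; rewrite sqr_enorm.
  exact: facet_bounded_dot.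
rewrite -(facet_intZ _ h); apply: eq_facet_int_open.
- exact: facet_bounded_side_flux.
- by apply: facet_boundedM => //; exact: facet_bounded_cst.
move=> x sx; rewrite /side_flux /lifted_jump /nplus /jump nN dotZl (ha _ sx) sqr_enorm -/(bn s x).
by case: (leP 0 (bn s x)) => [b0|b0]; [rewrite ger0_norm|rewrite ltr0_norm] => //; field.
Qed.

(* With a, b the two traces, the integrands add up to (1/2 - alpha) beta.n |a - b|^2. *)
Lemma interior_side_flux s s' v : Vh v -> lab s -> neighbour Omega s = Some s' ->
  facet_int s (side_flux v s) + facet_int s' (side_flux v s') =
  2^-1 * facet_int s (fun x => `|alpha_jump Omega lab alpha s x * bn s x|
                               * enorm (jump Omega lab v s x) ^+ 2).
Proof.
move=> hv ls ns; have ns' := neighbour_sym hM ns.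
have [_ ss' fs] := neighbourP ns.
have ls' : lab s' = false by rewrite (hlab ns) ls.
have nn : normal s' = - normal s by apply: opposite_normals nd (conforming_disj hM) _ _ fs ss'.
have [_ _ /(_ _ _ ns) ha _] := halpha.
pose a x := v s.1 x; pose b x := v s'.1 x.
(* The integrand of [s'] in the data of [s]: the weights sum to 1 and the normals are opposite,
   while [nplus] and the jump are common to both sides. *)
pose g x := 2^-1 * (- bn s x * dot (b x) (b x))
   + -1 * ((1 + -1 * alpha s x) * (bn s x * dot (jump Omega lab v s x) (b x))).
have bbn : facet_bounded s (bn s) by exact: facet_bounded_normal_flux.
have bal : facet_bounded s (alpha s) by exact: facet_bounded_alpha.
have bc c : facet_bounded s (fun=> c) by exact: facet_bounded_cst.
have bg : facet_bounded s g.
  apply: facet_boundedD; apply: facet_boundedM => //.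
    apply: facet_boundedM; last exact: facet_bounded_dot.
    have -> : (fun x => - bn s x) = fun x => -1 * bn s x by apply/funext => x; rewrite mulN1r.
    exact: facet_boundedM.
  apply: facet_boundedM; first by apply: facet_boundedD => //; exact: facet_boundedM.
  by apply: facet_boundedM => //; exact: facet_bounded_jump.
have -> : facet_int s' (side_flux v s') = facet_int s g.
  rewrite -(facet_int_eq nd fs (facet_bounded_integrable bg)).
  apply: eq_facet_int => x s'x.
  have sx : facet s x by rewrite -fs.
  have e : alpha s' x = 1 + -1 * alpha s x by have := ha _ sx; lra.
  rewrite /side_flux /g e /lifted_jump /nplus /jump ns ns' ls ls' dotZl /bn nn dotNr; ring.
rewrite -(facet_intD (facet_bounded_side_flux s hv) bg).
have bj : facet_bounded s (fun x => `|alpha_jump Omega lab alpha s x * bn s x|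
                               * enorm (jump Omega lab v s x) ^+ 2).
  apply: facet_boundedM; last exact: facet_bounded_jump_norm.
  apply: facet_bounded_norm; apply: facet_boundedM => //.
  apply: (@eq_facet_bounded _ _ _ (fun x => 2 * alpha s x + -1)).
    by move=> x sx; rewrite /alpha_jump ns ls; have := ha _ sx; lra.
  by apply: facet_boundedD => //; exact: facet_boundedM.
rewrite -(facet_intZ _ bj); apply: eq_facet_int => x sx.
have := hup (s := s) _ sx; rewrite /interior_facet ns ls => /(_ isT).
have e : alpha s' x = 1 - alpha s x by have := ha _ sx; lra.
rewrite /alpha_jump /nplus ns ls e -/(bn s x) => h.
have h0 : 0 <= Cup * `|bn s x| by rewrite mulr_ge0.
(* By the upwind condition [alpha_jump] times beta.n is nonpositive, so its absolute value is its
   opposite. *)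
rewrite ler0_norm; last by lra.
rewrite /side_flux /g /lifted_jump /nplus sqr_enorm /jump ns ls -/(bn s x) -/(a x) -/(b x).
by rewrite !(dotZl, dotDl, dotDr, dotNl, dotNr) (dotC (b x) (a x)); field.
Qed.

Lemma sum_side_flux v : Vh v -> \sum_s facet_int s (side_flux v s) =
  2^-1 * \sum_(s | interior_facet Omega lab s) facet_int s
      (fun x => `|alpha_jump Omega lab alpha s x * dot (beta x) (normal s)|
                * enorm (jump Omega lab v s x) ^+ 2)
  + 2^-1 * \sum_(s : side M | boundary_facet Omega s) facet_int s
      (fun x => `|dot (beta x) (normal s)| * enorm (v s.1 x) ^+ 2).
Proof.
move=> hv; rewrite (bigID (fun s => boundary_facet Omega s)) /= addrC; congr (_ + _).
  rewrite (sum_interior_sides hM _ hlab) mulr_sumr; apply: eq_bigr => s /andP[].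
  case ns : (neighbour Omega s) => [s'|] // _ ls; exact: interior_side_flux.
by rewrite mulr_sumr; apply: eq_bigr => s; exact: boundary_side_flux.
Qed.

Lemma sum_elem_flux v : Vh v ->
  \sum_t (2^-1 * \sum_(i < 4) facet_int (t, i) (fun x => dot (beta x) (normal (t, i)) * dot (v t x) (v t x))
     - \sum_(i < 4) facet_int (t, i) (fun x => alpha (t, i) x * dot (lifted_jump v (t, i) x) (v t x)))
  = \sum_s facet_int s (side_flux v s).
Proof.
move=> hv; rewrite -(sum_elem_sides (fun s => facet_int s (side_flux v s))); apply: eq_bigr => t _.
rewrite mulr_sumr -sumrB; apply: eq_bigr => i _; by rewrite facet_int_side_flux.
Qed.

End FluxBalance.

(** * Coercivity *)

Section ElementEstimates.
Context {R : realType} (Omega : set (vec R)) (M : mesh R) (k : nat).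
Context (eps rho0 Cinv : R) (beta : vec R -> vec R) (gamma : vec R -> R).
Context (lab : side M -> bool) (alpha : side M -> vec R -> R).
Context (delta : 'I_(nelem M) -> R) (Vh : set (bfield M)).
Hypotheses (hOmega : lipschitz_polyhedral_domain Omega)
  (heps : 0 < eps)
  (hW : forall i, W1infty Omega (fun x => beta x 0 i))
  (hbeta : {within closure Omega, continuous beta})
  (hgamma : Linfty Omega gamma)
  (hrho0 : 0 < rho0)
  (hcoer : coercivity_assumption Omega rho0 beta gamma)
  (hM : conforming_triangulation Omega M)
  (hVh : Hcurl_conforming_space Omega k Vh)
  (hCinv : 0 < Cinv)
  (hinv : inverse_inequality Cinv Vh)
  (halpha : weight_function Omega beta alpha)
  (hdelta0 : forall t, 0 <= delta t)
  (hdelta : forall t,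
     ((delta t)%:E <= delta_bound eps rho0 gamma Cinv t)%E).
Variables (v : bfield M) (hv : Vh v) (t : 'I_(nelem M)).

Let nd := conforming_ndeg hM.
Let O := oelem t.
Let u := v t.
Let oO : open O := @open_oelem _ _ t.
Let mO : measurable_vset O := open_measurable_vset oO.
Let cK : compact (elem t) := elem_compact (nd t).
Let subOK : O `<=` elem t := @oelem_sub _ _ t.
Let subO : O `<=` Omega := oelem_sub_domain hM hOmega.
Let oOmega : open Omega. Proof. by case: hOmega => -[]. Qed.

Let pu i : polyfun (fun x => u x 0 i) := Vh_polyfun hVh t i hv.
Let cbC i : {within closure Omega, continuous (fun x => beta x 0 i)}.
Proof. exact: beta_coord_within. Qed.
Let cbK i : {within elem t, continuous (fun x => beta x 0 i)}.
Proof. apply: continuous_subspaceW (@cbC i); exact: elem_sub_closure. Qed.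
Let cbOmega i : {within Omega, continuous (fun x => beta x 0 i)}.
Proof. apply: continuous_subspaceW (@cbC i); exact: subset_closure. Qed.

Let bdd_integrable f : ess_bounded O f -> integrable3 O f.
Proof. exact: ess_bounded_integrable3 cK subOK mO. Qed.

Let bdd_polyfun p : polyfun p -> ess_bounded O p.
Proof. by move=> /polyfun_continuous; exact: continuous_ess_bounded cK subOK mO. Qed.

Let bdd_u i : ess_bounded O (fun x => u x 0 i). Proof. exact: bdd_polyfun. Qed.

Let bdd_gamma : ess_bounded O gamma.
Proof.
apply: (ess_boundedS mO (open_measurable_vset oOmega) subO); exact: Linfty_ess_bounded.
Qed.

Let L0 := advection O beta u.
Let bdd_L0 i : ess_bounded O (fun x => L0 x 0 i).
Proof. exact: (advection_ess_bounded oOmega oO cK subOK subO (@cbK) (@cbOmega) hW pu). Qed.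

(** The divergence theorem is applied to each component of |u|^2 beta; exchanging the sums assembles
    the normal component on each face. *)
Lemma int3_flux_div :
  int3 O (fun x => \sum_(j < 3) flux_div Omega beta u j x) =
  \sum_(i < 4) facet_int (t, i) (fun x => dot (beta x) (normal (t, i)) * dot (u x) (u x)).
Proof.
have bf j := flux_div_ess_bounded oOmega oO cK subOK subO (@cbK) hW pu j.
rewrite int3_sum //; last by move=> j; exact: bdd_integrable.
pose F j x := beta x 0 j * dot (u x) (u x).
have cF j : {within elem t, continuous (F j)}.
  apply: within_continuousM; first exact: cbK.
  by apply: continuous_subspaceT; apply: polyfun_continuous; exact: polyfun_dot.
transitivity (\sum_(j < 3) \sum_(i < 4) normal (t, i) 0 j * facet_int (t, i) (F j)).
  apply: eq_bigr => j _; apply: (divergence_elem (nd t)); first exact: cF.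
    exact: (flux_weak_partial oOmega oO subO (@cbOmega) hW pu j).
  by apply: bdd_integrable; exact: bf.
rewrite exchange_big /=; apply: eq_bigr => i _.
have bF j : facet_bounded (t, i) (F j) by apply: (facet_bounded_within nd); exact: cF.
have bc j : facet_bounded (t, i) (fun x => normal (t, i) 0 j * F j x).
  by apply: facet_boundedM; [exact: facet_bounded_cst|exact: bF].
rewrite sum_I3 -!(facet_intZ _ (bF _)) -(facet_intD (bc 0) (bc 1)).
rewrite -(facet_intD (facet_boundedD (bc 0) (bc 1)) (bc 2)).
by apply: eq_facet_int => x _; rewrite /F (dotE (beta x)); ring.
Qed.

Lemma advection_elem :
  rho0 * L2ip O u u + 2^-1 * \sum_(i < 4) facet_int (t, i)
    (fun x => dot (beta x) (normal (t, i)) * dot (u x) (u x))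
  <= L2ip O (fun x => L0 x + gamma x *: u x) u.
Proof.
have bf j := flux_div_ess_bounded oOmega oO cK subOK subO (@cbK) hW pu j.
have bs : ess_bounded O (fun x => \sum_(j < 3) flux_div Omega beta u j x).
  exact: (@ess_bounded_sum _ _ _ (fun j x => flux_div Omega beta u j x)).
have bu : ess_bounded O (fun x => dot (u x) (u x)) by exact: ess_bounded_dot.
rewrite -int3_flux_div /L2ip -!int3Zl //; try exact: bdd_integrable.
rewrite -int3D //; try by apply: bdd_integrable; apply: ess_boundedM => //; exact: ess_bounded_cst.
apply: ae_le_int3 => //.
- by apply: bdd_integrable; apply: ess_boundedD; apply: ess_boundedM => //; exact: ess_bounded_cst.
- apply: bdd_integrable; apply: ess_bounded_dot => // i.
  have -> : (fun x => (L0 x + gamma x *: u x) 0 i) = fun x => L0 x 0 i + gamma x * u x 0 i.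
    by apply/funext => x; rewrite !mxE.
  by apply: ess_boundedD => //; exact: ess_boundedM.
exact: (advection_coercive oOmega oO subO (@cbOmega) hW pu hcoer).
Qed.

Let r := lifting alpha Vh (lifted_jump Omega beta lab v) t.
Let L := Ltilde Omega beta lab alpha Vh v t.
Let LE x : L x = L0 x - r x. Proof. by []. Qed.

Let r_lifting : is_lifting alpha Vh t (lifted_jump Omega beta lab v) r.
Proof. exact: (lifting_jump lab hM (@hbeta) hVh halpha t hv). Qed.

Let bdd_r i : ess_bounded O (fun x => r x 0 i).
Proof.
have [[w hw ->] _] := r_lifting; apply: bdd_polyfun; exact: (Vh_polyfun hVh t i hw).
Qed.

Let bdd_L i : ess_bounded O (fun x => L x 0 i).
Proof.
have -> : (fun x => L x 0 i) = fun x => L0 x 0 i + - r x 0 i.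
  by apply/funext => x; rewrite LE !mxE.
by apply: ess_boundedD => //; apply: ess_boundedN.
Qed.

Lemma advection_lifting_elem :
  rho0 * L2ip O u u
  + (2^-1 * \sum_(i < 4) facet_int (t, i)
      (fun x => dot (beta x) (normal (t, i)) * dot (v t x) (v t x))
     - \sum_(i < 4) facet_int (t, i)
         (fun x => alpha (t, i) x * dot (lifted_jump Omega beta lab v (t, i) x) (v t x)))
  <= L2ip O (fun x => L x + gamma x *: u x) u.
Proof.
(* The identity defining the lifting, tested with [v] itself, turns the facet terms into a volume
   integral. *)
have [_ /(_ v hv) <-] := r_lifting.
have bru : ess_bounded O (fun x => dot (r x) (u x)) by exact: ess_bounded_dot.
have b0 : ess_bounded O (fun x => dot (L0 x + gamma x *: u x) (u x)).
  apply: ess_bounded_dot => // i.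
  have -> : (fun x => (L0 x + gamma x *: u x) 0 i) = fun x => L0 x 0 i + gamma x * u x 0 i.
    by apply/funext => x; rewrite !mxE.
  by apply: ess_boundedD => //; exact: ess_boundedM.
have -> : L2ip O (fun x => L x + gamma x *: u x) u =
    L2ip O (fun x => L0 x + gamma x *: u x) u - L2ip O r u.
  rewrite /L2ip -int3B //; try exact: bdd_integrable.
  by apply: eq_int3 => x _; rewrite LE addrAC dotDl dotNl.
rewrite addrA lerD2r; exact: advection_elem.
Qed.

Lemma L2ip_ge0 (f : vec R -> vec R) : (forall i, ess_bounded O (fun x => f x 0 i)) ->
  0 <= L2ip O f f.
Proof.
move=> bf; apply: ge0_int3_ae => //; first by case: (ess_bounded_dot bf bf).
by apply: ae3W => x _ /=; exact: dot_ge0.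
Qed.

Lemma curlZ (a : R) (f : vec R -> vec R) x : (forall i, polyfun (fun y => f y 0 i)) ->
  curl (fun y => a *: f y) x = a *: curl f x.
Proof.
move=> pf; have e i j : partial j (fun y => (a *: f y) 0 i) x = a * partial j (fun y => f y 0 i) x.
  have -> : (fun y => (a *: f y) 0 i) = a \*: (fun y => f y 0 i).
    by apply/funext => y; rewrite mxE.
  rewrite /partial deriveZ //; exact: polyfun_derivable.
by apply/rowP => i; rewrite !mxE !e; ring.
Qed.

Let c := curl u.
Let cc := curl c.
Let pc := polyfun_curl pu.
Let bdd_c i : ess_bounded O (fun x => c x 0 i). Proof. exact: bdd_polyfun. Qed.
Let bdd_cc i : ess_bounded O (fun x => cc x 0 i).
Proof. by apply: bdd_polyfun; exact: polyfun_curl. Qed.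

Lemma diffusion_elem : L2ip O (fun x => eps *: c x) c = eps * L2ip O c c.
Proof.
rewrite /L2ip -int3Zl //; last by apply: bdd_integrable; exact: ess_bounded_dot.
by apply: eq_int3 => x _; rewrite dotZl.
Qed.

(** The first bound on delta is the reciprocal of the squared constant of the inverse inequality,
    times 1/(2 eps); against eps^2 this leaves eps/2. *)
Lemma curl_curl_elem : delta t * eps ^+ 2 * L2ip O cc cc <= eps / 2 * L2ip O c c.
Proof.
have c0 := L2ip_ge0 bdd_c; have cc0 := L2ip_ge0 bdd_cc.
have := hinv t hv; rewrite -/O -/u -/c -/cc /L2norm => hi.
have d1 : delta t <= diam (elem t) ^+ 2 / (2 * Cinv ^+ 2 * eps).
  by have := hdelta t; rewrite /delta_bound le_min lee_fin => /andP[].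
move: (L2ip O cc cc) (L2ip O c c) c0 cc0 hi d1 (hdelta0 t) => A C c0 cc0 hi d1 dp.
(* For a diameter 0 the bound forces [delta t = 0]; otherwise the powers of the diameter cancel. *)
have [h0|h0] := eqVneq (diam (elem t)) 0.
  have -> : delta t = 0.
    by apply/eqP; rewrite eq_le dp andbT (le_trans d1) // h0 expr0n mul0r.
  by rewrite !mul0r mulr_ge0 // divr_ge0 // ltW.
have hi2 : A <= Cinv ^+ 2 * (diam (elem t))^-1 ^+ 2 * C.
  rewrite -{1}(sqr_sqrtr cc0) -(sqr_sqrtr c0) -!exprMn.
  rewrite lerXn2r ?nnegrE ?sqrtr_ge0 //; apply: le_trans hi; exact: sqrtr_ge0.
apply: (le_trans (y := diam (elem t) ^+ 2 / (2 * Cinv ^+ 2 * eps) * eps ^+ 2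
    * (Cinv ^+ 2 * (diam (elem t))^-1 ^+ 2 * C))).
  apply: ler_pM => //; first by rewrite mulr_ge0 // sqr_ge0.
  by rewrite ler_wpM2r // sqr_ge0.
by rewrite le_eqVlt; apply/orP; left; apply/eqP; field; rewrite h0 !gt_eqF.
Qed.

Let G := fine (Linfty_norm O gamma).

Lemma gamma_elem : ae3 O [set x | `|gamma x| <= G] /\ delta t * G ^+ 2 <= rho0 / 2.
Proof.
have [_ [C hC]] := bdd_gamma.
have hC' : ae3 O [set x | `|gamma x| <= Num.max C 0].
  by apply: ae3S hC => x _ /= h; rewrite le_max h.
have m0 : 0 <= Num.max C 0 by rewrite le_max lexx orbT.
have /andP[n0 n1] := Linfty_norm_le m0 hC'.
have nf : (Linfty_norm O gamma < +oo)%E by exact: le_lt_trans n1 (ltry _).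
split; first exact: Linfty_ae.
have := hdelta t; rewrite /delta_bound le_min => /andP[_].
(* For a vanishing norm the bound on delta is +oo, but then the left side is 0. *)
rewrite /G -/O; case: eqP => [-> _|/eqP nz].
  by rewrite expr0n mulr0 divr_ge0 // ltW.
have gn : fine (Linfty_norm O gamma) != 0 by rewrite fine_eq0 // ge0_fin_numE.
have g0 : 0 < fine (Linfty_norm O gamma) ^+ 2 by rewrite exprn_even_gt0.
rewrite lee_fin => h; have := ler_wpM2r (ltW g0) h; congr (_ <= _).
by field.
Qed.

(** Young's inequality is applied pointwise, with [gamma] replaced by its essential bound [G]; the
    losses are then integrated and absorbed by [curl_curl_elem] and [gamma_elem]. *)
Lemma stabilization_elem :
  2^-1 * (delta t * L2norm O L ^+ 2) - eps / 2 * L2ip O c c - rho0 / 2 * L2ip O u u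
  <= L2ip O (Atilde Omega eps beta gamma lab alpha Vh v t) (fun x => delta t *: L x).
Proof.
have [hG dG] := gamma_elem.
have L0' := L2ip_ge0 bdd_L; have c0 := L2ip_ge0 bdd_c; have u0 := L2ip_ge0 bdd_u.
rewrite /L2norm sqr_sqrtr //.
have bLL := ess_bounded_dot bdd_L bdd_L; have bcc := ess_bounded_dot bdd_cc bdd_cc.
have buu := ess_bounded_dot bdd_u bdd_u; have bcL := ess_bounded_dot bdd_cc bdd_L.
have buL := ess_bounded_dot bdd_u bdd_L.
have bk a := @ess_bounded_cst R O a.
apply: (le_trans (y := int3 O (fun x => 2^-1 * delta t * dot (L x) (L x)
   + (- (delta t * eps ^+ 2) * dot (cc x) (cc x) + - (delta t * G ^+ 2) * dot (u x) (u x))))).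
  rewrite !int3D ?int3Zl //; do ?[apply: bdd_integrable|exact: bLL|exact: bcc|exact: buu|exact: ess_boundedM|apply: ess_boundedD].
  rewrite -[int3 O (fun x => dot (L x) (L x))]/(L2ip O L L).
  rewrite -[int3 O (fun x => dot (cc x) (cc x))]/(L2ip O cc cc).
  rewrite -[int3 O (fun x => dot (u x) (u x))]/(L2ip O u u).
  move: curl_curl_elem (ler_wpM2r u0 dG).
  move: (L2ip O L L) (L2ip O cc cc) (L2ip O u u) (L2ip O c c) => X1 X2 X3 X4 h1 h2.
  lra.
have e : L2ip O (Atilde Omega eps beta gamma lab alpha Vh v t) (fun x => delta t *: L x)
  = int3 O (fun x => delta t * (eps * dot (cc x) (L x) + (dot (L x) (L x) + gamma x * dot (u x) (L x)))).
  have aux (g d : R) (a b e l : vec R) : dot (eps *: a + b + g *: e) (d *: l) =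
      d * (eps * dot a l + (dot b l + g * dot e l)).
    by rewrite dotZr !dotDl !dotZl addrA.
  by apply: eq_int3 => x _; rewrite /Atilde curlZ //; exact: aux.
rewrite e; apply: ae_le_int3 => //.
- by apply: bdd_integrable; do ?[exact: ess_boundedM|apply: ess_boundedD].
- apply: bdd_integrable; apply: ess_boundedM => //.
  by do ?[exact: ess_boundedM|apply: ess_boundedD].
apply: ae3S hG => x _ /= gx.
have d0 := hdelta0 t.
move: (delta t) (cc x) (L x) (u x) (gamma x) gx d0 => d a l w g gx d0.
(* Completed squares: a cross term a.l is at least -|a|^2 - |l|^2/4. The two cross terms together
   use half of the square of [l]. *)
have y1 := dot_ge0 (eps *: a + 2^-1 *: l).
have y2 := dot_ge0 (g *: w + 2^-1 *: l).
have g2 : g ^+ 2 * dot w w <= G ^+ 2 * dot w w.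
  apply: ler_wpM2r; first exact: dot_ge0.
  by rewrite -[leLHS]real_normK ?num_real // lerXn2r // ?nnegrE // (le_trans _ gx).
rewrite !(dotDl, dotDr, dotZl, dotZr) (dotC l a) (dotC l w) in y1 y2.
have {}y1 : 0 <= eps ^+ 2 * dot a a + eps * dot a l + 4^-1 * dot l l by lra.
have {}y2 : 0 <= g ^+ 2 * dot w w + g * dot w l + 4^-1 * dot l l by lra.
rewrite -subr_ge0.
have -> : d * (eps * dot a l + (dot l l + g * dot w l)) -
   (2^-1 * d * dot l l + (- (d * eps ^+ 2) * dot a a + - (d * G ^+ 2) * dot w w)) =
   d * (eps * dot a l + g * dot w l + 2^-1 * dot l l + eps ^+ 2 * dot a a + G ^+ 2 * dot w w).
  by field.
by apply: mulr_ge0 => //; lra.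
Qed.

End ElementEstimates.

Theorem lemma5 (R : realType) (Omega : set (vec R))
  (eps rho0 sigma Cinv Cup : R) (k : nat)
  (beta : vec R -> vec R) (gamma : vec R -> R)
  (M : mesh R) (lab : side M -> bool) (alpha : side M -> vec R -> R)
  (delta : 'I_(nelem M) -> R) (Vh : set (bfield M))
  (hOmega : lipschitz_polyhedral_domain Omega)
  (heps : 0 < eps)
  (hbeta : forall i, W1infty Omega (fun x => beta x 0 i))
  (hbeta_rep : {within closure Omega, continuous beta})
  (hgamma : Linfty Omega gamma)
  (hrho0 : 0 < rho0)
  (hcoer : coercivity_assumption Omega rho0 beta gamma)
  (hM : conforming_triangulation Omega M)
  (hsigma : shape_regular M sigma)
  (hsplit : boundary_facets_split Omega M beta)
  (hlab : labelling Omega lab)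
  (hVh : Hcurl_conforming_space Omega k Vh)
  (hCinv : 0 < Cinv)
  (hinv : inverse_inequality Cinv Vh)
  (halpha : weight_function Omega beta alpha)
  (hCup : 0 < Cup)
  (hup : forall s, interior_facet Omega lab s -> forall x, facet s x ->
     - dot (beta x) (nplus Omega lab s) * alpha_jump Omega lab alpha s x
     >= Cup * `|dot (beta x) (normal s)|)
  (hdelta0 : forall t, 0 <= delta t)
  (hdelta : forall t,
     ((delta t)%:E <= delta_bound eps rho0 gamma Cinv t)%E) :
  forall v, Vh v ->
    a_h Omega eps beta gamma lab alpha delta Vh v v
    >= 2^-1 * energy_sq Omega eps rho0 beta lab alpha delta Vh v.
Proof.
move=> v hv.
have flux := etrans (sum_elem_flux lab hM (@hbeta_rep) hVh halpha hv)
  (sum_side_flux hM (@hbeta_rep) hlab hVh halpha (ltW hCup) hup hv).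
pose F t := 2^-1 * \sum_(i < 4) facet_int (t, i)
      (fun x => dot (beta x) (normal (t, i)) * dot (v t x) (v t x))
    - \sum_(i < 4) facet_int (t, i)
        (fun x => alpha (t, i) x * dot (lifted_jump Omega beta lab v (t, i) x) (v t x)).
rewrite -[\sum_t _]/(\sum_t F t) in flux.
rewrite /energy_sq.
set J := \sum_(s | interior_facet _ _ _) _ in flux *.
set B := \sum_(s | boundary_facet _ _) _ in flux *.
have J0 : 0 <= J.
  by apply: sumr_ge0 => s _; apply: facet_int_ge0 => x; rewrite mulr_ge0 // sqr_ge0.
have B0 : 0 <= B.
  by apply: sumr_ge0 => s _; apply: facet_int_ge0 => x; rewrite mulr_ge0 // sqr_ge0.
pose c t := L2ip (oelem t) (curl (v t)) (curl (v t)).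
pose m t := L2ip (oelem t) (v t) (v t).
pose l t := delta t * L2norm (oelem t) (Ltilde Omega beta lab alpha Vh v t) ^+ 2.
pose n t := L2ip (oelem t) (fun x => Ltilde Omega beta lab alpha Vh v t x + gamma x *: v t x) (v t).
pose p t := L2ip (oelem t) (Atilde Omega eps beta gamma lab alpha Vh v t)
  (fun x => delta t *: Ltilde Omega beta lab alpha Vh v t x).
have hn t : rho0 * m t + F t <= n t.
  exact: (advection_lifting_elem (@lab) hOmega hbeta (@hbeta_rep) hgamma hcoer hM hVh halpha hv t).
have hp t : 2^-1 * l t - eps / 2 * c t - rho0 / 2 * m t <= p t.
  exact: (stabilization_elem (@lab) hOmega heps hbeta (@hbeta_rep) hgamma hrho0 hM hVh hCinv hinv halpha hdelta0 hdelta hv t).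
have -> : a_h Omega eps beta gamma lab alpha delta Vh v v = \sum_t (eps * c t + n t + p t).
  rewrite !big_split /=; congr (_ + _ + _).
  apply: eq_bigr => t _; exact: (diffusion_elem eps hM hVh hv t).
have -> : 2^-1 * (eps * bip (bcurl v) (bcurl v) + rho0 * bip v v + \sum_t l t + 2^-1 * J + 2^-1 * B)
  = \sum_t (2^-1 * eps * c t + 2^-1 * rho0 * m t + 2^-1 * l t) + 2^-1 * (2^-1 * J + 2^-1 * B).
  rewrite !big_split /= -!mulr_sumr /bip -/c -/m; ring.
(* The fluxes supply the facet terms of the energy in full, of which half is kept. *)
have : 2^-1 * (2^-1 * J + 2^-1 * B) <= \sum_t F t by rewrite flux; lra.
move=> h; apply: (le_trans (lerD (lexx _) h)); rewrite -big_split /=.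
(* On each element diffusion and advection give [eps * c t + rho0 * m t], the stabilization takes
   back half of each, and half of [l t] remains. *)
apply: ler_sum => t _; have := hn t; have := hp t.
move: (F t) (c t) (m t) (l t) (n t) (p t) => *; lra.
Qed.
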